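(* Let $\mathcal H$ be a complex Hilbert space of finite dimension $d\ge 2$, let $P$ be a nonzero orthogonal projection on $\mathcal H$, let $n=d-\operatorname{rank}P$, and let $\lambda=(r_1,\dots,r_k)$ be a complementary rank profile (an integer partition of $n$). If $n=0$, then $P=I$ and $\mathfrak M_{P,\lambda}$ is a point. Suppose $n\ge 1$. For each $s\ge 1$, let $m_s$ be the multiplicity of the part $s$ in $\lambda$. Then, noncanonically, $$\mathfrak M_{P,\lambda}\cong \mathcal U(n)\Big/\prod_{s:\,m_s>0}\left(\mathcal U(s)^{m_s}\rtimes S_{m_s}\right).$$ In particular, $\mathfrak M_{P,\lambda}$ is a compact smooth homogeneous space with $$\dim_{\mathbb R}\mathfrak M_{P,\lambda}=n^2-\sum_{s:\,m_s>0}m_s s^2=n^2-\sum_{j=1}^k r_j^2.$$ Thus $\mathfrak M_P$ is a finite disjoint union of compact homogeneous spaces indexed by the integer partitions of $n$.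
   Context: A projective measurement on $\mathcal H$ is an unordered finite family (set) $\mathsf M=\{P_1,\dots,P_m\}$ of nonzero pairwise orthogonal orthogonal projections on $\mathcal H$ with $\sum_{j=1}^m P_j=I$. $\mathfrak M(\mathcal H)$ is the set of all projective measurements, and $\mathfrak M_P=\{\mathsf M\in\mathfrak M(\mathcal H):P\in\mathsf M\}$. For $P\in\mathsf M$, the complementary rank profile $\lambda_P(\mathsf M)$ is the nondecreasing tuple listing (with multiplicity) the ranks of the projections in $\mathsf M\setminus\{P\}$; it is an integer partition of $d-\operatorname{rank}P$ (empty if $P=I$). For a profile $\lambda$, $\mathfrak M_{P,\lambda}=\{\mathsf M\in\mathfrak M_P:\lambda_P(\mathsf M)=\lambda\}$. $P^\perp$ denotes $\operatorname{ran}(I-P)$, of dimension $n$. The group $G_P=\{U\in\mathcal U(\mathcal H):Ux=x\text{ for every }x\in\operatorname{ran}P\}$ is identified by restriction with $\mathcal U(P^\perp)$, and (after choosing an orthonormal basis of $P^\perp$) with the group $\mathcal U(n)$ of unitary $n\times n$ matrices; it acts on $\mathfrak M_{P,\lambda}$ by $U\cdot\mathsf M=\{UQU^*:Q\in\mathsf M\}$, and the isomorphism is one of homogeneous spaces for this action. The group $\prod_{s:m_s>0}(\mathcal U(s)^{m_s}\rtimes S_{m_s})$ is regarded as the closed subgroup of $\mathcal U(n)$ that is the setwise stabilizer of a reference orthogonal decomposition of $P^\perp\cong\mathbb C^n$ into blocks with dimensions $r_1,\dots,r_k$: it consists of arbitrary unitary changes of basis within each block together with permutations of blocks of equal dimension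 (the symmetric group $S_{m_s}$ permuting the $m_s$ blocks of dimension $s$). The quotient of $\mathcal U(n)$ by this closed subgroup carries the standard smooth manifold structure for which the quotient projection is a submersion. *)

(* Defs.v *)
From HB Require Import structures.
From mathcomp Require Import all_boot all_order all_fingroup all_algebra.
From mathcomp Require Import finmap complex.
From mathcomp Require Import all_classical all_reals all_analysis.
From mathcomp Require Import sesquilinear spectral.

Set Implicit Arguments.
Unset Strict Implicit.
Unset Printing Implicit Defensive.

Import Order.TTheory GRing.Theory Num.Theory.
Import numFieldNormedType.Exports.

Local Open Scope classical_set_scope.
Local Open Scope ring_scope.
Local Open Scope sesquilinear_scope.
Local Open Scope quotient_scope.

Section Smooth.
Context {R : realType}.

Definition iter_partial (W : normedModType R) N (s : seq 'I_N)
    (f : 'rV[R]_N -> W) : 'rV[R]_N -> W :=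
  foldr (fun i g => fun x => 'D_(delta_mx 0 i) g x) f s.

(* C^oo on an open set D: every iterated partial derivative is Frechet
   differentiable at every point of D.  Only the germs of f at points of D
   matter, so f may take arbitrary values outside D. *)
Definition smooth_on (W : normedModType R) N (D : set 'rV[R]_N)
    (f : 'rV[R]_N -> W) :=
  forall (s : seq 'I_N) x, D x -> differentiable (iter_partial s f) x.

(* [chart_map] matters only on [chart_dom], [chart_inv] only on its image. *)
Record chart (X : topologicalType) N := Chart {
  chart_dom : set X;
  chart_map : X -> 'rV[R]_N;
  chart_inv : 'rV[R]_N -> X }.

Definition chart_img (X : topologicalType) N (c : chart X N) :=
  chart_map c @` chart_dom c.

Definition is_chart (X : topologicalType) N (c : chart X N) :=
  [/\ open (chart_dom c),
      open (chart_img c),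
      forall x, chart_dom c x -> chart_inv c (chart_map c x) = x,
      {within chart_dom c, continuous (chart_map c)} &
      {within chart_img c, continuous (chart_inv c)}].

Definition smooth_atlas (X : topologicalType) N (A : set (chart X N)) :=
  [/\ forall c, A c -> is_chart c,
      forall x, exists2 c, A c & chart_dom c x &
      forall c c', A c -> A c' ->
        smooth_on (chart_map c @` (chart_dom c `&` chart_dom c'))
                  (chart_map c' \o chart_inv c)].

Definition smooth_manifold (X : topologicalType) N (A : set (chart X N)) :=
  [/\ hausdorff_space X, @second_countable X & smooth_atlas A].

Definition smooth_map (X Y : topologicalType) N M (A : set (chart X N))
    (B : set (chart Y M)) (f : X -> Y) :=
  continuous f /\
  forall c c', A c -> B c' ->
    smooth_on (chart_map c @` (chart_dom c `&` f @^-1` chart_dom c'))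
              (chart_map c' \o f \o chart_inv c).

Definition smooth_submersion (X Y : topologicalType) N M
    (A : set (chart X N)) (B : set (chart Y M)) (f : X -> Y) :=
  smooth_map A B f /\
  forall c c' x, A c -> B c' -> chart_dom c x -> chart_dom c' (f x) ->
    forall w : 'rV[R]_M, exists v : 'rV[R]_N,
      'd (chart_map c' \o f \o chart_inv c) (chart_map c x) v = w.

Definition prod_chart (X Y : topologicalType) N M (c : chart X N)
    (c' : chart Y M) : chart (X * Y)%type (N + M) :=
  Chart (chart_dom c `*` chart_dom c')
        (fun p => row_mx (chart_map c p.1) (chart_map c' p.2))
        (fun v => (chart_inv c (lsubmx v), chart_inv c' (rsubmx v))).

Definition prod_atlas (X Y : topologicalType) N M (A : set (chart X N))
    (B : set (chart Y M)) : set (chart (X * Y)%type (N + M)) :=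
  [set prod_chart c c' | c in A & c' in B].

(* The smooth structure of X viewed, through iota, as an N-dimensional
   submanifold of R^k: the charts are the diffeomorphisms from open pieces of X
   onto open subsets of R^N, a map defined on a piece of X being smooth when it
   extends locally to a smooth map on an open subset of R^k. *)
Definition submanifold_atlas (X : topologicalType) k (iota : X -> 'rV[R]_k) N
    : set (chart X N) :=
  [set c | [/\ is_chart c,
    smooth_on (chart_img c) (iota \o chart_inv c) &
    forall x, chart_dom c x ->
      exists (W : set 'rV[R]_k) (F : 'rV[R]_k -> 'rV[R]_N),
        [/\ open W, W (iota x), smooth_on W F &
            forall y, chart_dom c y -> W (iota y) ->
              F (iota y) = chart_map c y]]].

End Smooth.

Arguments chart R X N : clear implicits.

Section Unitary.
Context (R : realType) (n : nat).

Definition unitary : Type := {A : 'M[R[i]]_n | A \is unitarymx}.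

HB.instance Definition _ := [isSub of unitary for @sval _ _].
HB.instance Definition _ := [Choice of unitary by <:].

Definition unitary_mul (A B : unitary) : unitary :=
  exist _ (val A *m val B) (mul_unitarymx (valP A) (valP B)).

Lemma unitary_inv_subproof (A : unitary) : (val A)^t* \is unitarymx.
Proof. by rewrite trmxC_unitary; exact: valP. Qed.

Definition unitary_inv (A : unitary) : unitary :=
  exist _ ((val A)^t*) (unitary_inv_subproof A).

Lemma unitary_one_subproof : (1%:M : 'M[R[i]]_n) \is unitarymx.
Proof. by apply/unitarymxP; rewrite trmx1 map_mx1 mulmx1. Qed.

Definition unitary_one : unitary := exist _ 1%:M unitary_one_subproof.

Lemma unitary_mulA : associative unitary_mul.
Proof. by move=> A B C; apply: val_inj; rewrite /= mulmxA. Qed.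

Lemma unitary_mul1 : left_id unitary_one unitary_mul.
Proof. by move=> A; apply: val_inj; rewrite /= mul1mx. Qed.

Lemma unitary_1mul : right_id unitary_one unitary_mul.
Proof. by move=> A; apply: val_inj; rewrite /= mulmx1. Qed.

Lemma unitary_mulV : right_inverse unitary_one unitary_inv unitary_mul.
Proof. by move=> A; apply: val_inj; apply/unitarymxP; exact: valP. Qed.

Lemma unitary_Vmul : left_inverse unitary_one unitary_inv unitary_mul.
Proof. by move=> A; apply: val_inj; apply: mulmx1C; apply/unitarymxP; exact: valP. Qed.

HB.instance Definition _ := isGroup.Build unitary
  unitary_mulA unitary_mul1 unitary_1mul unitary_Vmul unitary_mulV.

(* M_n(C) as R^(2 n^2). *)
Definition realify (A : 'M[R[i]]_n) : 'rV[R]_(n * n + n * n) :=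
  row_mx (mxvec (map_mx (@complex.Re R) A)) (mxvec (map_mx (@complex.Im R) A)).

Definition unitary_embed (U : unitary) := realify (val U).

HB.instance Definition _ :=
  Topological.copy unitary (initial_topology unitary_embed).

Definition unitary_atlas : set (chart R unitary (n ^ 2)%N) :=
  @submanifold_atlas R unitary (n * n + n * n) unitary_embed (n ^ 2)%N.

Definition unitary_is_lie_group :=
  [/\ smooth_manifold unitary_atlas,
      smooth_map (prod_atlas unitary_atlas unitary_atlas) unitary_atlas
                 (fun p : unitary * unitary => (p.1 * p.2)%g) &
      smooth_map unitary_atlas unitary_atlas (fun U : unitary => (U^-1)%g)].

Definition smooth_homogeneous_space (X : topologicalType) N
    (A : set (chart R X N)) (act : unitary -> X -> X) :=
  [/\ unitary_is_lie_group,
      smooth_manifold A,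
      (forall x, act 1%g x = x) /\
      (forall U V x, act (U * V)%g x = act U (act V x)),
      (exists x : X, True) /\ (forall x y, exists U, act U x = y) &
      smooth_map (prod_atlas unitary_atlas A) A
                 (fun p : unitary * X => act p.1 p.2)].

End Unitary.

Arguments unitary_atlas : clear implicits.

Definition is_partition (n : nat) (lam : seq nat) :=
  [/\ sorted leq lam, 0%N \notin lam & sumn lam = n].

Section BlockGroup.
Context (R : realType) (n : nat) (lam : seq nat).

(* When lam is a partition of n, the coordinates 0, ..., n-1 are cut into
   consecutive intervals of lengths r_1, ..., r_k, and [reshape_index lam i] is
   the number of the interval containing i. *)
Definition block (j : nat) : set 'cV[R[i]]_n :=
  [set v | forall i : 'I_n, reshape_index lam i != j -> v i 0 = 0].

Definition decomposition : set (set 'cV[R[i]]_n) :=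
  [set block j | j in [set j | (j < size lam)%N]].

(* The setwise stabilizer of the decomposition: its elements may permute the
   blocks. *)
Definition block_group : set (unitary R n) :=
  [set U | [set (fun v => val U *m v) @` E | E in decomposition]
           = decomposition].

Definition same_coset (U V : unitary R n) : bool :=
  `[< block_group (U^-1 * V)%g >].

Let act (U : unitary R n) (D : set (set 'cV[R[i]]_n)) :=
  [set (fun v => val U *m v) @` E | E in D].

Let actM U V D : act (U * V)%g D = act U (act V D).
Proof.
rewrite /act [RHS]image_comp; congr image; apply/funext => E /=.
by rewrite [RHS]image_comp; congr image; apply/funext => v /=; rewrite mulmxA.
Qed.

Let act1 D : act 1%g D = D.
Proof.
rewrite /act -[RHS]image_id; congr image; apply/funext => E /=.
by rewrite -[RHS]image_id; congr image; apply/funext => v /=; rewrite mul1mx.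
Qed.

Lemma same_coset_refl : reflexive same_coset.
Proof. by move=> U; apply/asboolP; rewrite mulVg; exact: act1. Qed.

Lemma same_coset_sym : symmetric same_coset.
Proof.
suff H U V : same_coset U V -> same_coset V U by move=> U V; apply/idP/idP; exact: H.
move=> /asboolP UV; apply/asboolP.
have -> : (V^-1 * U = (U^-1 * V)^-1)%g by rewrite invMg invgK.
change (act (U^-1 * V)^-1%g decomposition = decomposition).
by rewrite -{1}(UV : act _ decomposition = _) -actM mulVg act1.
Qed.

Lemma same_coset_trans : transitive same_coset.
Proof.
move=> V U W /asboolP UV /asboolP VW; apply/asboolP.
have -> : (U^-1 * W = (U^-1 * V) * (V^-1 * W))%g by rewrite mulgA mulgK.
change (act (U^-1 * V * (V^-1 * W))%g decomposition = decomposition).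
by rewrite actM (VW : act _ decomposition = _) (UV : act _ decomposition = _).
Qed.

Canonical same_coset_equiv :=
  EquivRel same_coset same_coset_refl same_coset_sym same_coset_trans.

Definition block_quotient : topologicalType :=
  quotient_topology {eq_quot same_coset_equiv}.

Definition coset_of_unitary (U : unitary R n) : block_quotient :=
  \pi_block_quotient U.

(* U(s)^m \rtimes S_m. *)
Definition wreath (s m : nat) : Type :=
  (('I_m -> unitary R s) * {perm 'I_m})%type.

(* (u, sigma) sends the j-th block to the (sigma j)-th one through
   u (sigma j); recall that (t * s)%g is s \o t. *)
Definition wreath_mul s m (x y : wreath s m) : wreath s m :=
  (fun i => (x.1 i * y.1 ((x.2)^-1%g i))%g, (y.2 * x.2)%g).

(* The index set is {s | s occurs in lam}, i.e. m_s > 0. *)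
Definition wreath_prod : Type :=
  forall s : seq_sub lam, wreath (val s) (count_mem (val s) lam).

Definition wreath_prod_mul (x y : wreath_prod) : wreath_prod :=
  fun s => wreath_mul (x s) (y s).

Definition block_group_is_wreath_prod :=
  exists h : wreath_prod -> unitary R n,
    [/\ injective h,
        forall x y, h (wreath_prod_mul x y) = (h x * h y)%g &
        range h = block_group].

End BlockGroup.

Arguments block_group : clear implicits.
Arguments block_group_is_wreath_prod : clear implicits.

Section Measurements.
Context (R : realType) (H : vectType R[i]) (dot : {dot H for Num.conj}).

(* In finite dimension the adjoint exists and is unique, so the default value of
   [xget] is never used. *)
Definition adjoint (A : 'End(H)) : 'End(H) :=
  xget 0 [set B : 'End(H) | forall x y, dot (A x) y = dot x (B y)].

Definition is_projection (Q : 'End(H)) :=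
  (Q \o Q)%VF = Q /\ adjoint Q = Q.

Definition rank (Q : 'End(H)) : nat := \dim (limg Q).

Definition is_measurement (M : {fset 'End(H)}) :=
  [/\ forall Q, Q \in M -> is_projection Q /\ Q <> 0,
      forall Q Q', Q \in M -> Q' \in M -> Q <> Q' -> (Q \o Q')%VF = 0 &
      \sum_(Q <- M) Q = \1%VF].

Definition measurements_at (P : 'End(H)) : set {fset 'End(H)} :=
  [set M | is_measurement M /\ P \in M].

Definition profile (P : 'End(H)) (M : {fset 'End(H)}) : seq nat :=
  sort leq [seq rank Q | Q <- (M `\ P)%fset].

Definition measurements_with_profile (P : 'End(H)) (lam : seq nat)
    : set {fset 'End(H)} :=
  [set M | measurements_at P M /\ profile P M = lam].

Definition is_unitary_op (U : 'End(H)) :=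
  (adjoint U \o U)%VF = \1%VF /\ (U \o adjoint U)%VF = \1%VF.

Definition fixing_group (P : 'End(H)) : set 'End(H) :=
  [set U | is_unitary_op U /\ forall x, x \in limg P -> U x = x].

Definition conj_measurement (U : 'End(H)) (M : {fset 'End(H)})
    : {fset 'End(H)} :=
  [fset (U \o Q \o adjoint U)%VF | Q in M]%fset.

Definition orthonormal_basis_of (V : {vspace H}) n (b : n.-tuple H) :=
  orthonormal dot b /\ <<b>>%VS = V.

(* A is the matrix, in the orthonormal family b, of the restriction of U to the
   span of b (dot is linear on the left). *)
Definition restricts_to n (b : n.-tuple H) (U : 'End(H)) (A : unitary R n) :=
  forall i j, val A i j = dot (U (tnth b j)) (tnth b i).

(* The measurements with profile lam form a compact smooth homogeneous space of
   dimension N, isomorphic to U(n) / block_group lam.  They carry the topology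
   transported from the quotient along the bijection f. *)
Definition homogeneous_model (P : 'End(H)) n (b : n.-tuple H)
    (lam : seq nat) (N : nat) : Prop :=
  exists (act : unitary R n -> measurements_with_profile P lam ->
                measurements_with_profile P lam)
         (f : measurements_with_profile P lam -> block_quotient R n lam)
         (g : block_quotient R n lam -> initial_topology f)
         (AQ : set (chart R (block_quotient R n lam) N))
         (AM : set (chart R (initial_topology f) N)),
    [/\ forall U A M, fixing_group P U -> restricts_to b U A ->
          val (act A M) = conj_measurement U (val M),
        [/\ cancel f g, cancel g f &
            forall A B M, f M = coset_of_unitary lam B ->
              f (act A M) = coset_of_unitary lam (A * B)%g],
        smooth_manifold AQ /\
        smooth_submersion (unitary_atlas R n) AQ (@coset_of_unitary R n lam),
        smooth_map AM AQ f /\ smooth_map AQ AM g &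
        compact [set: initial_topology f] /\
        @smooth_homogeneous_space R n (initial_topology f) N AM act].

End Measurements.

(* Main.v *)
(* A measurement with profile lam containing P is the same thing as an orthogonal
   decomposition of ran (1 - P) into subspaces of dimensions r_1, ..., r_k. Adapted
   orthonormal bases show that U(n) permutes these decompositions transitively, and the
   stabilizer of the standard one is [block_group].

   Charts of U(n) are translates of the Cayley transform. For U(n) / block_group, a
   unitary V near 1 is written V = L B with L block lower unipotent and B block upper
   triangular; L depends only on the coset of V under block-diagonal unitaries, its
   entries below the block diagonal are the coordinates, and the Gram-Schmidt
   orthonormalization of L is a smooth local section. The number of real coordinates is
   that of the off-diagonal entries, n^2 - \sum r_j^2. *)

(* A definition of smoothness by iterated partial derivatives gives no calculus by itself. All of it
   comes from one class of real functions stable under partial derivatives; after that, smoothness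
   of a map to or from U(n) is reduced to smoothness of matrix entries, and charts of U(n) disappear
   from the arguments.

   The Gram-Schmidt matrix of L lies in the coset of V because V and that matrix both differ from L
   by a block upper triangular factor on the right: their quotient is then unitary and block upper
   triangular, and such a matrix is block diagonal. The converse direction is the obstacle: a chart
   must separate cosets of the full stabilizer, which also contains permutations of blocks, so its
   domain must be small enough to exclude these.

   The charts of the quotient are built from an abstract coordinate and section near 1, then
   translated by U(n). The set of measurements has no topology beforehand; it receives that of the
   quotient through a bijection, so its manifold structure and action are formal consequences. *)
From HB Require Import structures.
Require Import Defs.
From mathcomp Require Import all_boot all_order all_fingroup all_algebra.
From mathcomp Require Import finmap complex.
From mathcomp Require Import all_classical all_reals all_analysis.
From mathcomp Require Import sesquilinear spectral.
From mathcomp Require Import ring lra.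

Set Implicit Arguments.
Unset Strict Implicit.
Unset Printing Implicit Defensive.

Import Order.TTheory GRing.Theory Num.Theory.
Import numFieldNormedType.Exports.

Local Open Scope classical_set_scope.
Local Open Scope ring_scope.
Local Open Scope complex_scope.
Local Open Scope sesquilinear_scope.

(** * Smooth functions *)

Section SmoothCalculus.
Context {R : realType}.

(** The difference g - f vanishes near x, so it has the first-order expansion with zero
    differential, and g is f plus a differentiable function. *)
Lemma differentiable_near (V W : normedModType R) (f g : V -> W) x :
  (\forall y \near x, f y = g y) -> differentiable f x -> differentiable g x.
Proof.
move=> fg df; pose h := g - f.
have h0 : \forall y \near x, h y = 0.
  by near=> y; rewrite /h !fctE (near fg y) ?subrr.
have hx : h x = 0 by exact: (nbhs_singleton h0).
have E : h \o shift x = cst (h x) + \0 +o_ 0 id.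
  apply/eqaddoP => e e0 /=; rewrite hx.
  move: h0; rewrite (near_shift 0) subr0 => h0; near=> y.
  have yx : h (y + x) = 0 by near: y.
  rewrite (_ : _ y = 0) ?normr0 ?mulr_ge0 ?(ltW e0)//.
  by rewrite -[LHS]/(h (y + x) - (0 + 0)) yx addr0 subrr.
have ct : continuous (\0 : V -> W) by move=> y; exact: cvg_cst.
have dh : differentiable h x.
  by apply/diff_locallyP; rewrite (diff_unique ct E).
have -> : g = f + h by rewrite /h addrC subrK.
exact: differentiableD.
Unshelve. all: by end_near. Qed.

Section OpenSet.
Context (N : nat) (D : set 'rV[R]_N) (oD : open D).

Lemma iter_partial_ext (W : normedModType R) (f g : 'rV[R]_N -> W) s :
  (forall x, D x -> f x = g x) ->
  forall x, D x -> iter_partial s f x = iter_partial s g x.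
Proof.
move=> fg; elim: s => //= i s IH x Dx.
by apply: near_eq_derive; apply: filterS (IH) _; exact: open_nbhs_nbhs.
Qed.

Lemma smooth_on_ext (W : normedModType R) (f g : 'rV[R]_N -> W) :
  (forall x, D x -> f x = g x) -> smooth_on D f -> smooth_on D g.
Proof.
move=> fg sf s x Dx; apply: differentiable_near (sf s x Dx).
by apply: filterS (iter_partial_ext s fg) _; exact: open_nbhs_nbhs.
Qed.

(* The class is closed under partial derivatives and its members are differentiable,
   so they are smooth. *)
Inductive smooth_gen : ('rV[R]_N -> R) -> Prop :=
| gen_smooth f : smooth_on D f -> smooth_gen f
| gen_ext f g : (forall x, D x -> f x = g x) -> smooth_gen f -> smooth_gen g
| gen_add f g : smooth_gen f -> smooth_gen g -> smooth_gen (f + g)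
| gen_mul f g : smooth_gen f -> smooth_gen g -> smooth_gen (f * g)
| gen_inv f : (forall x, D x -> f x != 0) -> smooth_gen f ->
    smooth_gen (fun x => (f x)^-1)
| gen_sqrt f : (forall x, D x -> 0 < f x) -> smooth_gen f ->
    smooth_gen (fun x => Num.sqrt (f x))
| gen_comp M (E : set 'rV[R]_M) (h : 'rV[R]_M -> R) (f : 'I_M -> 'rV[R]_N -> R) :
    open E -> smooth_on E h -> (forall j, smooth_gen (f j)) ->
    (forall x, D x -> E (\row_j f j x)) ->
    smooth_gen (fun x => h (\row_j f j x)).

(** [foldr] applies the last index of the list first, so the iterated partials of a partial are
    those of f along [rcons s i]. *)
Lemma smooth_on_partial (W : normedModType R) (f : 'rV[R]_N -> W) i :
  smooth_on D f -> smooth_on D ('D_(delta_mx 0 i) f).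
Proof. by move=> sf s; move: (sf (rcons s i)); rewrite /iter_partial foldr_rcons. Qed.

Lemma smooth_on_cst (W : normedModType R) (c : W) : smooth_on D (cst c).
Proof.
move=> s x _.
suff [d ->] : exists d, iter_partial s (cst c) = cst d by exact: differentiable_cst.
elim: s => [|i s [d /= ->]]; first by exists c.
by exists 0; apply/funext => y; rewrite derive_cst.
Qed.

Lemma gen_sum m (f : 'I_m -> 'rV[R]_N -> R) :
  (forall j, smooth_gen (f j)) -> smooth_gen (\sum_j f j).
Proof.
move=> gf; elim/big_ind : _ => //; last exact: gen_add.
by apply: gen_smooth; exact: smooth_on_cst.
Qed.

Lemma row_differentiable m (V : normedModType R) (f : 'I_m -> V -> R) x :
  (forall j, differentiable (f j) x) -> differentiable (fun y => \row_j f j y) x.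
Proof.
move=> df.
have -> : (fun y => \row_j f j y) =
    \sum_(j < m) (fun y => f j y *: (delta_mx 0 j : 'rV[R]_m)).
  apply/funext => y; rewrite fct_sumE; apply/rowP => j.
  rewrite mxE summxE (bigD1 j)//= !mxE !eqxx mulr1 big1 ?addr0// => k kj.
  by rewrite !mxE eqxx eq_sym (negbTE kj) mulr0.
by apply: differentiable_sum => j; exact: differentiableZl.
Qed.

Lemma derive_row m (V : normedModType R) (f : 'I_m -> V -> R) x v :
  (forall j, derivable (f j) x v) ->
  'D_v (fun y => \row_j f j y) x = \row_j 'D_v (f j) x.
Proof.
move=> df; rewrite derive_mx; last first.
  apply/derivable_mxP => i j; apply: near_eq_derivable (df j).
  by near=> y; rewrite mxE.
apply/rowP => j; rewrite !mxE; apply: near_eq_derive.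
by near=> y; rewrite mxE.
Unshelve. all: by end_near. Qed.

Lemma derive_comp_row M (h : 'rV[R]_M -> R) (f : 'I_M -> 'rV[R]_N -> R) x v :
  (forall j, differentiable (f j) x) -> differentiable h (\row_j f j x) ->
  'D_v (fun x => h (\row_j f j x)) x =
    \sum_j 'D_(delta_mx 0 j) h (\row_j f j x) * 'D_v (f j) x.
Proof.
move=> df dh.
have drow := row_differentiable df.
rewrite deriveE; last exact: (differentiable_comp drow dh).
rewrite (_ : (fun x => h _) = h \o (fun x => \row_j f j x))// diff_comp//=.
rewrite -[X in 'd h _ X]deriveE// derive_row; last first.
  by move=> j; exact: diff_derivable.
rewrite [X in 'd h _ X]row_sum_delta linear_sum; apply: eq_bigr => j _.
by rewrite linearZ /= mxE -deriveE// mulrC.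
Qed.

(** Each differentiation rule expresses the derivative through the constructors. The derivatives of
    an inverse and of a square root involve these functions again, and the chain rule involves
    partials of h at the same inner functions. *)
Lemma smooth_gen_step (f : 'rV[R]_N -> R) : smooth_gen f ->
  (forall x, D x -> differentiable f x) /\
  forall i, smooth_gen ('D_(delta_mx 0 i) f).
Proof.
elim=> {f} [f sf|f g fg _ [df gf]|f g _ [df gf] _ [dg gg]|f g Gf [df gf] Gg [dg gg]
  |f f0 Gf [df gf]|f f0 Gf [df gf]|M E h f oE sh Gf IH fE].
- split; first by move=> x; exact: (sf [::]).
  by move=> i; apply: gen_smooth; exact: smooth_on_partial.
- have fgN x : D x -> \forall y \near x, f y = g y.
    by move=> Dx; apply: filterS (fg) _; exact: open_nbhs_nbhs.
  split; first by move=> x Dx; exact: differentiable_near (fgN x Dx) (df x Dx).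
  by move=> i; apply: gen_ext (gf i) => x /fgN; exact: near_eq_derive.
- split; first by move=> x Dx; apply: differentiableD; [exact: df|exact: dg].
  move=> i; apply: gen_ext (gen_add (gf i) (gg i)) => x Dx.
  by rewrite deriveD//; apply: diff_derivable; [exact: df|exact: dg].
- split; first by move=> x Dx; apply: differentiableM; [exact: df|exact: dg].
  move=> i; apply: gen_ext (gen_add (gen_mul Gf (gg i)) (gen_mul Gg (gf i))) => x Dx.
  by rewrite deriveM//; apply: diff_derivable; [exact: df|exact: dg].
- split; first by move=> x Dx; apply: differentiableV; [exact: df|exact: f0].
  have Gi := gen_inv f0 Gf.
  (* Signs enter as multiplication by the constant -1, since the class has no constructor for
     opposites. *)
  have Gc : smooth_gen (cst (-1)) by apply: gen_smooth; exact: smooth_on_cst.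
  move=> i; apply: gen_ext (gen_mul Gc (gen_mul (gen_mul Gi Gi) (gf i))) => x Dx.
  rewrite deriveV; [|exact: f0|by apply: diff_derivable; exact: df].
  by rewrite !fctE /= mulN1r scaleNr -exprVn expr2.
- have ds x : D x -> differentiable (Num.sqrt : R -> R) (f x).
    move=> Dx; apply/derivable1_diffP.
    by have [] := @is_derive1_sqrt R (f x) (f0 x Dx).
  split.
    by move=> x Dx; exact: (differentiable_comp (df x Dx) (ds x Dx)).
  have Gs : smooth_gen (fun x => (2 * Num.sqrt (f x))^-1).
    apply: (@gen_inv (fun x => 2 * Num.sqrt (f x))).
      by move=> x Dx; rewrite mulf_neq0 ?pnatr_eq0// gt_eqF// sqrtr_gt0 f0.
    apply: (@gen_mul (cst 2)); last exact: gen_sqrt.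
    by apply: gen_smooth; exact: smooth_on_cst.
  move=> i; apply: gen_ext (gen_mul (gf i) Gs) => x Dx.
  rewrite deriveE; last exact: (differentiable_comp (df x Dx) (ds x Dx)).
  rewrite (_ : (fun _ => Num.sqrt _) = Num.sqrt \o f)// diff_comp//; last 2 first.
  + exact: df.
  + exact: ds.
  rewrite /= -(deriveE _ (df x Dx)); set t := 'D__ f x.
  (* A differential on the line is its value at 1 times the argument; writing t as t *: 1 exposes
     that value as a derivative. *)
  rewrite -[X in 'd _ _ X]mulr1 -[t * 1]/(t *: (1 : R^o)) linearZ.
  by rewrite -(deriveE _ (ds x Dx)) derive_sqrt// f0.
- split.
    move=> x Dx; apply: (@differentiable_comp _ _ _ _ (fun x => \row_j f j x)).
      by apply: row_differentiable => j; exact: (IH j).1.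
    exact: (sh [::] _ (fE _ Dx)).
  move=> i.
  pose t j := (fun x => 'D_(delta_mx 0 j) h (\row_j f j x)) * 'D_(delta_mx 0 i) (f j).
  apply: (@gen_ext (\sum_j t j)).
    move=> x Dx; rewrite derive_comp_row; last 2 first.
    + by move=> j; exact: (IH j).1.
    + exact: (sh [::] _ (fE _ Dx)).
    by rewrite fct_sumE.
  apply: gen_sum => j; apply: gen_mul; last exact: (IH j).2.
  apply: (@gen_comp _ E ('D_(delta_mx 0 j) h)) => // s.
  by move: (sh (rcons s j)); rewrite /iter_partial foldr_rcons.
Qed.

Lemma smooth_gen_on f : smooth_gen f -> smooth_on D f.
Proof.
move=> Gf s x Dx; suff G : smooth_gen (iter_partial s f) by exact: (smooth_gen_step G).1.
by elim: s => //= i s IH; exact: (smooth_gen_step IH).2.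
Qed.

(** Iterated partials commute with taking coordinates. Each commutation step needs differentiability
    of the previous iterate, so it is proved twice: from the vector side for one implication, from
    the coordinate side for the other. *)
Lemma smooth_on_coord m (f : 'rV[R]_N -> 'rV[R]_m) :
  smooth_on D f <-> forall j, smooth_on D (fun x => f x 0 j).
Proof.
have P s : (forall s x, D x -> differentiable (iter_partial s f) x) ->
    forall x, D x -> forall j, iter_partial s f x 0 j = iter_partial s (fun x => f x 0 j) x.
  move=> sf; elim: s => //= i s IH x Dx j.
  rewrite derive_mx; last by apply: diff_derivable; exact: sf.
  rewrite mxE; apply: near_eq_derive.
  by apply: filterS (fun x Dx => IH x Dx j) _; exact: open_nbhs_nbhs.
split=> [sf j s x Dx|sf].
  apply: (@differentiable_near _ _ (fun x => iter_partial s f x 0 j)).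
    by apply: filterS (fun x Dx => P s sf x Dx j) _; exact: open_nbhs_nbhs.
  exact: (differentiable_comp (sf s x Dx) (differentiable_coord _ _ _)).
have Q s : forall x, D x ->
    iter_partial s f x = \row_j iter_partial s (fun x => f x 0 j) x.
  elim: s => [|i s IH] x Dx /=; first by apply/rowP => j; rewrite mxE.
  have E : \forall y \near x, iter_partial s f y =
      \row_j iter_partial s (fun x => f x 0 j) y.
    by apply: filterS (IH) _; exact: open_nbhs_nbhs.
  rewrite (near_eq_derive _ E) derive_row// => j.
  by apply: diff_derivable; exact: sf.
move=> s x Dx.
apply: (@differentiable_near _ _ (fun x => \row_j iter_partial s (fun x => f x 0 j) x)).
  by apply: filterS (fun x Dx => esym (Q s x Dx)) _; exact: open_nbhs_nbhs.
by apply: row_differentiable => j; exact: sf.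
Qed.

End OpenSet.

Lemma smooth_on_subset (W : normedModType R) N (D E : set 'rV[R]_N)
    (f : 'rV[R]_N -> W) : E `<=` D -> smooth_on D f -> smooth_on E f.
Proof. by move=> ED sf s x Ex; apply: sf; exact: ED. Qed.

End SmoothCalculus.

(** * Smoothness near a point *)

Section SmoothAt.
Context {R : realType} {N : nat}.
Implicit Types (x : 'rV[R]_N) (D : set 'rV[R]_N).

(** A pointwise notion that still provides an open domain: the operations below may shrink this
    domain freely. *)
Definition smooth_at (W : normedModType R) (f : 'rV[R]_N -> W) x :=
  exists2 D, open_nbhs x D & smooth_on D f.

Lemma smooth_at_on (W : normedModType R) D (f : 'rV[R]_N -> W) :
  (forall x, D x -> smooth_at f x) -> smooth_on D f.
Proof. by move=> sf s x Dx; have [E [_ Ex] sE] := sf x Dx; exact: sE. Qed.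

Lemma smooth_on_at (W : normedModType R) D (f : 'rV[R]_N -> W) x :
  open D -> smooth_on D f -> D x -> smooth_at f x.
Proof. by move=> oD sf Dx; exists D. Qed.

Lemma smooth_at_near (W : normedModType R) (f g : 'rV[R]_N -> W) x :
  (\forall y \near x, f y = g y) -> smooth_at f x -> smooth_at g x.
Proof.
move=> fg; have : nbhs x [set y | f y = g y] by exact: fg.
rewrite nbhsE => -[E [oE Ex] {}fg] [D [oD Dx] sf].
exists (D `&` E); first by split; [exact: openI|].
apply: (@smooth_on_ext _ _ _ (openI oD oE) _ f); first by move=> y [_ /fg].
by apply: smooth_on_subset sf => y [].
Qed.

Lemma smooth_at_differentiable (W : normedModType R) (f : 'rV[R]_N -> W) x :
  smooth_at f x -> differentiable f x.
Proof. by move=> [D [_ Dx] sf]; exact: (sf [::]). Qed.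

Lemma smooth_at_continuous (W : normedModType R) (f : 'rV[R]_N -> W) x :
  smooth_at f x -> {for x, continuous f}.
Proof. by move/smooth_at_differentiable/differentiable_continuous. Qed.

Lemma smooth_at_cst (W : normedModType R) (c : W) x : smooth_at (fun=> c) x.
Proof. by exists setT; [exact: open_nbhsT|exact: smooth_on_cst]. Qed.

Lemma smooth_at_rowP m (f : 'rV[R]_N -> 'rV[R]_m) x :
  smooth_at f x <-> forall j, smooth_at (fun y => f y 0 j) x.
Proof.
split=> [[D [oD Dx] sf] j|sf].
  by exists D => //; exact: (smooth_on_coord oD f).1.
pose E j := s2val (cid2 (sf j)).
have oE j : open_nbhs x (E j) by exact: s2valP (cid2 (sf j)).
have nE : \forall y \near x, forall j, E j y.
  by apply: (@filter_forall _ _ E (nbhs x) _) => j; exact: open_nbhs_nbhs.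
exists [set y | forall j, E j y]°; first by split; [exact: open_interior|].
apply/smooth_on_coord; first exact: open_interior.
move=> j; apply: smooth_on_subset (s2valP' (cid2 (sf j))) => y /interior_subset.
exact.
Qed.

Lemma smooth_at_gen2 (f g h : 'rV[R]_N -> R) x :
  (forall D, open D -> smooth_gen D f -> smooth_gen D g -> smooth_gen D h) ->
  smooth_at f x -> smooth_at g x -> smooth_at h x.
Proof.
move=> H [D [oD Dx] sf] [E [oE Ex] sg]; have oDE := openI oD oE.
exists (D `&` E); first by split.
by apply: smooth_gen_on => //; apply: H => //; apply: gen_smooth;
  [apply: smooth_on_subset sf|apply: smooth_on_subset sg] => y [].
Qed.

Lemma smooth_atD (f g : 'rV[R]_N -> R) x :
  smooth_at f x -> smooth_at g x -> smooth_at (fun y => f y + g y) x.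
Proof. by apply: smooth_at_gen2 => D oD; exact: gen_add. Qed.

Lemma smooth_atM (f g : 'rV[R]_N -> R) x :
  smooth_at f x -> smooth_at g x -> smooth_at (fun y => f y * g y) x.
Proof. by apply: smooth_at_gen2 => D oD; exact: gen_mul. Qed.

Lemma smooth_atN (f : 'rV[R]_N -> R) x :
  smooth_at f x -> smooth_at (fun y => - f y) x.
Proof.
have sc : smooth_at (fun=> -1 : R) x by exact: smooth_at_cst.
move=> /(smooth_atM sc); apply: smooth_at_near.
by near=> y; rewrite mulN1r.
Unshelve. all: by end_near. Qed.

Lemma smooth_atB (f g : 'rV[R]_N -> R) x :
  smooth_at f x -> smooth_at g x -> smooth_at (fun y => f y - g y) x.
Proof. by move=> sf sg; apply: smooth_atD => //; exact: smooth_atN. Qed.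

(** Inverses and square roots in [smooth_gen] ask for their sign condition on the whole domain;
    continuity allows one to shrink to a domain where an open condition known at x persists. *)
Lemma smooth_at_restrict (f : 'rV[R]_N -> R) (P : set R) x : open P ->
  smooth_at f x -> P (f x) ->
  exists2 D, open_nbhs x D & smooth_on D f /\ D `<=` f @^-1` P.
Proof.
move=> oP sf Pfx; have [D [oD Dx] sD] := sf.
have : nbhs x (D `&` f @^-1` P).
  apply: filterI; first exact: open_nbhs_nbhs.
  by apply: (smooth_at_continuous sf); exact: open_nbhs_nbhs.
rewrite nbhsE => -[E oE EDP]; exists E => //.
by split; [apply: smooth_on_subset sD|]; move=> y /EDP[].
Qed.

Lemma smooth_atV (f : 'rV[R]_N -> R) x : f x != 0 ->
  smooth_at f x -> smooth_at (fun y => (f y)^-1) x.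
Proof.
move=> f0 /(smooth_at_restrict (P := [set t | t != 0])).
case=> [|//|D oD [sD DP]]; first exact: open_neq.
exists D => //; apply: smooth_gen_on; first by case: oD.
by apply: gen_inv => //; exact: gen_smooth.
Qed.

Lemma smooth_at_sqrt (f : 'rV[R]_N -> R) x : 0 < f x ->
  smooth_at f x -> smooth_at (fun y => Num.sqrt (f y)) x.
Proof.
move=> f0 /(smooth_at_restrict (P := [set t | 0 < t])).
case=> [|//|D oD [sD DP]]; first exact: open_gt.
exists D => //; apply: smooth_gen_on; first by case: oD.
by apply: gen_sqrt => //; exact: gen_smooth.
Qed.

Lemma smooth_at_sum (I : Type) (r : seq I) (P : pred I) (f : I -> 'rV[R]_N -> R) x :
  (forall i, P i -> smooth_at (f i) x) ->
  smooth_at (fun y => \sum_(i <- r | P i) f i y) x.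
Proof.
move=> sf; elim: r => [|i r IH].
  have : smooth_at (fun=> 0 : R) x by exact: smooth_at_cst.
  apply: smooth_at_near.
  by near=> y; rewrite big_nil.
apply: (@smooth_at_near _ (fun y => (if P i then f i y else 0) +
    \sum_(i <- r | P i) f i y)).
  by near=> y; rewrite big_cons; case: ifP; rewrite ?add0r.
apply: smooth_atD => //; case Pi: (P i); first exact: sf.
exact: smooth_at_cst.
Unshelve. all: by end_near. Qed.

Lemma smooth_at_coord j x : smooth_at (fun y : 'rV[R]_N => y 0 j) x.
Proof.
exists setT; first exact: open_nbhsT.
move=> s y _; suff : iter_partial s (fun y : 'rV[R]_N => y 0 j) = (fun y => y 0 j) \/
    exists c : R, iter_partial s (fun y : 'rV[R]_N => y 0 j) = cst c.
  by case=> [->|[c ->]]; [exact: differentiable_coord|exact: differentiable_cst].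
elim: s => [|i s [/= ->|[c /= ->]]]; first by left.
  right; exists ((delta_mx 0 i : 'rV[R]_N) 0 j); apply/funext => z.
  (* The derivative of a coordinate is read off from the derivative of the identity map. *)
  have /matrixP/(_ 0 j) := derive_mx (@derivable_id _ _ z (delta_mx 0 i)).
  by rewrite mxE derive_id.
by right; exists 0; apply/funext => z; rewrite derive_cst.
Qed.

End SmoothAt.

Lemma smooth_at_comp (R : realType) N M K (h : 'rV[R]_M -> 'rV[R]_K)
    (f : 'rV[R]_N -> 'rV[R]_M) x :
  smooth_at f x -> smooth_at h (f x) -> smooth_at (fun y => h (f y)) x.
Proof.
move=> sf sh; apply/smooth_at_rowP => k.
have [E [oE Efx] sE] := (smooth_at_rowP h (f x)).1 sh k.
have [D [oD Dx] sD] := sf.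
have : nbhs x (D `&` f @^-1` E).
  apply: filterI; first exact: open_nbhs_nbhs.
  by apply: (smooth_at_continuous sf); exact: open_nbhs_nbhs.
rewrite nbhsE => -[B [oB Bx] BDE]; exists B => //.
have fE y : f y = \row_j f y 0 j by apply/rowP => j; rewrite mxE.
apply: (@smooth_on_ext _ _ _ oB _ (fun y => h (\row_j f y 0 j) 0 k)).
  by move=> y _; rewrite -fE.
apply: smooth_gen_on => //.
apply: (@gen_comp _ _ _ _ E (fun z => h z 0 k) (fun j y => f y 0 j)) => //.
  move=> j; apply: gen_smooth; apply: (smooth_on_coord oB f).1.
  by apply: smooth_on_subset sD => y /BDE[].
by move=> y /BDE[_]; rewrite /= {1}fE.
Qed.

(** * Complex and matrix valued smooth maps of real variables *)

Section ComplexSmooth.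
Context {R : realType}.
Local Notation Re := complex.Re.
Local Notation Im := complex.Im.

Lemma smooth_at_eq (W : normedModType R) N (f g : 'rV[R]_N -> W) x :
  f =1 g -> smooth_at f x -> smooth_at g x.
Proof. by move=> /funext ->. Qed.

(** Real smoothness, not holomorphy: conjugation must be allowed, because adjoints occur
    everywhere. *)
Definition csmooth_at N (f : 'rV[R]_N -> R[i]) x :=
  smooth_at (fun y => Re (f y)) x /\ smooth_at (fun y => Im (f y)) x.

Section Scalar.
Context {N : nat}.
Implicit Types (f g : 'rV[R]_N -> R[i]) (x : 'rV[R]_N).

Lemma csmooth_at_near f g x :
  (\forall y \near x, f y = g y) -> csmooth_at f x -> csmooth_at g x.
Proof.
by move=> fg [sr si]; split; [apply: smooth_at_near sr|apply: smooth_at_near si];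
  apply: filterS fg => y ->.
Qed.

Lemma csmooth_at_eq f g x : f =1 g -> csmooth_at f x -> csmooth_at g x.
Proof. by move=> /funext ->. Qed.

Lemma csmooth_at_cst (c : R[i]) x : csmooth_at (fun=> c) x.
Proof. by split; exact: smooth_at_cst. Qed.

Lemma csmooth_atD f g x :
  csmooth_at f x -> csmooth_at g x -> csmooth_at (fun y => f y + g y) x.
Proof.
move=> [fr fi] [gr gi].
split; [apply: smooth_at_eq (smooth_atD fr gr)|
  apply: smooth_at_eq (smooth_atD fi gi)];
  by move=> y; case: (f y) (g y) => [a b] [c d].
Qed.

Lemma csmooth_atN f x : csmooth_at f x -> csmooth_at (fun y => - f y) x.
Proof.
move=> [fr fi].
split; [apply: smooth_at_eq (smooth_atN fr)|apply: smooth_at_eq (smooth_atN fi)];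
  by move=> y; case: (f y).
Qed.

Lemma csmooth_atM f g x :
  csmooth_at f x -> csmooth_at g x -> csmooth_at (fun y => f y * g y) x.
Proof.
move=> [fr fi] [gr gi]; split.
  apply: smooth_at_eq (smooth_atB (smooth_atM fr gr) (smooth_atM fi gi)).
  by move=> y; case: (f y) (g y) => [a b] [c d].
apply: smooth_at_eq (smooth_atD (smooth_atM fr gi) (smooth_atM fi gr)).
by move=> y; case: (f y) (g y) => [a b] [c d].
Qed.

Lemma csmooth_at_conj f x : csmooth_at f x -> csmooth_at (fun y => (f y)^*)%R x.
Proof.
move=> [fr fi].
split; [apply: smooth_at_eq fr|apply: smooth_at_eq (smooth_atN fi)];
  by move=> y; case: (f y).
Qed.

Lemma csmooth_at_real (f : 'rV[R]_N -> R) x :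
  smooth_at f x -> csmooth_at (fun y => (f y)%:C) x.
Proof. by move=> sf; split => //; exact: smooth_at_cst. Qed.

Lemma csmooth_atV f x : f x != 0 ->
  csmooth_at f x -> csmooth_at (fun y => (f y)^-1) x.
Proof.
move=> f0 [fr fi].
have n0 : Re (f x) ^+ 2 + Im (f x) ^+ 2 != 0.
  rewrite paddr_eq0 ?sqr_ge0// !sqrf_eq0; apply: contra f0.
  by case: (f x) => a b /= /andP[/eqP -> /eqP ->].
(* 1/z is the conjugate of z divided by the squared modulus, which is real and nonzero at x. *)
have sn : smooth_at (fun y => (Re (f y) * Re (f y) + Im (f y) * Im (f y))^-1) x.
  by apply: smooth_atV; [rewrite -!expr2|apply: smooth_atD; exact: smooth_atM].
split; [apply: smooth_at_eq (smooth_atM fr sn)|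
  apply: smooth_at_eq (smooth_atN (smooth_atM fi sn))];
  by move=> y; rewrite -!expr2; case: (f y).
Qed.

Lemma csmooth_at_sum (I : Type) (r : seq I) (P : pred I) (f : I -> 'rV[R]_N -> R[i]) x :
  (forall i, csmooth_at (f i) x) -> csmooth_at (fun y => \sum_(i <- r | P i) f i y) x.
Proof.
move=> sf; elim: r => [|i r IH].
  apply: csmooth_at_eq (csmooth_at_cst 0 x).
  by move=> y; rewrite big_nil.
apply: (@csmooth_at_eq (fun y => (if P i then f i y else 0) +
    \sum_(i <- r | P i) f i y)).
  by move=> y; rewrite big_cons; case: ifP; rewrite ?add0r.
apply: csmooth_atD => //; case Pi: (P i); first exact: sf.
exact: csmooth_at_cst.
Qed.

Lemma csmooth_at_prod (I : Type) (r : seq I) (P : pred I) (f : I -> 'rV[R]_N -> R[i]) x :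
  (forall i, csmooth_at (f i) x) -> csmooth_at (fun y => \prod_(i <- r | P i) f i y) x.
Proof.
move=> sf; elim: r => [|i r IH].
  apply: csmooth_at_eq (csmooth_at_cst 1 x).
  by move=> y; rewrite big_nil.
apply: (@csmooth_at_eq (fun y => (if P i then f i y else 1) *
    \prod_(i <- r | P i) f i y)).
  by move=> y; rewrite big_cons; case: ifP; rewrite ?mul1r.
apply: csmooth_atM => //; case Pi: (P i); first exact: sf.
exact: csmooth_at_cst.
Qed.

End Scalar.

Definition mxsmooth_at N m n (f : 'rV[R]_N -> 'M[R[i]]_(m, n)) x :=
  forall i j, csmooth_at (fun y => f y i j) x.

Section Matrices.
Context {N : nat}.
Implicit Types x : 'rV[R]_N.

Lemma mxsmooth_at_near m n (f g : 'rV[R]_N -> 'M[R[i]]_(m, n)) x :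
  (\forall y \near x, f y = g y) -> mxsmooth_at f x -> mxsmooth_at g x.
Proof.
move=> fg sf i j; apply: csmooth_at_near (sf i j).
by apply: filterS fg => y ->.
Qed.

Lemma mxsmooth_at_cst m n (A : 'M[R[i]]_(m, n)) x : mxsmooth_at (fun=> A) x.
Proof. by move=> i j; exact: csmooth_at_cst. Qed.

Lemma mxsmooth_atD m n (f g : 'rV[R]_N -> 'M[R[i]]_(m, n)) x :
  mxsmooth_at f x -> mxsmooth_at g x -> mxsmooth_at (fun y => f y + g y) x.
Proof.
move=> sf sg i j; apply: csmooth_at_eq (csmooth_atD (sf i j) (sg i j)).
by move=> y; rewrite mxE.
Qed.

Lemma mxsmooth_atN m n (f : 'rV[R]_N -> 'M[R[i]]_(m, n)) x :
  mxsmooth_at f x -> mxsmooth_at (fun y => - f y) x.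
Proof.
move=> sf i j; apply: csmooth_at_eq (csmooth_atN (sf i j)).
by move=> y; rewrite mxE.
Qed.

Lemma mxsmooth_atB m n (f g : 'rV[R]_N -> 'M[R[i]]_(m, n)) x :
  mxsmooth_at f x -> mxsmooth_at g x -> mxsmooth_at (fun y => f y - g y) x.
Proof. by move=> sf sg; apply: mxsmooth_atD => //; exact: mxsmooth_atN. Qed.

Lemma mxsmooth_atZ m n (c : 'rV[R]_N -> R[i]) (f : 'rV[R]_N -> 'M[R[i]]_(m, n)) x :
  csmooth_at c x -> mxsmooth_at f x -> mxsmooth_at (fun y => c y *: f y) x.
Proof.
move=> sc sf i j; apply: csmooth_at_eq (csmooth_atM sc (sf i j)).
by move=> y; rewrite mxE.
Qed.

Lemma mxsmooth_at_mul m n p (f : 'rV[R]_N -> 'M[R[i]]_(m, n))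
    (g : 'rV[R]_N -> 'M[R[i]]_(n, p)) x :
  mxsmooth_at f x -> mxsmooth_at g x -> mxsmooth_at (fun y => f y *m g y) x.
Proof.
move=> sf sg i j.
have : csmooth_at (fun y => \sum_k f y i k * g y k j) x.
  by apply: csmooth_at_sum => k; exact: csmooth_atM.
by apply: csmooth_at_eq; move=> y; rewrite mxE.
Qed.

Lemma mxsmooth_at_adj m n (f : 'rV[R]_N -> 'M[R[i]]_(m, n)) x :
  mxsmooth_at f x -> mxsmooth_at (fun y => (f y)^t*) x.
Proof.
move=> sf i j; apply: csmooth_at_eq (csmooth_at_conj (sf j i)).
by move=> y; rewrite !mxE.
Qed.

Lemma csmooth_at_det n (f : 'rV[R]_N -> 'M[R[i]]_n) x :
  mxsmooth_at f x -> csmooth_at (fun y => \det (f y)) x.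
Proof.
move=> sf; rewrite /determinant; apply: csmooth_at_sum => s.
apply: csmooth_atM; first exact: csmooth_at_cst.
by apply: csmooth_at_prod => i; exact: sf.
Qed.

Lemma csmooth_at_neq0 (f : 'rV[R]_N -> R[i]) x :
  csmooth_at f x -> f x != 0 -> \forall y \near x, f y != 0.
Proof.
move=> [fr fi] f0.
have sn : smooth_at (fun y => Re (f y) * Re (f y) + Im (f y) * Im (f y)) x.
  by apply: smooth_atD; exact: smooth_atM.
have n0 : Re (f x) * Re (f x) + Im (f x) * Im (f x) != 0.
  rewrite -!expr2 paddr_eq0 ?sqr_ge0// !sqrf_eq0; apply: contra f0.
  by case: (f x) => a b /= /andP[/eqP -> /eqP ->].
have oN : open [set t : R | t != 0] by exact: open_neq.
have nz : \forall y \near x, Re (f y) * Re (f y) + Im (f y) * Im (f y) != 0.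
  exact: smooth_at_continuous sn _ (open_nbhs_nbhs (conj oN n0)).
near=> y; have : Re (f y) * Re (f y) + Im (f y) * Im (f y) != 0 by near: y.
by apply: contra => /eqP ->; rewrite /= !mulr0 addr0.
Unshelve. all: by end_near. Qed.

(** Cramer's formula, valid near x because the determinant stays nonzero there; cofactors are again
    determinants. *)
Lemma mxsmooth_at_inv n (f : 'rV[R]_N -> 'M[R[i]]_n) x :
  mxsmooth_at f x -> f x \in unitmx -> mxsmooth_at (fun y => invmx (f y)) x.
Proof.
rewrite unitmxE unitfE => sf f0; have sd := csmooth_at_det sf.
apply: (@mxsmooth_at_near _ _ (fun y => (\det (f y))^-1 *: \adj (f y))).
  apply: filterS (csmooth_at_neq0 sd f0) => y d0.
  by rewrite /invmx unitmxE unitfE d0.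
apply: mxsmooth_atZ; first exact: csmooth_atV.
move=> i j; have : csmooth_at (fun y => cofactor (f y) j i) x.
  rewrite /cofactor; apply: csmooth_atM; first exact: csmooth_at_cst.
  apply: csmooth_at_det => k l.
  by apply: csmooth_at_eq (sf (lift j k) (lift i l)); move=> y; rewrite !mxE.
by apply: csmooth_at_eq; move=> y; rewrite mxE.
Qed.

End Matrices.

Definition complexify n (v : 'rV[R]_(n * n + n * n)) : 'M[R[i]]_n :=
  \matrix_(i, j) (v 0 (lshift _ (mxvec_index i j)) +i* v 0 (rshift _ (mxvec_index i j))).

Lemma realifyK n (A : 'M[R[i]]_n) : complexify (realify A) = A.
Proof.
apply/matrixP => i j; rewrite !mxE !(unsplitK (inl _)) !(unsplitK (inr _)).
by rewrite !mxvecE !mxE; case: (A i j).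
Qed.

Lemma complexifyK n (v : 'rV[R]_(n * n + n * n)) : realify (complexify v) = v.
Proof.
apply/rowP => l; case: (splitP l) => l' El.
  rewrite (_ : l = lshift _ l'); last exact: val_inj.
  by rewrite row_mxEl; case/mxvec_indexP: l' {El} => a b; rewrite mxvecE !mxE.
rewrite (_ : l = rshift _ l'); last exact: val_inj.
by rewrite row_mxEr; case/mxvec_indexP: l' {El} => a b; rewrite mxvecE !mxE.
Qed.

Lemma mxsmooth_at_complexify n x : mxsmooth_at (@complexify n) x.
Proof.
by move=> i j; split; [apply: smooth_at_eq (smooth_at_coord (lshift _ (mxvec_index i j)) x)
 |apply: smooth_at_eq (smooth_at_coord (rshift _ (mxvec_index i j)) x)];
 move=> y; rewrite mxE.
Qed.

Lemma smooth_at_realify n N (f : 'rV[R]_N -> 'M[R[i]]_n) x :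
  mxsmooth_at f x <-> smooth_at (fun y => realify (f y)) x.
Proof.
split=> [sf|/smooth_at_rowP sf i j].
  apply/smooth_at_rowP => k; case: (splitP k) => k' /= Ek.
    case/mxvec_indexP: k' Ek => i j Ek.
    apply: smooth_at_eq (sf i j).1; move=> y.
    by rewrite (_ : k = lshift _ (mxvec_index i j)); [rewrite row_mxEl mxvecE mxE|exact: val_inj].
  case/mxvec_indexP: k' Ek => i j Ek.
  apply: smooth_at_eq (sf i j).2; move=> y.
  by rewrite (_ : k = rshift _ (mxvec_index i j)); [rewrite row_mxEr mxvecE mxE|exact: val_inj].
split.
  apply: smooth_at_eq (sf (lshift _ (mxvec_index i j))); move=> y.
  by rewrite row_mxEl mxvecE mxE.
apply: smooth_at_eq (sf (rshift _ (mxvec_index i j))); move=> y.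
by rewrite row_mxEr mxvecE mxE.
Qed.

Lemma csmooth_at_comp N M (h : 'rV[R]_M -> R[i]) (f : 'rV[R]_N -> 'rV[R]_M) x :
  smooth_at f x -> csmooth_at h (f x) -> csmooth_at (fun y => h (f y)) x.
Proof.
have H (k : 'rV[R]_M -> R) : smooth_at f x -> smooth_at k (f x) ->
    smooth_at (fun y => k (f y)) x.
  (* A scalar function is packed as a row with one entry, so that composition of row-valued maps
     applies. *)
  move=> sf sk; have sc : smooth_at (fun z => \row_(i < 1) k z) (f x).
    by apply/smooth_at_rowP => i; apply: smooth_at_eq sk; move=> y; rewrite mxE.
  have /smooth_at_rowP/(_ 0) := smooth_at_comp sf sc.
  by apply: smooth_at_eq; move=> y; rewrite mxE.
by move=> sf [hr hi]; split; [exact: (H (fun z => Re (h z)))|exact: (H (fun z => Im (h z)))].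
Qed.

Lemma mxsmooth_at_comp N M m n (h : 'rV[R]_M -> 'M[R[i]]_(m, n))
    (f : 'rV[R]_N -> 'rV[R]_M) x :
  smooth_at f x -> mxsmooth_at h (f x) -> mxsmooth_at (fun y => h (f y)) x.
Proof. by move=> sf sh i j; exact: (csmooth_at_comp sf (sh i j)). Qed.

End ComplexSmooth.

(** * The Lie group U(n) *)

Section UnitaryTopology.
Context (R : realType) (n : nat).
Local Notation G := (unitary R n).
Local Notation k := (n * n + n * n)%N.
Local Notation emb := (@unitary_embed R n).

Lemma complexify_embed (U : G) : complexify (emb U) = val U.
Proof. exact: realifyK. Qed.

Lemma unitary_embed_inj : injective emb.
Proof. by move=> U V /(congr1 (@complexify R n)); rewrite !complexify_embed => /val_inj. Qed.

Lemma unitary_embed_continuous : continuous emb.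
Proof. exact: initial_continuous. Qed.

Lemma to_unitary_continuous (T : topologicalType) (f : T -> G) t :
  {for t, continuous (emb \o f)} -> {for t, continuous f}.
Proof.
by move=> cf U [? [[W oW <-]]] /= Wft /filterS; apply; apply: cf; exact: open_nbhs_nbhs.
Qed.

Lemma of_unitary_continuous K (h : 'M[R[i]]_n -> 'rV[R]_K) (U : G) :
  smooth_at (fun v => h (complexify v)) (emb U) ->
  {for U, continuous (fun V : G => h (val V))}.
Proof.
move=> /smooth_at_continuous ch.
rewrite (_ : (fun V : G => _) = (fun v => h (complexify v)) \o emb); last first.
  by apply/funext => V /=; rewrite complexify_embed.
exact: (continuous_comp (@unitary_embed_continuous U) ch).
Qed.

Lemma mxsmooth_unitary_continuous N (f : 'rV[R]_N -> G) x :
  mxsmooth_at (fun y => val (f y)) x -> {for x, continuous f}.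
Proof.
by move=> /smooth_at_realify/smooth_at_continuous cf; exact: to_unitary_continuous.
Qed.

Lemma rV_continuous (T : topologicalType) m (f : T -> 'rV[R]_m) t :
  (forall j, {for t, continuous (fun s => f s 0 j)}) -> {for t, continuous f}.
Proof.
move=> cf A [P Pn PA].
have : \forall s \near t, forall j, P 0 j (f s 0 j).
  by apply: (@filter_forall _ _ (fun j s => P 0 j (f s 0 j)) (nbhs t) _) => j; exact: cf.
by apply: filterS => s Ps; apply: PA => i j; rewrite (ord1 i).
Qed.

Lemma row_mx_continuous (T : topologicalType) m p (f : T -> 'rV[R]_m) (g : T -> 'rV[R]_p) t :
  {for t, continuous f} -> {for t, continuous g} ->
  {for t, continuous (fun s => row_mx (f s) (g s))}.
Proof.
move=> cf cg; apply: rV_continuous => j; case: (splitP j) => j' Ej.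
  rewrite (_ : (fun s => _) = (fun v : 'rV[R]_m => v 0 j') \o f); last first.
    apply/funext => s /=; rewrite (_ : j = lshift _ j') ?row_mxEl//; exact: val_inj.
  by apply: continuous_comp => //; exact: coord_continuous.
rewrite (_ : (fun s => _) = (fun v : 'rV[R]_p => v 0 j') \o g); last first.
  apply/funext => s /=; rewrite (_ : j = rshift _ j') ?row_mxEr//; exact: val_inj.
by apply: continuous_comp => //; exact: coord_continuous.
Qed.

Lemma smooth_at_lsubmx m p (v : 'rV[R]_(m + p)) : smooth_at lsubmx v.
Proof.
apply/smooth_at_rowP => j; apply: smooth_at_eq (smooth_at_coord (lshift _ j) v).
by move=> y; rewrite mxE.
Qed.

Lemma smooth_at_rsubmx m p (v : 'rV[R]_(m + p)) : smooth_at rsubmx v.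
Proof.
apply/smooth_at_rowP => j; apply: smooth_at_eq (smooth_at_coord (rshift _ j) v).
by move=> y; rewrite mxE.
Qed.

Lemma unitary_mul_continuous : continuous (fun p : G * G => (p.1 * p.2)%g).
Proof.
move=> p; apply: to_unitary_continuous.
pose h (v : 'rV[R]_(k + k)) := realify (complexify (lsubmx v) *m complexify (rsubmx v)).
rewrite (_ : _ \o _ = h \o (fun p : G * G => row_mx (emb p.1) (emb p.2))); last first.
  by apply/funext => q /=; rewrite /h row_mxKl row_mxKr !complexify_embed.
apply: continuous_comp.
  apply: row_mx_continuous.
    by apply: continuous_comp; [exact: cvg_fst|exact: unitary_embed_continuous].
  by apply: continuous_comp; [exact: cvg_snd|exact: unitary_embed_continuous].
apply: smooth_at_continuous; apply/smooth_at_realify; apply: mxsmooth_at_mul.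
  by apply: mxsmooth_at_comp; [exact: smooth_at_lsubmx|exact: mxsmooth_at_complexify].
by apply: mxsmooth_at_comp; [exact: smooth_at_rsubmx|exact: mxsmooth_at_complexify].
Qed.

Lemma unitary_inv_continuous : continuous (fun U : G => (U^-1)%g).
Proof.
move=> U; apply: to_unitary_continuous.
apply: (@of_unitary_continuous _ (fun A => realify (A^t*))).
by apply/smooth_at_realify; apply: mxsmooth_at_adj; exact: mxsmooth_at_complexify.
Qed.

Lemma unitary_mull_continuous (U : G) : continuous (fun V : G => (U * V)%g).
Proof.
move=> V; apply: (@continuous_comp _ _ _ (fun V => (U, V)) (fun p : G * G => (p.1 * p.2)%g)).
  exact: (@cvg_pair _ _ _ (nbhs V) (nbhs U) (nbhs V) _ _ _ (fun=> U) id (cvg_cst _) cvg_id).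
exact: unitary_mul_continuous.
Qed.

Lemma unitary_mulr_continuous (U : G) : continuous (fun V : G => (V * U)%g).
Proof.
move=> V; apply: (@continuous_comp _ _ _ (fun V => (V, U)) (fun p : G * G => (p.1 * p.2)%g)).
  exact: (@cvg_pair _ _ _ (nbhs V) (nbhs V) (nbhs U) _ _ _ id (fun=> U) cvg_id (cvg_cst _)).
exact: unitary_mul_continuous.
Qed.

Lemma unitary_hausdorff : hausdorff_space G.
Proof.
move=> U V UV; apply: unitary_embed_inj; apply: (@norm_hausdorff _ 'rV[R]_k).
move=> A B nA nB.
have [W [WA WB]] := UV _ _ (unitary_embed_continuous nA) (unitary_embed_continuous nB).
by exists (emb W).
Qed.

Lemma unitary_entry_le1 (U : G) i j : `|val U i j| <= 1.
Proof.
have /unitarymxP/matrixP/(_ i i) := valP U.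
rewrite !mxE eqxx (bigD1 j)//= !mxE -normCK => Uij.
have : `|val U i j| ^+ 2 <= 1.
  rewrite -[leRHS]Uij lerDl sumr_ge0// => l _; rewrite !mxE -normCK; exact: exprn_ge0.
by rewrite -{1}(expr1n _ 2) ler_sqr ?nnegrE.
Qed.

(** The image of the embedding is bounded and closed in a finite-dimensional space. Compactness
    comes back to U(n) because its topology is the initial one. *)
Lemma unitary_compact : compact [set: G].
Proof.
have cr : compact (range emb).
  apply: bounded_closed_compact.
    exists 1; split=> // M M1 _ [U _ <-] /=.
    rewrite /Num.Def.normr/= mx_normrE; apply: (bigmax_le _ (ltW (lt_trans _ M1)))=> //.
    move=> [i l] _; apply: le_trans (ltW M1); rewrite (ord1 i) /=.
    have H := unitary_entry_le1 U.
    have [Hr Hi] : (forall a b, `|complex.Re (val U a b)| <= 1) /\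
        (forall a b, `|complex.Im (val U a b)| <= 1).
      split=> a b; rewrite -lecR (le_trans _ (H a b))//.
        exact: normc_ge_Re.
      (* The imaginary part of z is, up to sign, the real part of z times i, and i has modulus 1. *)
      rewrite -normrN -ReiNIm (le_trans (normc_ge_Re _))// normrM.
      by rewrite [X in _ * X](_ : _ = 1) ?mulr1// normc_def /= expr0n expr1n add0r sqrtr1.
    case: (splitP l) => l' El.
      rewrite (_ : l = lshift _ l'); last exact: val_inj.
      by rewrite row_mxEl; case/mxvec_indexP: l' {El} => a b; rewrite mxvecE mxE.
    rewrite (_ : l = rshift _ l'); last exact: val_inj.
    by rewrite row_mxEr; case/mxvec_indexP: l' {El} => a b; rewrite mxvecE mxE.
  (* Closedness: U(n) is the fibre of the continuous map sending V to V times its adjoint, over the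
     identity. *)
  pose h (v : 'rV[R]_k) := realify (complexify v *m (complexify v)^t*).
  have -> : range emb = h @^-1` [set realify 1%:M].
    apply/seteqP; split=> [_ [U _ <-]|v] /=.
      by rewrite /h complexify_embed; congr realify; apply/unitarymxP; exact: valP.
    move=> /(congr1 (@complexify R n)); rewrite !realifyK => /unitarymxP uv.
    exists (exist (fun A : 'M[R[i]]_n => A \is unitarymx) _ uv : G) => //.
    exact: complexifyK.
  apply: preimage_closed.
    move=> v _; apply: smooth_at_continuous; apply/smooth_at_realify.
    apply: mxsmooth_at_mul; last apply: mxsmooth_at_adj; exact: mxsmooth_at_complexify.
  by apply: accessible_closed_set1; apply: hausdorff_accessible; exact: norm_hausdorff.
(* A cluster point of the image filter is the image of some U. Every neighbourhood of U contains the
   preimage of an open set of the ambient space, so U is a cluster point of F. *)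
move=> F PF _; have [|_ [[U _ <-] cU]] := cr (emb @ F) _.
  by apply: (@filterS _ F _ [set: G]); [move=> U _; exists U|exact: filterT].
exists U; split=> // A B FA [_ [[W oW <-] WU] WB].
have [_ [[V AV <-] WV]] : (emb @` A) `&` W !=set0.
  apply: cU; last exact: open_nbhs_nbhs.
  by apply: (@filterS _ F _ A) => // V AV; exists V.
by exists V; split => //; exact: WB.
Qed.

(** Compact pseudometric spaces are second countable. The pseudometric is pulled back along the
    embedding, and the identity serves as base point. *)
Lemma unitary_second_countable : @second_countable G.
Proof.
pose T := initial_topology emb.
pose P := isPointed.Build T (1%g : G).
pose X : pseudoPMetricType R := HB.pack T P.
exact: (@compact_second_countable R X unitary_compact).
Qed.

End UnitaryTopology.

(** * The Cayley transform *)

Section Cayley.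
Context (R : realType) (n : nat).
Local Notation C := R[i].
Local Notation "1" := (1%:M : 'M[C]_n).

(** An involution exchanging skew-Hermitian matrices and the unitary V with 1 + V invertible, so one
    formula gives both a chart and its inverse. *)
Definition cayley (A : 'M[C]_n) : 'M[C]_n := (1 - A) *m invmx (1 + A).

Lemma adj_mul m p q (A : 'M[C]_(m, p)) (B : 'M[C]_(p, q)) : (A *m B)^t* = B^t* *m A^t*.
Proof. by rewrite trmx_mul map_mxM. Qed.

Lemma adjD m p (A B : 'M[C]_(m, p)) : (A + B)^t* = A^t* + B^t*.
Proof. by apply/matrixP => i j; rewrite !mxE rmorphD. Qed.

Lemma adjN m p (A : 'M[C]_(m, p)) : (- A)^t* = - A^t*.
Proof. by apply/matrixP => i j; rewrite !mxE rmorphN. Qed.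

Lemma adj1 : 1^t* = 1.
Proof. by rewrite trmx1 map_mx1. Qed.

Lemma mul_adj_eq0 m p (u : 'M[C]_(m, p)) : u *m u^t* = 0 -> u = 0.
Proof.
move=> /matrixP u0; apply/matrixP => i j; rewrite mxE.
have := u0 i i; rewrite !mxE => /eqP; rewrite psumr_eq0; last first.
  by move=> l _; rewrite !mxE -normCK exprn_ge0.
move=> /allP/(_ j); rewrite mem_index_enum => /(_ isT).
by rewrite /= !mxE -normCK sqrf_eq0 normr_eq0 => /eqP.
Qed.

Lemma adj_inv (A : 'M[C]_n) : A \in unitmx -> (invmx A)^t* = invmx (A^t*).
Proof. by move=> Au; rewrite trmx_inv map_invmx. Qed.

(** If the rows of u span the left kernel, u u^t* equals - u A u^t*. The former is Hermitian and the
    latter skew-Hermitian, so both are 0 and u = 0. *)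
Lemma skew_unit (A : 'M[C]_n) : A^t* = - A -> 1 + A \in unitmx.
Proof.
move=> sA; rewrite -row_free_unit -kermx_eq0; apply/eqP.
have := mulmx_ker (1 + A); move: (kermx _) => u.
rewrite mulmxDr mulmx1 => /eqP; rewrite addr_eq0 => /eqP uE.
have E : u *m u^t* = - (u *m A *m u^t*) by rewrite {1}uE mulNmx.
have E' : u *m u^t* = u *m A *m u^t*.
  have : (u *m u^t*)^t* = (- (u *m A *m u^t*))^t* by rewrite -E.
  by rewrite adjN !adj_mul trmxCK sA mulNmx mulmxN opprK mulmxA.
have /eqP : (2%:R : C) *: (u *m u^t*) = 0.
  by rewrite scaler_nat mulr2n {1}E -E' addNr.
by rewrite scaler_eq0 pnatr_eq0 /= => /eqP/mul_adj_eq0.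
Qed.

Lemma cayley_comm (A : 'M[C]_n) : (1 - A) *m (1 + A) = (1 + A) *m (1 - A).
Proof. by rewrite mulmxDr mulmx1 mulmxBl mul1mx [RHS]mulmxDl mul1mx mulmxBr mulmx1. Qed.

Lemma cayley_commV (A : 'M[C]_n) : 1 + A \in unitmx ->
  invmx (1 + A) *m (1 - A) = (1 - A) *m invmx (1 + A).
Proof.
by move=> Au; apply: (can_inj (mulKmx Au)); rewrite mulKVmx// mulmxA -cayley_comm mulmxK.
Qed.

Lemma cayley_unitary (A : 'M[C]_n) : A^t* = - A -> cayley A \is unitarymx.
Proof.
move=> sA; have Au := skew_unit sA.
have Bu : 1 - A \in unitmx by apply: skew_unit; rewrite adjN sA.
apply/unitarymxP; rewrite /cayley -(cayley_commV Au) adj_mul (adj_inv Au) !adjD adjN adj1 sA opprK.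
by rewrite -mulmxA [X in _ *m X]mulmxA cayley_comm (mulmxK Bu) (mulVmx Au).
Qed.

Lemma cayley1D (A : 'M[C]_n) : 1 + A \in unitmx ->
  1 + cayley A = 2 *: invmx (1 + A).
Proof.
move=> Au; apply: (can_inj (mulmxK Au)).
rewrite mulmxDl mul1mx /cayley mulmxKV// -scalemxAl mulVmx//.
by rewrite addrACA subrr addr0 scaler_nat mulr2n.
Qed.

Lemma cayley1B (A : 'M[C]_n) : 1 + A \in unitmx ->
  1 - cayley A = 2 *: (A *m invmx (1 + A)).
Proof.
move=> Au; apply: (can_inj (mulmxK Au)).
rewrite mulmxBl mul1mx /cayley mulmxKV// -scalemxAl mulmxKV//.
by rewrite opprB addrCA [1 + A]addrC addrK scaler_nat mulr2n.
Qed.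

Lemma cayley1D_unit (A : 'M[C]_n) : 1 + A \in unitmx -> 1 + cayley A \in unitmx.
Proof.
move=> Au; rewrite cayley1D// unitmxZ ?unitmx_inv//.
by rewrite unitfE pnatr_eq0.
Qed.

Lemma cayleyK (A : 'M[C]_n) : 1 + A \in unitmx -> cayley (cayley A) = A.
Proof.
move=> Au; rewrite {1}/cayley cayley1B//; apply: (can_inj (mulmxK (cayley1D_unit Au))).
by rewrite mulmxKV ?cayley1D_unit// cayley1D// scalemxAr.
Qed.

Lemma cayley_skew (V : 'M[C]_n) : V \is unitarymx -> 1 + V \in unitmx ->
  (cayley V)^t* = - cayley V.
Proof.
move=> uV Vu.
have VV : V^t* *m V = 1 by apply: mulmx1C; exact/unitarymxP.
have aVu : (1 + V)^t* \in unitmx by rewrite map_unitmx unitmx_tr.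
rewrite /cayley adj_mul (adj_inv Vu); apply: (can_inj (mulKmx aVu)).
rewrite (mulKVmx aVu); apply: (can_inj (mulmxK Vu)).
rewrite mulmxN mulNmx -mulmxA (mulmxKV Vu) !adjD adjN adj1.
rewrite mulmxDr mulmx1 mulmxBl VV mul1mx mulmxDl mul1mx mulmxBr mulmx1 VV.
by rewrite opprD !opprB addrC.
Qed.

Lemma mxsmooth_at_cayley N (f : 'rV[R]_N -> 'M[C]_n) x :
  mxsmooth_at f x -> 1 + f x \in unitmx -> mxsmooth_at (fun y => cayley (f y)) x.
Proof.
move=> sf fu; have s1 : mxsmooth_at (fun=> 1) x by exact: mxsmooth_at_cst.
apply: mxsmooth_at_mul; first exact: mxsmooth_atB.
by apply: mxsmooth_at_inv => //; exact: mxsmooth_atD.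
Qed.

(* A skew-Hermitian matrix is (X - X^T) + i (X + X^T) for a unique real matrix X. *)
Definition skew_of_row (x : 'rV[R]_(n * n)) : 'M[C]_n :=
  \matrix_(i, j) ((vec_mx x i j - vec_mx x j i) +i* (vec_mx x i j + vec_mx x j i)).

Definition row_of_skew (A : 'M[C]_n) : 'rV[R]_(n * n) :=
  mxvec (\matrix_(i, j) (2^-1 * (complex.Re (A i j) + complex.Im (A i j)))).

Lemma skew_of_row_skew x : (skew_of_row x)^t* = - skew_of_row x.
Proof.
apply/matrixP => i j; rewrite !mxE; apply/eqP; rewrite eq_complex /=.
by apply/andP; split; apply/eqP; ring.
Qed.

Lemma skew_of_rowK : cancel skew_of_row row_of_skew.
Proof.
move=> x; rewrite /row_of_skew -[RHS]vec_mxK; congr mxvec.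
apply/matrixP => i j; rewrite !mxE /=; lra.
Qed.

Lemma row_of_skewK (A : 'M[C]_n) : A^t* = - A -> skew_of_row (row_of_skew A) = A.
Proof.
move=> /matrixP sA; apply/matrixP => i j; rewrite mxE /row_of_skew mxvecK !mxE.
have := sA i j; rewrite !mxE; case: (A i j) (A j i) => [a b] [c d] /= -[ca db].
by congr (_ +i* _); lra.
Qed.

Lemma mxsmooth_at_skew_of_row x : mxsmooth_at skew_of_row x.
Proof.
have H i j : smooth_at (fun y : 'rV[R]_(n * n) => vec_mx y i j) x.
  by apply: smooth_at_eq (smooth_at_coord (mxvec_index i j) x) => y; rewrite mxE.
move=> i j; split.
  by apply: smooth_at_eq (smooth_atB (H i j) (H j i)) => y; rewrite [in RHS]mxE.
by apply: smooth_at_eq (smooth_atD (H i j) (H j i)) => y; rewrite [in RHS]mxE.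
Qed.

Lemma smooth_at_row_of_skew N (f : 'rV[R]_N -> 'M[C]_n) x :
  mxsmooth_at f x -> smooth_at (fun y => row_of_skew (f y)) x.
Proof.
move=> sf; apply/smooth_at_rowP => l; case/mxvec_indexP: l => i j.
have s2 : smooth_at (fun=> 2^-1 : R) x by exact: smooth_at_cst.
have [fr fi] := sf i j.
by apply: smooth_at_eq (smooth_atM s2 (smooth_atD fr fi)) => y; rewrite mxvecE mxE.
Qed.

End Cayley.

(** * Charts and Lie group structure of U(n) *)

Section UnitaryLieGroup.
Context (R : realType) (n : nat).
Local Notation G := (unitary R n).
Local Notation k := (n * n + n * n)%N.
Local Notation emb := (@unitary_embed R n).

Lemma unitary_chart_inv_smooth (c : chart R G (n ^ 2)%N) x :
  unitary_atlas R n c -> chart_img c x ->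
  mxsmooth_at (fun y => val (chart_inv c y)) x.
Proof.
move=> [[_ oi _ _ _] si _] cx; apply/smooth_at_realify.
by have := smooth_on_at oi si cx.
Qed.

(** Together with the previous lemma, this replaces charts of U(n) by matrix entries. Near the
    point, the chart map is the restriction of a smooth map F on an open set of the ambient space,
    and F can be composed with the embedded f. *)
Lemma unitary_chart_map_smooth (c : chart R G (n ^ 2)%N) K (f : 'rV[R]_K -> G) x :
  unitary_atlas R n c -> mxsmooth_at (fun y => val (f y)) x ->
  chart_dom c (f x) -> smooth_at (fun y => chart_map c (f y)) x.
Proof.
move=> [[od _ _ _ _] _ ext] sf cfx.
have [W [F [oW Wfx sF FE]]] := ext _ cfx.
have sef : smooth_at (fun y => emb (f y)) x by apply/smooth_at_realify.
have cf := mxsmooth_unitary_continuous sf.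
apply: (@smooth_at_near _ _ _ (fun y => F (emb (f y)))); last first.
  by apply: smooth_at_comp => //; exact: smooth_on_at sF _.
near=> y; apply: FE; near: y.
  by apply: cf; exact: open_nbhs_nbhs.
by apply: (smooth_at_continuous sef); exact: open_nbhs_nbhs.
Unshelve. all: by end_near. Qed.

Definition unitary_cayley (x : 'rV[R]_(n * n)) : G :=
  exist (fun A : 'M[R[i]]_n => A \is unitarymx) _
    (cayley_unitary (skew_of_row_skew x)).

Lemma unitary_cayleyK (V : G) : 1%:M + val V \in unitmx ->
  unitary_cayley (row_of_skew (cayley (val V))) = V.
Proof.
move=> Vu; apply: val_inj.
exact: etrans (congr1 (@cayley R n) (row_of_skewK (cayley_skew (valP V) Vu))) (cayleyK Vu).
Qed.

Definition cayley_chart (U : G) : chart R G (n ^ 2)%N :=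
  @Chart R G (n ^ 2)%N [set V | 1%:M + val (U^-1 * V)%g \in unitmx]
    (fun V => row_of_skew (cayley (val (U^-1 * V)%g)))
    (fun x => (U * unitary_cayley x)%g).

Lemma cayley_chart_dom U x : chart_dom (cayley_chart U) (U * unitary_cayley x)%g.
Proof.
rewrite -[chart_dom _ _]/(is_true (1%:M + val (U^-1 * (U * _))%g \in unitmx)) mulKg.
by apply: cayley1D_unit; apply: skew_unit; exact: skew_of_row_skew.
Qed.

Lemma cayley_chartK U : cancel (chart_inv (cayley_chart U)) (chart_map (cayley_chart U)).
Proof.
move=> x; rewrite -[LHS]/(row_of_skew (cayley (val (U^-1 * (U * _))%g))) mulKg /=.
rewrite cayleyK ?skew_of_rowK//.
by apply: skew_unit; exact: skew_of_row_skew.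
Qed.

Lemma mxsmooth_at_mul_cst (A : 'M[R[i]]_n) (v : 'rV[R]_k) :
  mxsmooth_at (fun v => A *m complexify v) v.
Proof.
by apply: mxsmooth_at_mul; [exact: mxsmooth_at_cst|exact: mxsmooth_at_complexify].
Qed.

Lemma cayley_chart_atlas U : unitary_atlas R n (cayley_chart U).
Proof.
pose A := val (U^-1)%g.
have VE (V : G) : val (U^-1 * V)%g = A *m complexify (emb V) by rewrite complexify_embed.
(* The chart formula makes sense for every matrix v with 1 + A v invertible, not only for unitary
   ones. This ambient open set carries the smooth extension F of the chart map. *)
pose W := [set v : 'rV[R]_k | 1%:M + A *m complexify v \in unitmx].
have sW (v : 'rV[R]_k) : mxsmooth_at (fun v => 1%:M + A *m complexify v) v.
  apply: (@mxsmooth_atD _ _ _ _ (fun=> 1%:M)); first exact: mxsmooth_at_cst.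
  exact: mxsmooth_at_mul_cst.
have oW : open W.
  rewrite openE => v; rewrite /W /= unitmxE unitfE => Wv.
  have := csmooth_at_neq0 (csmooth_at_det (sW v)) Wv.
  by rewrite /interior; congr nbhs; apply/funext => u; rewrite /= unitmxE unitfE.
have domW : chart_dom (cayley_chart U) = emb @^-1` W.
  by apply/seteqP; split=> V /=; rewrite /W /= -VE.
have od : open (chart_dom (cayley_chart U)) by rewrite domW; exists W.
pose F (v : 'rV[R]_k) : 'rV[R]_(n ^ 2) := row_of_skew (cayley (A *m complexify v)).
have sF v : W v -> smooth_at F v.
  move=> Wv; apply: smooth_at_row_of_skew; apply: mxsmooth_at_cayley => //.
  exact: mxsmooth_at_mul_cst.
(* 1 + A is invertible for every skew-Hermitian A, so the chart covers all of its coordinate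
   space. *)
have imgT : chart_img (cayley_chart U) = setT.
  apply/seteqP; split => // x _; exists (U * unitary_cayley x)%g.
    exact: cayley_chart_dom.
  exact: cayley_chartK.
have si x : mxsmooth_at (fun y => val (chart_inv (cayley_chart U) y)) x.
  apply: mxsmooth_at_mul; first exact: mxsmooth_at_cst.
  apply: mxsmooth_at_cayley; first exact: mxsmooth_at_skew_of_row.
  by apply: skew_unit; exact: skew_of_row_skew.
split.
- split; first exact: od.
  + by rewrite imgT; exact: openT.
  + move=> V Vd; rewrite -[LHS]/(U * unitary_cayley (row_of_skew (cayley (val (U^-1 * V)%g))))%g.
    by rewrite (unitary_cayleyK Vd) mulKVg.
  + rewrite continuous_open_subspace// => V; rewrite inE => Vd.
    apply: (@of_unitary_continuous _ _ _ (fun B => row_of_skew (cayley (A *m B)))).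
    by apply: sF; rewrite /W /= -VE.
  + rewrite imgT; apply: continuous_subspaceT => x.
    exact: mxsmooth_unitary_continuous.
- by apply: smooth_at_on => x _; apply/smooth_at_realify.
- move=> V Vd; exists W, F; split; first exact: oW.
  + by rewrite /W /= -VE.
  + exact: smooth_at_on.
  + by move=> V' _ _; rewrite /F -VE.
Qed.

Lemma unitary_smooth_manifold : smooth_manifold (unitary_atlas R n).
Proof.
split; [exact: unitary_hausdorff|exact: unitary_second_countable|split].
- by move=> c [].
- move=> U; exists (cayley_chart U); first exact: cayley_chart_atlas.
  rewrite -[chart_dom _ _]/(is_true (1%:M + val (U^-1 * U)%g \in unitmx)) mulVg.
  rewrite -[val _]/(1%:M) -mulr2n -scaler_nat unitmxZ ?unitmx1//.
  by rewrite unitfE pnatr_eq0.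
- move=> c c' Ac Ac'; apply: smooth_at_on => _ [U [Ud Ud'] <-].
  apply: unitary_chart_map_smooth => //.
    by apply: unitary_chart_inv_smooth => //; exists U.
  by case: Ac => -[_ _ -> //].
Qed.

Lemma unitary_lie_group : unitary_is_lie_group R n.
Proof.
split; first exact: unitary_smooth_manifold.
- split; first exact: unitary_mul_continuous.
  move=> _ c [c1 A1 [c2 A2 <-]] Ac; apply: smooth_at_on => _ [[U V] [[/= d1 d2] d] <-] /=.
  apply: (@unitary_chart_map_smooth c _
    (fun v => chart_inv c1 (lsubmx v) * chart_inv c2 (rsubmx v))%g) => //.
    apply: mxsmooth_at_mul.
      apply: (mxsmooth_at_comp (h := fun y => val (chart_inv c1 y)) (f := lsubmx)).
        exact: smooth_at_lsubmx.
      by apply: unitary_chart_inv_smooth => //; rewrite row_mxKl; exists U.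
    apply: (mxsmooth_at_comp (h := fun y => val (chart_inv c2 y)) (f := rsubmx)).
      exact: smooth_at_rsubmx.
    by apply: unitary_chart_inv_smooth => //; rewrite row_mxKr; exists V.
  rewrite row_mxKl row_mxKr; case: A1 A2 => -[_ _ -> // _ _] _ _ [[_ _ -> //]].
- split; first exact: unitary_inv_continuous.
  move=> c c' Ac Ac'; apply: smooth_at_on => _ [U [d d'] <-].
  apply: (@unitary_chart_map_smooth c' _ (fun v => (chart_inv c v)^-1)%g) => //.
    apply: mxsmooth_at_adj.
    by apply: unitary_chart_inv_smooth => //; exists U.
  by case: Ac => -[_ _ -> //].
Qed.

End UnitaryLieGroup.

(** * Quotients by block groups *)

Lemma pair_continuous (T X Y : topologicalType) (f : T -> X) (g : T -> Y) t :
  {for t, continuous f} -> {for t, continuous g} ->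
  {for t, continuous (fun s => (f s, g s))}.
Proof.
by move=> cf cg; exact: (@cvg_pair _ _ _ (nbhs t) (nbhs (f t)) (nbhs (g t)) _ _ _ f g).
Qed.

Section BlockQuotient.
Context (R : realType) (n : nat) (lam : seq nat).
Local Notation G := (unitary R n).
Local Notation H := (block_group R n lam).
Local Notation Q := (block_quotient R n lam).
Local Notation pi := (@coset_of_unitary R n lam).

Lemma coset_eqP (U V : G) : pi U = pi V <-> H (U^-1 * V)%g.
Proof.
set e := same_coset_equiv R n lam.
have E : (U = V %[mod {eq_quot e}])%qT <-> H (U^-1 * V)%g.
  by split=> [/eqmodP/asboolP //|UV]; apply/eqmodP/asboolP.
exact: E.
Qed.

Lemma coset_surj (q : Q) : exists U, pi U = q.
Proof. by exists (generic_quotient.repr q); rewrite /coset_of_unitary reprK. Qed.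

Lemma coset_mulr U V : H V -> pi (U * V)%g = pi U.
Proof. by move=> HV; apply/esym/coset_eqP; rewrite mulKg. Qed.

Lemma coset_mull A U V : pi U = pi V -> pi (A * U)%g = pi (A * V)%g.
Proof.
move=> /coset_eqP UV; apply/coset_eqP.
by rewrite invMg -mulgA mulKg.
Qed.

Lemma coset_continuous : continuous (pi : G -> Q).
Proof. exact: pi_continuous. Qed.

(** The saturation of an open set is the union of its right translates by elements of the block
    group, each of them open. *)
Lemma coset_open (A : set G) : open A -> open (pi @` A).
Proof.
move=> oA; rewrite /open /= /quotient_open.
have -> : \pi_Q%qT @^-1` (pi @` A) =
    \bigcup_(h in H) ((fun U => U * h)%g @^-1` A).
  apply/seteqP; split=> U.
    move=> [V AV /esym/coset_eqP UV]; exists (U^-1 * V)%g => //=.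
    by rewrite mulKVg.
  by move=> [h Hh /= AUh]; exists (U * h)%g => //; exact: coset_mulr.
apply: bigcup_open => h _; move: (@unitary_mulr_continuous R n h) => /continuousP.
exact.
Qed.

Lemma coset_nbhs (U : G) (A : set G) : nbhs U A -> nbhs (pi U) (pi @` A).
Proof.
rewrite nbhsE => -[B [oB BU] BA].
exists (pi @` B); last exact: image_subset.
by split; [exact: coset_open|exists U].
Qed.

(** Since the projection is open, continuity at a coset can be tested at a single representative of
    it. *)
Lemma from_coset_continuous (T : topologicalType) (f : Q -> T) (U : G) :
  {for U, continuous (f \o pi)} -> {for pi U, continuous f}.
Proof.
move=> cf A /cf /coset_nbhs; apply: filterS => _ [V AV <-]; exact: AV.
Qed.

Lemma coset_second_countable : @second_countable Q.
Proof.
have [B cB [oB bB]] := @unitary_second_countable R n.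
exists ((fun A => pi @` A) @` B); first by exact: (card_le_trans (card_image_le _ _)).
split=> [_ [A BA <-]|q A]; first by apply: coset_open; exact: oB.
have [U <-] := coset_surj q => /coset_continuous.
move=> /(bB U)[C [BC CU] CA]; exists (pi @` C).
  by split; [exists C|exists U].
by move=> _ [V CV <-]; exact: CA.
Qed.

Lemma coset_compact : compact [set: Q].
Proof.
have -> : [set: Q] = pi @` [set: G].
  by apply/seteqP; split=> // q _; have [U <-] := coset_surj q; exists U.
apply: continuous_compact; last exact: unitary_compact.
by apply: continuous_subspaceT; exact: coset_continuous.
Qed.

(** If U^-1 V is outside the closed subgroup, so is A^-1 B for all A near U and B near V. The
    projection being open, the images of the two neighbourhoods are disjoint neighbourhoods of the
    cosets. *)
Lemma coset_hausdorff : closed H -> hausdorff_space Q.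
Proof.
move=> cH p q; have [U <-] := coset_surj p; have [V <-] := coset_surj q => clUV.
apply/coset_eqP; apply: contrapT => nH.
have cm : continuous (fun x : G * G => (x.1^-1 * x.2)%g).
  move=> x; apply: (@continuous_comp _ _ _ (fun x : G * G => ((x.1^-1)%g, x.2))
      (fun p : G * G => (p.1 * p.2)%g)); last exact: unitary_mul_continuous.
  apply: pair_continuous; last exact: cvg_snd.
  apply: (@continuous_comp _ _ _ fst (fun U : G => (U^-1)%g)); first exact: cvg_fst.
  exact: unitary_inv_continuous.
have : nbhs (U, V) ((fun x : G * G => (x.1^-1 * x.2)%g) @^-1` ~` H).
  by apply: cm; apply: open_nbhs_nbhs; split => //; exact: closed_openC.
move=> [[A B] /= [nA nB] AB].
have [_ [[U' AU <-] [V' BV UV]]] := clUV _ _ (coset_nbhs nA) (coset_nbhs nB).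
by apply: (AB (U', V')) => //=; apply/coset_eqP; rewrite UV.
Qed.

Definition coset_act (A : G) (q : Q) : Q := pi (A * generic_quotient.repr q)%g.

Lemma coset_actE A U : coset_act A (pi U) = pi (A * U)%g.
Proof. by apply: coset_mull; rewrite /coset_of_unitary reprK. Qed.

(** A neighbourhood of a coset may be taken to be the image of one of a representative, which
    reduces the claim to continuity of the product of U(n). *)
Lemma coset_act_continuous : continuous (fun p : G * Q => coset_act p.1 p.2).
Proof.
move=> [A q] W; have [U <-] := coset_surj q; rewrite /= coset_actE.
move=> /coset_continuous/(@unitary_mul_continuous R n (A, U))[[B C] /= [nB nC] BCW].
exists (B, pi @` C) => /=; first by split; [|exact: coset_nbhs].
by move=> [A' _] /= [BA' [U' CU' <-]]; rewrite coset_actE; exact: (BCW (A', U')).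
Qed.

(** * Charts of the quotient from a coordinate and a section near the identity *)

Section Charts.
Context (N : nat) (Om : set G) (phi : G -> 'rV[R]_N) (sec : 'rV[R]_N -> G).
Hypothesis Om_open : open Om.
Hypothesis Om1 : Om 1%g.
Hypothesis phi_smooth : forall K (f : 'rV[R]_K -> G) x,
  mxsmooth_at (fun y => val (f y)) x -> Om (f x) -> smooth_at (fun y => phi (f y)) x.
Hypothesis phi_continuous : forall V, Om V -> {for V, continuous phi}.
Hypothesis sec_smooth : forall x, mxsmooth_at (fun y => val (sec y)) x.
Hypothesis phi_eqP : forall V W, Om V -> Om W -> phi V = phi W <-> H (V^-1 * W)%g.
Hypothesis Om_sec : forall V, Om V -> Om (sec (phi V)).
Hypothesis secK : forall x, Om (sec x) -> phi (sec x) = x.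

(** The coordinate is read on an arbitrary representative in the translate of [Om] by U; [phi_eqP]
    makes the choice irrelevant. The default 1 of [xget] is returned only outside the domain. *)
Definition coset_chart (U : G) : chart R Q N :=
  @Chart R Q N [set q | exists2 V, Om V & pi (U * V)%g = q]
    (fun q => phi (xget 1%g [set V | Om V /\ pi (U * V)%g = q]))
    (fun x => pi (U * sec x)%g).

Definition coset_atlas : set (chart R Q N) := range coset_chart.

Lemma coset_chart_mapE U V : Om V -> chart_map (coset_chart U) (pi (U * V)%g) = phi V.
Proof.
move=> OV; rewrite /=; case: xgetP => [W _ [OW /coset_eqP UW]|/(_ V)[]//].
by apply/phi_eqP => //; move: UW; rewrite invMg -mulgA mulKg.
Qed.

(** Only the coset of f x is known to meet the translate of [Om]. One fixed element h of the
    subgroup moves f x into it, and then f y h stays in it for y near x, with the same coset as f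
    y. *)
Lemma coset_chart_map_smooth U K (f : 'rV[R]_K -> G) x :
  mxsmooth_at (fun y => val (f y)) x -> chart_dom (coset_chart U) (pi (f x)) ->
  smooth_at (fun y => chart_map (coset_chart U) (pi (f y))) x.
Proof.
move=> sf [W OW /esym/coset_eqP]; set h := (_ * _)%g => Hh.
pose f' y := (U^-1 * (f y * h))%g.
have f'x : f' x = W by rewrite /f' /h mulKVg mulKg.
have sf' : mxsmooth_at (fun y => val (f' y)) x.
  apply: mxsmooth_at_mul; first exact: mxsmooth_at_cst.
  by apply: mxsmooth_at_mul => //; exact: mxsmooth_at_cst.
apply: (@smooth_at_near _ _ _ (fun y => phi (f' y))); last first.
  by apply: phi_smooth => //; rewrite f'x.
near=> y; have Oy : Om (f' y).
  near: y; apply: (mxsmooth_unitary_continuous sf'); rewrite f'x.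
  exact: open_nbhs_nbhs.
by rewrite -(coset_chart_mapE U Oy) mulKVg coset_mulr.
Unshelve. all: by end_near. Qed.

Lemma coset_chart_is_chart U : is_chart (coset_chart U).
Proof.
(* The section is defined on all rows but may leave [Om]; the image of the chart is where it does
   not, an open set by continuity of [sec]. *)
have imgE : chart_img (coset_chart U) = sec @^-1` Om.
  apply/seteqP; split=> [_ [_ [V OV <-] <-]|x Ox].
    by rewrite coset_chart_mapE//; exact: Om_sec.
  exists (pi (U * sec x)%g); first by exists (sec x).
  by rewrite coset_chart_mapE//; exact: secK.
have domE : chart_dom (coset_chart U) = pi @` ((fun V => U^-1 * V)%g @^-1` Om).
  apply/seteqP; split=> [_ [V OV <-]|_ [V OV <-]].
    by exists (U * V)%g => //=; rewrite mulKg.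
  by exists (U^-1 * V)%g => //; rewrite mulKVg.
have od : open (chart_dom (coset_chart U)).
  rewrite domE; apply: coset_open.
  by move: (@unitary_mull_continuous R n (U^-1)%g) => /continuousP; exact.
have csec : continuous sec by move=> x; exact: mxsmooth_unitary_continuous.
have oi : open (chart_img (coset_chart U)).
  by rewrite imgE; move/continuousP: csec; exact.
split => //.
- move=> _ [V OV <-]; rewrite coset_chart_mapE//=; apply: coset_mull.
  by apply/coset_eqP; apply/phi_eqP => //; [exact: Om_sec|rewrite secK//; exact: Om_sec].
- rewrite continuous_open_subspace// => _ /set_mem[V OV <-].
  apply: from_coset_continuous => A.
  rewrite -[(_ \o _) _]/(chart_map (coset_chart U) (pi (U * V)%g)) coset_chart_mapE// => nA.
  have cV : {for (U * V)%g, continuous (fun W => phi (U^-1 * W)%g)}.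
    apply: (@continuous_comp _ _ _ (fun W => U^-1 * W)%g).
      exact: unitary_mull_continuous.
    by rewrite mulKg; exact: phi_continuous.
  have nW : \forall W \near (U * V)%g, Om (U^-1 * W)%g.
    by apply: (@unitary_mull_continuous R n (U^-1)%g); rewrite mulKg; exact: open_nbhs_nbhs.
  have nAW : \forall W \near (U * V)%g, A (phi (U^-1 * W)%g).
    by apply: cV; rewrite mulKg.
  apply: filterS2 nW nAW => W OW AW.
  by rewrite -[W](mulKVg U) /= -[X in A X]/(chart_map (coset_chart U) _) coset_chart_mapE.
- rewrite continuous_open_subspace// => x _.
  apply: (@continuous_comp _ _ _ (fun x => U * sec x)%g); last exact: coset_continuous.
  by apply: continuous_comp; [exact: csec|exact: unitary_mull_continuous].
Qed.

Lemma coset_smooth_manifold : closed H -> smooth_manifold coset_atlas.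
Proof.
move=> cH; split; [exact: coset_hausdorff|exact: coset_second_countable|split].
- by move=> _ [U _ <-]; exact: coset_chart_is_chart.
- move=> q; have [U <-] := coset_surj q; exists (coset_chart U); first by exists U.
  by exists 1%g => //; rewrite mulg1.
- move=> _ _ [U _ <-] [U' _ <-]; apply: smooth_at_on => _ [_ [[V OV <-] d'] <-].
  rewrite coset_chart_mapE//.
  apply: (@coset_chart_map_smooth U' _ (fun x => U * sec x)%g).
    by apply: mxsmooth_at_mul; [exact: mxsmooth_at_cst|exact: sec_smooth].
  rewrite (_ : pi _ = pi (U * V)%g)//; apply: coset_mull; apply/coset_eqP.
  by apply/phi_eqP => //; [exact: Om_sec|rewrite secK//; exact: Om_sec].
Qed.

(** A smooth local section r of the projection passes through U. In charts, the projection composed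
    with r is the identity near [phi W], so by the chain rule its differential has a right
    inverse. *)
Lemma coset_submersion : smooth_submersion (unitary_atlas R n) coset_atlas pi.
Proof.
have sm c c' : unitary_atlas R n c -> coset_atlas c' ->
    forall U, chart_dom c U -> chart_dom c' (pi U) ->
    smooth_at (chart_map c' \o pi \o chart_inv c) (chart_map c U).
  move=> Ac [U' _ <-] U dU dU'.
  apply: (@coset_chart_map_smooth U' _ (chart_inv c)).
    by apply: unitary_chart_inv_smooth => //; exists U.
  by case: Ac => -[_ _ -> //].
split; first (split; first exact: coset_continuous).
  by move=> c c' Ac Ac'; apply: smooth_at_on => _ [U [dU dU'] <-]; exact: sm.
move=> c c' U Ac Ac' dU dU' w; have sf := sm c c' Ac Ac' U dU dU'.
case: Ac' sf dU' => U1 _ <- sf [W OW piW].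
(* The translated section meets the coset of U, not necessarily at U; right multiplication by h in
   the subgroup makes it pass through U. *)
pose h := ((U1 * sec (phi W))^-1 * U)%g.
have Hh : H h.
  apply/coset_eqP; rewrite -piW; apply: coset_mull; apply/coset_eqP.
  by apply/phi_eqP => //; [exact: Om_sec|rewrite secK//; exact: Om_sec].
pose r x := (U1 * sec x * h)%g.
have rW : r (phi W) = U by rewrite /r /h mulKVg.
have sr : mxsmooth_at (fun x => val (r x)) (phi W).
  apply: mxsmooth_at_mul; last exact: mxsmooth_at_cst.
  by apply: mxsmooth_at_mul; [exact: mxsmooth_at_cst|exact: sec_smooth].
have src : smooth_at (fun x => chart_map c (r x)) (phi W).
  by apply: unitary_chart_map_smooth => //; rewrite rW.
pose f := chart_map (coset_chart U1) \o pi \o chart_inv c.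
rewrite -/f in sf; rewrite -/f.
have [[od _ cK _ _] _ _] := Ac.
have E : \forall x \near phi W, x = f (chart_map c (r x)).
  near=> x; have Ox : Om (sec x).
    near: x; apply: (mxsmooth_unitary_continuous (sec_smooth (phi W))).
    by apply: open_nbhs_nbhs; split => //; exact: Om_sec.
  have dx : chart_dom c (r x).
    near: x; apply: (mxsmooth_unitary_continuous sr); rewrite rW.
    exact: open_nbhs_nbhs.
  by rewrite /f [LHS]/= /comp cK// /r coset_mulr// coset_chart_mapE// secK.
pose F x := chart_map c (r x).
have dF : differentiable F (phi W) := smooth_at_differentiable src.
have Fx : F (phi W) = chart_map c U by rewrite /F rW.
have df : differentiable f (F (phi W)) by rewrite Fx; exact: smooth_at_differentiable.
(* The preimage of w is its image under the differential of the section in charts. *)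
exists ('d F (phi W) w); rewrite -Fx.
rewrite -[LHS]/(('d f (F (phi W)) \o 'd F (phi W)) w) -diff_comp//.
rewrite -deriveE; last exact: differentiable_comp.
by rewrite -(near_eq_derive _ E) derive_id.
Unshelve. all: by end_near. Qed.

(** * Transport of the structure along a bijection with the quotient *)

Section Transport.
Context (M : choiceType) (f : M -> Q).
Local Notation X := (initial_topology f).
Context (g : Q -> X) (act : G -> M -> M).
Hypothesis fK : cancel f g.
Hypothesis gK : cancel g f.
Hypothesis actE : forall A m B, f m = pi B -> f (act A m) = pi (A * B)%g.
Hypothesis H_closed : closed H.

Definition pull_chart (c : chart R Q N) : chart R X N :=
  @Chart R X N (f @^-1` chart_dom c) (fun x => chart_map c (f x)) (fun v => g (chart_inv c v)).

Definition pull_atlas : set (chart R X N) := pull_chart @` coset_atlas.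

Let f_continuous : continuous (f : X -> Q).
Proof. exact: initial_continuous. Qed.

Let g_continuous : continuous (g : Q -> X).
Proof.
by apply: continuous_comp_initial; rewrite (_ : f \o g = id);
  [move=> q; exact: cvg_id|exact/funext].
Qed.

Let act_coset A m : f (act A m) = coset_act A (f m).
Proof. by have [U Um] := coset_surj (f m); rewrite -Um coset_actE; exact: actE. Qed.

Let compat c c' : coset_atlas c -> coset_atlas c' ->
  smooth_on (chart_map c @` (chart_dom c `&` chart_dom c')) (chart_map c' \o chart_inv c).
Proof. by have [_ _ [_ _]] := coset_smooth_manifold H_closed; apply. Qed.

Let pull_img c : chart_img (pull_chart c) = chart_img c.
Proof.
apply/seteqP; split=> [_ [x dx <-]|_ [q dq <-]]; first by exists (f x).
by exists (g q); rewrite /= gK.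
Qed.

Lemma pull_smooth_manifold : smooth_manifold pull_atlas.
Proof.
have [hQ [B cB [oB bB]] [cQ covQ _]] := coset_smooth_manifold H_closed.
split; last split.
- move=> x y xy; apply: (can_inj fK); apply: hQ => A A' nA nA'.
  have [z [Az A'z]] := xy _ _ (f_continuous nA) (f_continuous nA').
  by exists (f z).
- exists ((fun A => f @^-1` A) @` B); first exact: (card_le_trans (card_image_le _ _)).
  split=> [_ [A BA <-]|x A nA]; first by exists A => //; exact: oB.
  have ngA : nbhs (f x) (g @^-1` A) by apply: g_continuous; rewrite fK.
  have [C [BC Cx] CA] := bB _ _ ngA; exists (f @^-1` C).
    by split => //; exists C.
  by move=> y /CA /=; rewrite fK.
- move=> _ [c Ac <-]; have [od oi invK cm ci] := cQ _ Ac.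
  have odp : open (chart_dom (pull_chart c)) by exists (chart_dom c).
  split.
  + exact: odp.
  + by rewrite pull_img.
  + by move=> x dx; rewrite /= invK// fK.
  + move: cm; rewrite !continuous_open_subspace// => cm x /set_mem dx.
    by apply: (@continuous_comp X Q _ f (chart_map c)); [exact: f_continuous|apply: cm; exact: mem_set].
  + move: ci; rewrite pull_img !continuous_open_subspace// => ci v dv.
    by apply: continuous_comp; [exact: ci|exact: g_continuous].
- move=> x; have [c Ac cx] := covQ (f x); exists (pull_chart c) => //.
  by exists c.
- move=> _ _ [c Ac <-] [c' Ac' <-].
  rewrite (_ : _ \o _ = chart_map c' \o chart_inv c); last first.
    by apply/funext => v /=; rewrite gK.
  apply: smooth_on_subset (compat Ac Ac') => _ [x [dx dx'] <-].
  by exists (f x).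
Qed.

Lemma pull_compact : compact [set: X].
Proof.
have -> : [set: X] = g @` [set: Q].
  by apply/seteqP; split=> // x _; exists (f x).
apply: continuous_compact; last exact: coset_compact.
by apply: continuous_subspaceT; exact: g_continuous.
Qed.

Lemma pull_diffeo : smooth_map pull_atlas coset_atlas f /\ smooth_map coset_atlas pull_atlas g.
Proof.
split; split; [exact: f_continuous| |exact: g_continuous|].
- move=> _ c' [c Ac <-] Ac'.
  rewrite (_ : _ \o _ \o _ = chart_map c' \o chart_inv c); last first.
    by apply/funext => v /=; rewrite gK.
  apply: smooth_on_subset (compat Ac Ac') => _ [x [dx dx'] <-].
  by exists (f x).
- move=> c _ Ac [c' Ac' <-].
  rewrite (_ : _ \o _ \o _ = chart_map c' \o chart_inv c); last first.
    by apply/funext => v /=; rewrite gK.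
  apply: smooth_on_subset (compat Ac Ac') => _ [q [dx /= dx'] <-].
  by exists q => //; split => //; rewrite -[q]gK.
Qed.

Lemma pull_homogeneous : @smooth_homogeneous_space R n X N pull_atlas act.
Proof.
split.
- exact: unitary_lie_group.
- exact: pull_smooth_manifold.
- split=> [x|U V x]; apply: (can_inj fK); rewrite !act_coset;
    have [W <-] := coset_surj (f x); rewrite !coset_actE.
    by rewrite mul1g.
  by rewrite mulgA.
- split; first by exists (g (pi 1%g)).
  move=> x y; have [U Ux] := coset_surj (f x); have [V Vy] := coset_surj (f y).
  exists (V * U^-1)%g; apply: (can_inj fK).
  by rewrite act_coset -Ux coset_actE -mulgA mulVg mulg1.
- split.
    apply: continuous_comp_initial => p.
    rewrite (_ : f \o _ = (fun p : G * Q => coset_act p.1 p.2) \o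
      (fun p : G * X => (p.1, f p.2))); last by apply/funext => q /=; exact: act_coset.
    apply: continuous_comp; last exact: coset_act_continuous.
    apply: pair_continuous; first exact: cvg_fst.
    by apply: (@continuous_comp (G * X)%type X Q snd f); [exact: cvg_snd|exact: f_continuous].
  move=> _ _ [c Ac [_ [c' Ac' <-] <-]] [_ [U2 _ <-] <-].
  case: Ac' => U1 _ <-.
  apply: smooth_at_on => _ [[U x] [[/= dU [V OV Vx]] d2] <-].
  set v0 := row_mx _ _.
  (* A unitary-valued lift of the action in charts: the section replaces the point x by a unitary
     matrix depending smoothly on its coordinates. *)
  pose h v := (chart_inv c (lsubmx v) * (U1 * sec (rsubmx v)))%g.
  have -> : (chart_map (pull_chart (coset_chart U2)) \o (fun p : G * X => act p.1 p.2)) \o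
      chart_inv (prod_chart c (pull_chart (coset_chart U1))) =
      (fun v => chart_map (coset_chart U2) (pi (h v))).
    apply/funext => v; rewrite /comp -[LHS]/(chart_map (coset_chart U2) (f (act _ _))).
    by rewrite act_coset /= gK coset_actE.
  (* The lift need not be U times a chosen representative of x; agreement of cosets is all that
     [coset_chart_map_smooth] asks for. *)
  have h0 : pi (h v0) = f (act U x).
    rewrite act_coset -Vx coset_actE /h row_mxKl row_mxKr.
    have -> : chart_inv c (chart_map c U) = U by case: Ac => -[_ _ -> //].
    do 2! apply: coset_mull; rewrite -[X in sec X]/(chart_map (coset_chart U1) (f x)) -Vx.
    rewrite coset_chart_mapE//; apply/coset_eqP.
    by apply/phi_eqP => //; [exact: Om_sec|rewrite secK//; exact: Om_sec].
  apply: (@coset_chart_map_smooth U2 _ h); last by rewrite h0.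
  apply: mxsmooth_at_mul.
    apply: (mxsmooth_at_comp (h := fun y => val (chart_inv c y)) (f := lsubmx)).
      exact: smooth_at_lsubmx.
    by apply: unitary_chart_inv_smooth => //; rewrite row_mxKl; exists U.
  apply: mxsmooth_at_mul; first exact: mxsmooth_at_cst.
  apply: (mxsmooth_at_comp (h := fun y => val (sec y)) (f := rsubmx)).
    exact: smooth_at_rsubmx.
  exact: sec_smooth.
Qed.

End Transport.
End Charts.
End BlockQuotient.

(** * Block LU factorization and Gram-Schmidt *)

Section BlockTriangular.
Context (R : realType) (n : nat) (bk : 'I_n -> nat).
Local Notation C := R[i].
Local Notation M := 'M[C]_n.
Implicit Types (V W L B T h : M).

Lemma unitary_adj_mul V : V \is unitarymx -> V^t* *m V = 1%:M.
Proof. by move=> /unitarymxP/mulmx1C. Qed.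

Definition lead_proj (j : nat) : M := \matrix_(a, b) ((a == b) && (bk a <= j)%N)%:R.

Definition block_upper B := forall a b, (bk b < bk a)%N -> B a b = 0.
Definition block_diag h := forall a b, bk a != bk b -> h a b = 0.
Definition block_unip L := forall a b, (bk a <= bk b)%N -> L a b = (a == b)%:R.

Lemma lead_proj_mul j V a b : (lead_proj j *m V) a b = (bk a <= j)%N%:R * V a b.
Proof.
rewrite mxE (bigD1 a)//= big1 ?addr0 => [|l la]; rewrite !mxE; first by rewrite eqxx.
by rewrite eq_sym (negbTE la) mul0r.
Qed.

Lemma mul_lead_proj j V a b : (V *m lead_proj j) a b = V a b * (bk b <= j)%N%:R.
Proof.
rewrite mxE (bigD1 b)//= big1 ?addr0 => [|l la]; rewrite !mxE; first by rewrite eqxx.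
by rewrite (negbTE la) mulr0.
Qed.

Lemma lead_proj_idem j : lead_proj j *m lead_proj j = lead_proj j.
Proof.
apply/matrixP => a b; rewrite lead_proj_mul !mxE.
by case: (bk a <= j)%N; rewrite ?andbF ?mul0r ?mul1r.
Qed.

(* The leading block of V, up to the j-th, completed by the identity: its determinant is
   the leading block minor, whereas the matrix keeps the size of V. *)
Definition lead j V : M := lead_proj j *m V *m lead_proj j + (1%:M - lead_proj j).

Lemma leadE j V a b :
  lead j V a b = if (bk a <= j)%N && (bk b <= j)%N then V a b else (a == b)%:R.
Proof.
rewrite mxE mul_lead_proj lead_proj_mul !mxE; case: eqVneq => [->|_].
  by case: (bk b <= j)%N; rewrite /= ?mulr1 ?mul1r ?subrr ?addr0 ?mul0r ?add0r ?subr0.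
rewrite subr0 addr0.
by case: (bk a <= j)%N; case: (bk b <= j)%N; rewrite /= ?mulr0 ?mul0r ?mulr1 ?mul1r.
Qed.

Lemma block_upper_proj B j : block_upper B ->
  lead_proj j *m B *m lead_proj j = B *m lead_proj j.
Proof.
move=> uB; apply/matrixP => a b; rewrite !mul_lead_proj lead_proj_mul.
have [aj|ja] := leqP (bk a) j; first by rewrite mul1r.
rewrite mul0r mul0r; have [bj|jb] := leqP (bk b) j; last by rewrite mulr0.
by rewrite uB ?mul0r//; exact: leq_ltn_trans bj ja.
Qed.

(** A block upper B maps the span of the leading coordinates into itself, D B D = B D, so no term of
    V outside its leading block contributes. *)
Lemma lead_mul j V B : block_upper B -> lead j (V *m B) = lead j V *m lead j B.
Proof.
move=> uB; rewrite /lead (block_upper_proj _ uB); set D := lead_proj j.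
have DD : D *m D = D by exact: lead_proj_idem.
have DB : D *m (B *m D) = B *m D by rewrite mulmxA block_upper_proj.
rewrite mulmxDr mulmxBr mulmx1 mulmxDl mulmxBl mul1mx DB subrr addr0.
rewrite (_ : (D *m V *m D + (1%:M - D)) *m D = D *m V *m D); last first.
  by rewrite mulmxDl mulmxBl mul1mx DD subrr addr0 -mulmxA DD.
rewrite [D *m V *m D + _ in RHS]addrC addrK; congr (_ + _).
by rewrite -(mulmxA _ D (B *m D)) DB !mulmxA.
Qed.

(* The factor L of V = L B, column by column: the columns of block j of L are those of
   V times the inverse of the leading block of V up to j. *)
Definition lower_factor V : M :=
  \matrix_(a, b) (V *m lead_proj (bk b) *m invmx (lead (bk b) V)) a b.

Definition lead_regular V := forall b, lead (bk b) V \in unitmx.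

Lemma lead_projC_inv j V : lead j V \in unitmx ->
  (1%:M - lead_proj j) *m invmx (lead j V) = 1%:M - lead_proj j.
Proof.
move=> ju; apply: (can_inj (mulmxK ju)); rewrite (mulmxKV ju).
rewrite /lead; set D := lead_proj j; have DD : D *m D = D by exact: lead_proj_idem.
have E0 : (1%:M - D) *m D = 0 by rewrite mulmxBl mul1mx DD subrr.
by rewrite mulmxDr !mulmxA E0 !mul0mx add0r mulmxBr mulmx1 E0 subr0.
Qed.

Lemma lead_proj_inv j V : lead j V \in unitmx ->
  lead_proj j *m V *m lead_proj j *m invmx (lead j V) = lead_proj j.
Proof.
move=> ju; have : lead j V *m invmx (lead j V) = 1%:M by exact: mulmxV.
rewrite {1}/lead mulmxDl (lead_projC_inv ju) => /(canRL (addrK _)) ->.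
by rewrite subKr.
Qed.

Lemma lower_factor_unip V : lead_regular V -> block_unip (lower_factor V).
Proof.
move=> rV a b ab; rewrite mxE.
have := congr1 (fun A : M => A a b) (lead_proj_inv (rV b)).
rewrite -!mulmxA lead_proj_mul ab mul1r mulmxA => ->.
by rewrite mxE ab andbT.
Qed.

Lemma lower_factor_mul V : lead_regular V ->
  exists2 B, block_upper B & lower_factor V = V *m B.
Proof.
move=> rV; exists (\matrix_(a, b) (lead_proj (bk b) *m invmx (lead (bk b) V)) a b).
  by move=> a b ba; rewrite mxE lead_proj_mul leqNgt ba mul0r.
apply/matrixP => a b; rewrite mxE -mulmxA mxE [RHS]mxE.
by apply: eq_bigr => l _; rewrite [in RHS]mxE.
Qed.

(** Column b of B is supported on the blocks up to that of b, and the part of column b of L in these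
    blocks is the unit vector. Hence the invertible leading block of V sends column b of B to that
    unit vector, which determines it. *)
Lemma lower_factor_unique V L B : lead_regular V -> block_unip L -> block_upper B ->
  L = V *m B -> L = lower_factor V.
Proof.
move=> rV uL uB LVB; apply/matrixP => a b; rewrite mxE.
set j := bk b; set D := lead_proj j.
have DD : D *m D = D by exact: lead_proj_idem.
pose z := B *m col b (1%:M : M).
have Dz : D *m z = z.
  rewrite /z mulmxA; apply/matrixP => c e.
  rewrite -[B in RHS]mulmx1 !mxE; apply: eq_bigr => l _; rewrite mulmx1 lead_proj_mul.
  have [->|lb] := eqVneq l b; last by rewrite !mxE (negbTE lb) !mulr0.
  have [cj|jc] := leqP (bk c) j; first by rewrite mul1r.
  by rewrite uB// !mul0r.
have LE : L *m col b (1%:M : M) = V *m z by rewrite LVB -mulmxA.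
have Kz : lead j V *m z = col b (1%:M : M).
  rewrite /lead mulmxDl mulmxBl mul1mx -/D Dz subrr addr0 -mulmxA Dz -mulmxA -LE.
  apply/matrixP => c e; rewrite mulmxA !mxE (bigD1 b)//= big1 ?addr0.
    rewrite lead_proj_mul !mxE eqxx mulr1.
    have [cj|jc] := leqP (bk c) j; first by rewrite mul1r uL.
    by rewrite mul0r; case: eqVneq jc => // ->; rewrite /j ltnn.
  by move=> l lb; rewrite !mxE (negbTE lb) mulr0.
have zE : z = invmx (lead j V) *m col b (1%:M : M) by rewrite -Kz (mulKmx (rV b)).
have colE (A : M) : (A *m col b (1%:M : M)) a 0 = A a b.
  rewrite mxE (bigD1 b)//= big1 ?addr0 => [|l lb]; rewrite !mxE ?eqxx ?mulr1//.
  by rewrite (negbTE lb) mulr0.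
by rewrite -[L a b]colE LE -Dz zE !mulmxA colE.
Qed.

Hypothesis bk_mono : forall a b : 'I_n, (bk a < bk b)%N -> (a < b)%N.

(** By [bk_mono] blocks are consecutive intervals, so block unipotent matrices are honest
    unitriangular ones and have determinant 1. *)
Lemma block_unip_trig L : block_unip L -> is_trig_mx L /\ forall a, L a a = 1.
Proof.
move=> uL; split=> [|a]; last by rewrite uL// eqxx.
apply/is_trig_mxP => a b ab; rewrite uL; first by case: eqVneq ab => // ->; rewrite ltnn.
by rewrite leqNgt; apply/negP => /bk_mono; rewrite ltnNge (ltnW ab).
Qed.

Lemma unip_unit L : is_trig_mx L -> (forall a, L a a = 1) -> L \in unitmx.
Proof. by move=> tL dL; rewrite unitmxE det_trig// big1 ?unitr1// => a _; rewrite dL. Qed.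

Lemma block_unip_unit L : block_unip L -> L \in unitmx.
Proof. by move=> /block_unip_trig[]; exact: unip_unit. Qed.

Lemma lead_unip_unit j L : block_unip L -> lead j L \in unitmx.
Proof.
move=> /block_unip_trig[/is_trig_mxP tL dL]; apply: unip_unit => [|a].
  apply/is_trig_mxP => a b ab; rewrite leadE; case: ifP => _; first exact: tL.
  by case: eqVneq ab => // ->; rewrite ltnn.
by rewrite leadE; case: ifP; rewrite ?eqxx.
Qed.

(** The product of the two leading blocks is the leading block of L, which is unitriangular. *)
Lemma lead_factor V B L : block_unip L -> block_upper B -> L = V *m B ->
  forall j, lead j V \in unitmx /\ lead j B \in unitmx.
Proof.
move=> uL uB LVB j; have := lead_unip_unit j uL.
by rewrite LVB (lead_mul j V uB) unitmx_mul => /andP.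
Qed.

Lemma mul_adj_entry m p (u : 'M[C]_(m, p)) a : (u *m u^t*) a a = \sum_l `|u a l| ^+ 2.
Proof. by rewrite mxE; apply: eq_bigr => l _; rewrite !mxE normCK. Qed.

(** The leading block of h is an isometry, hence unitary as it is square. Its rows already have norm
    1, as have the full rows of h, so nothing is left to the right of the leading block. *)
Lemma block_upper_diag h : h \is unitarymx -> block_upper h -> block_diag h.
Proof.
move=> hU uh; suff H j a b : (bk a <= j)%N -> (j < bk b)%N -> h a b = 0.
  move=> a b; rewrite neq_ltn => /orP[ab|ba]; last exact: uh.
  exact: (H (bk a)).
pose D := lead_proj j; have DD : D *m D = D by exact: lead_proj_idem.
have DhD : D *m h *m D = h *m D by exact: block_upper_proj.
have Da : D^t* = D.
  apply/matrixP => c e; rewrite !mxE eq_sym; have [->|] := eqVneq; last by rewrite rmorph0.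
  by rewrite conjC_nat.
have hh := unitary_adj_mul hU.
have hhV : h *m h^t* = 1%:M by exact/unitarymxP.
have XX : (D *m h *m D)^t* *m (D *m h *m D) = D.
  by rewrite DhD adj_mul Da -mulmxA [h^t* *m _]mulmxA hh mul1mx.
pose K := lead j h.
(* Completing the leading block by the identity keeps a square matrix, so that a left inverse is
   also a right inverse. *)
have KK : K^t* *m K = 1%:M.
  rewrite /K /lead -/D; set X := D *m h *m D in XX *.
  have XD : X *m (1%:M - D) = 0 by rewrite /X mulmxBr mulmx1 -(mulmxA _ D D) DD subrr.
  have DX : (1%:M - D) *m X = 0.
    by rewrite /X mulmxBl mul1mx !mulmxA DD subrr.
  have DaE : (1%:M - D)^t* = 1%:M - D by rewrite adjD adjN adj1 Da.
  have DXa : X^t* *m (1%:M - D) = 0.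
    by rewrite -{1}DaE -adj_mul DX trmx0 map_mx0.
  rewrite adjD DaE mulmxDl (mulmxDr (X^t*)) (mulmxDr (1%:M - D)) XX DXa DX addr0 add0r.
  by rewrite mulmxBr mulmx1 mulmxBl mul1mx DD subrr subr0 addrC subrK.
have KKV : K *m K^t* = 1%:M by exact: mulmx1C.
have Daj : D *m K = D *m h *m D.
  by rewrite /K /lead -/D mulmxDr mulmxBr mulmx1 DD subrr addr0 !mulmxA DD.
have Y0 : (D *m h *m (1%:M - D)) *m (D *m h *m (1%:M - D))^t* = 0.
  have E1 : (D *m h) *m (D *m h)^t* = D.
    by rewrite adj_mul Da mulmxA -(mulmxA D h) hhV mulmx1 DD.
  have E2 : (D *m h *m D) *m (D *m h *m D)^t* = D.
    by rewrite -Daj adj_mul Da mulmxA -(mulmxA D K) KKV mulmx1 DD.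
  have E3 : (D *m h *m D) *m (D *m h *m D)^t* = (D *m h) *m D *m (D *m h)^t*.
    by rewrite [(D *m h *m D)^t*]adj_mul Da mulmxA -(mulmxA _ D D) DD.
  have E4 : (1%:M - D)^t* = 1%:M - D by rewrite adjD adjN adj1 Da.
  have CC : (1%:M - D) *m (1%:M - D) = 1%:M - D.
    by rewrite mulmxBr mulmx1 mulmxBl mul1mx DD subrr subr0.
  rewrite [X in _ *m X = _]adj_mul E4 mulmxA -(mulmxA (D *m h)) CC.
  by rewrite mulmxBr mulmx1 mulmxBl E1 -E3 E2 subrr.
move/mul_adj_eq0 : Y0 => /matrixP/(_ a b) + aj jb.
rewrite mulmxBr mulmx1 [LHS]mxE [X in _ + X]mxE mul_lead_proj lead_proj_mul aj mul1r.
by rewrite leqNgt jb mulr0 subr0 mxE.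
Qed.

Lemma block_diag_upper h : block_diag h -> block_upper h.
Proof. by move=> dh a b ba; apply: dh; rewrite gtn_eqF. Qed.

Lemma block_diag_adj h : block_diag h -> block_diag (h^t*).
Proof. by move=> dh a b ab; rewrite !mxE dh ?rmorph0// eq_sym. Qed.

Lemma block_upper_mul A B : block_upper A -> block_upper B -> block_upper (A *m B).
Proof.
move=> uA uB a b ba; rewrite mxE big1// => l _.
have [la|al] := ltnP (bk l) (bk a); first by rewrite uA ?mul0r.
by rewrite uB ?mulr0//; exact: leq_trans ba al.
Qed.

Lemma lead_unit_diag j h : h \is unitarymx -> block_diag h -> lead j h \in unitmx.
Proof.
move=> /unitarymxP hU dh.
have : lead j h *m lead j (h^t*) = 1%:M.
  rewrite -(lead_mul j h (block_diag_upper (block_diag_adj dh))).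
  rewrite hU; apply/matrixP => a b; rewrite leadE !mxE.
  by rewrite if_same.
by move=> /mulmx1_unit[-> _].
Qed.

(** From L = V B follows L = (V h) (h^t* B), whose second factor is still block upper; uniqueness
    identifies the factors. *)
Lemma lower_factor_mulr V h : h \is unitarymx -> block_diag h -> lead_regular V ->
  lead_regular (V *m h) /\ lower_factor (V *m h) = lower_factor V.
Proof.
move=> hU dh rV; have uh := block_diag_upper dh.
have rVh : lead_regular (V *m h).
  move=> b; rewrite (lead_mul _ V uh) unitmx_mul; apply/andP; split; first exact: rV.
  exact: lead_unit_diag.
split; first exact: rVh.
have [B uB LVB] := lower_factor_mul rV.
apply/esym; apply: (lower_factor_unique rVh (lower_factor_unip rV) (B := h^t* *m B)).
  by apply: block_upper_mul => //; apply: block_diag_upper; exact: block_diag_adj.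
by rewrite mulmxA mulmxtVK.
Qed.

(** Writing the common factor as V B = W B' gives h B' = B for h = V^t* W. Invertibility of the
    leading blocks of B' makes h block upper, and a unitary block upper matrix is block diagonal. *)
Lemma lower_factor_eq V W : V \is unitarymx -> W \is unitarymx ->
  lead_regular V -> lead_regular W -> lower_factor V = lower_factor W ->
  block_diag (V^t* *m W).
Proof.
move=> uV uW rV rW VW; move hE : (V^t* *m W) => h.
have uh : h \is unitarymx by rewrite -hE; apply: (mul_unitarymx _ uW); rewrite trmxC_unitary; exact: uV.
apply: (block_upper_diag uh).
have [B uB LB] := lower_factor_mul rV; have [B' uB' LB'] := lower_factor_mul rW.
have VV := unitary_adj_mul uV.
have hB : h *m B' = B by rewrite -hE -mulmxA -LB' -VW LB mulmxA VV mul1mx.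
have uL := lower_factor_unip rW.
move=> a b ba.
pose j := bk b; pose D := lead_proj j.
have [_ B'u] := lead_factor uL uB' LB' j.
have DD : D *m D = D by exact: lead_proj_idem.
(* Since B' and B are block upper, the left side is (1 - D) h B' D = (1 - D) B D = 0. *)
have E : (1%:M - D) *m h *m D *m lead j B' = 0.
  rewrite /lead -/D (block_upper_proj j uB') mulmxDr -[_ *m D *m (1%:M - D)]mulmxA.
  rewrite mulmxBr mulmx1 DD subrr mulmx0 addr0 -!mulmxA.
  have -> : D *m (B' *m D) = B' *m D by rewrite mulmxA block_upper_proj.
  rewrite [h *m _]mulmxA hB -(block_upper_proj j uB) mulmxA mulmxA.
  by rewrite mulmxBl mul1mx DD subrr !mul0mx.
have E' : (1%:M - D) *m h *m D = 0.
  by apply: (can_inj (mulmxK B'u)); rewrite E mul0mx.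
move/matrixP : E' => /(_ a b).
rewrite -mulmxA mulmxBl mul1mx [LHS]mxE [X in _ + X]mxE lead_proj_mul mul_lead_proj.
by rewrite leqnn mulr1 leqNgt ba mul0r subr0 mxE.
Qed.

End BlockTriangular.

Lemma mulr_perm4 (A : comPzRingType) (p q r t : A) : p * q * (r * t) = q * t * (p * r).
Proof. by rewrite [p * q]mulrC [r * t]mulrC mulrACA. Qed.

Lemma mulr_perm3 (A : comPzRingType) (p q r : A) : p * q * r = q * (p * r).
Proof. by rewrite [p * q]mulrC mulrA. Qed.

(** * Gram-Schmidt orthonormalization *)

Section GramSchmidt.
Context (R : realType) (n : nat).
Local Notation C := R[i].
Implicit Types (L : 'M[C]_n).

(** Indexed by nat to let the recursion on columns run without ordinals; beyond n it is zero. *)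
Definition unit_col (k : nat) : 'cV[C]_n := \col_i ((i == k :> nat)%:R).

Lemma mul_unit_col L (k : 'I_n) a : (L *m unit_col k) a 0 = L a k.
Proof.
rewrite mxE (bigD1 k)//= big1 ?addr0 => [|l lk]; rewrite !mxE ?eqxx ?mulr1//.
by move: lk; rewrite -val_eqE => /negbTE ->; rewrite mulr0.
Qed.

(** Adds the projection on the line of the component of c orthogonal to the range of P. With
    projections in place of unit vectors the recursion uses only field operations and conjugation;
    the square root occurs once, in the final normalization. *)
Definition gs_step (P : 'M[C]_n) (c : 'cV[C]_n) :=
  P + (((c - P *m c)^t* *m (c - P *m c)) 0 0)^-1 *: ((c - P *m c) *m (c - P *m c)^t*).

(* The orthogonal projection on the span of the first k columns of L. *)
Definition gs_proj L (k : nat) : 'M[C]_n :=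
  iteri k (fun k P => gs_step P (L *m unit_col k)) 0.

Definition gs_vec L (k : nat) : 'cV[C]_n :=
  L *m unit_col k - gs_proj L k *m (L *m unit_col k).

Definition gs_sqnorm L (k : nat) : C := ((gs_vec L k)^t* *m gs_vec L k) 0 0.

Definition gs_scale L (k : nat) : C := ((Num.sqrt (complex.Re (gs_sqnorm L k)))%:C)^-1.

Definition gram_schmidt L : 'M[C]_n := \matrix_(a, b) (gs_vec L b a 0 * gs_scale L b).

Lemma gs_projS L k :
  gs_proj L k.+1 = gs_proj L k + (gs_sqnorm L k)^-1 *: (gs_vec L k *m (gs_vec L k)^t*).
Proof. by []. Qed.

Lemma sqnorm_sum (w : 'cV[C]_n) : (w^t* *m w) 0 0 = \sum_a `|w a 0| ^+ 2.
Proof. by rewrite mxE; apply: eq_bigr => a _; rewrite !mxE mulrC -normCK. Qed.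

Lemma gs_sqnorm_ge0 L k : 0 <= gs_sqnorm L k.
Proof. by rewrite /gs_sqnorm sqnorm_sum sumr_ge0// => a _; rewrite exprn_ge0. Qed.

Lemma gs_sqnorm_eq0 L k : gs_sqnorm L k = 0 -> gs_vec L k = 0.
Proof.
move=> w0; have := @mul_adj_eq0 R _ _ ((gs_vec L k)^t*).
rewrite trmxCK => H; rewrite -[LHS]trmxCK H; first by rewrite trmx0 map_mx0.
by apply/matrixP => i j; rewrite (ord1 i) (ord1 j) [RHS]mxE.
Qed.

Lemma adjE m p (A : 'M[C]_(m, p)) i j : (A^t*) i j = (A j i)^*%R.
Proof. by rewrite !mxE. Qed.

Lemma adjZ m p (a : C) (A : 'M[C]_(m, p)) : (a *: A)^t* = a^*%R *: A^t*.
Proof. by apply/matrixP => i j; rewrite !mxE rmorphM. Qed.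

Lemma gs_proj0 L : gs_proj L 0 = 0.
Proof. by []. Qed.

Lemma gs_vecE L k : gs_vec L k = L *m unit_col k - gs_proj L k *m (L *m unit_col k).
Proof. by []. Qed.

Lemma gs_sqnormE L k : (gs_vec L k)^t* *m gs_vec L k = (gs_sqnorm L k)%:M.
Proof. exact: mx11_scalar. Qed.

Lemma gram_schmidtE L a b : gram_schmidt L a b = gs_vec L b a 0 * gs_scale L b.
Proof. by rewrite mxE. Qed.

Lemma gs_scaleE L k : gs_scale L k = ((Num.sqrt (complex.Re (gs_sqnorm L k)))%:C)^-1.
Proof. by []. Qed.

Lemma gs_scale_conj L k : (gs_scale L k)^*%R = gs_scale L k.
Proof. by apply: conj_Creal; rewrite realV complex_real. Qed.

Lemma gs_scale_sq L k : gs_sqnorm L k != 0 -> gs_scale L k ^+ 2 * gs_sqnorm L k = 1.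
Proof.
move=> n0; have n1 := gs_sqnorm_ge0 L k; rewrite /gs_scale exprVn -rmorphXn /= sqr_sqrtr.
  by rewrite RRe_real ?ger0_real// mulVf.
by move: n1; rewrite lecE => /andP[].
Qed.

Local Opaque gs_proj gs_vec gs_sqnorm gs_scale gram_schmidt.

Section Regular.
Context (L : 'M[C]_n).
Hypothesis Lu : L \in unitmx.
Local Notation P := (gs_proj L).
Local Notation w := (gs_vec L).
Local Notation c k := (L *m unit_col k).

(** The range of the k-th projection lies in the span of the first k columns of L; S holds the
    coefficients. Linear independence of the columns can then be used. *)
Lemma gs_proj_support k : exists2 S : 'M[C]_n, P k = L *m S &
  forall a b : 'I_n, (k <= a)%N -> S a b = 0.
Proof.
elim: k => [|k [S PS S0]].
  by exists 0 => [|a b _]; rewrite ?gs_proj0 ?mulmx0// mxE.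
(* The coefficients of [gs_vec L k] in the columns of L. *)
pose T := unit_col k - S *m c k.
exists (S + (gs_sqnorm L k)^-1 *: (T *m (w k)^t*)).
  by rewrite gs_projS mulmxDr -PS -scalemxAr mulmxA mulmxBr [L *m (S *m _)]mulmxA -PS -gs_vecE.
move=> a b ka; rewrite mxE (S0 a b (ltnW ka)) add0r mxE mxE big1 ?mulr0// => l _.
rewrite [T a l]mxE [X in _ + X]mxE [X in _ - X]mxE big1 => [|p _]; last first.
  by rewrite (S0 a p (ltnW ka)) mul0r.
by rewrite mxE gtn_eqF// subrr mul0r.
Qed.

(** A zero residual would express column k through the previous ones. Cancelling the invertible L
    and reading row k gives 1 = 0. *)
Lemma gs_sqnorm_neq0 (k : 'I_n) : gs_sqnorm L k != 0.
Proof.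
apply/eqP => /gs_sqnorm_eq0 /eqP; rewrite gs_vecE subr_eq0 => /eqP.
have [S -> S0] := gs_proj_support k.
rewrite -mulmxA => /(can_inj (mulKmx Lu))/matrixP/(_ k 0).
rewrite mxE eqxx [RHS]mxE big1 => [/eqP|l _]; first by rewrite oner_eq0.
by rewrite S0// mul0r.
Qed.

Lemma gs_proj_spec k : (k <= n)%N -> (P k)^t* = P k /\ P k *m P k = P k.
Proof.
elim: k => [|k IH] kn; first by rewrite gs_proj0 trmx0 map_mx0 mulmx0.
have [hP iP] := IH (ltnW kn).
have Pw : P k *m w k = 0 by rewrite gs_vecE mulmxBr (mulmxA (P k) (P k)) iP subrr.
have wP : (w k)^t* *m P k = 0 by rewrite -hP -adj_mul Pw trmx0 map_mx0.
have := gs_sqnorm_neq0 (Ordinal kn); rewrite /= => n0.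
have rn : ((gs_sqnorm L k)^-1)^*%R = (gs_sqnorm L k)^-1.
  by apply: conj_Creal; rewrite realV ger0_real// gs_sqnorm_ge0.
have ww := gs_sqnormE L k.
rewrite gs_projS; split; first by rewrite adjD hP adjZ rn adj_mul trmxCK.
rewrite mulmxDl 2!mulmxDr iP -!scalemxAr -!scalemxAl.
rewrite [P k *m (_ *m _)]mulmxA Pw mul0mx scaler0 addr0.
rewrite -[w k *m _ *m P k]mulmxA wP mulmx0 scaler0 add0r.
congr (_ + _ *: _).
rewrite -mulmxA [(w k)^t* *m (_ *m _)]mulmxA ww mul_scalar_mx -scalemxAr scalerA.
by rewrite mulVf// scale1r.
Qed.

Lemma gs_proj_vec k : (k <= n)%N -> P k *m w k = 0.
Proof. by move=> /gs_proj_spec[_ iP]; rewrite gs_vecE mulmxBr (mulmxA (P k) (P k)) iP subrr. Qed.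

Lemma gs_vec_adj_proj k : (k <= n)%N -> (w k)^t* *m P k = 0.
Proof.
by move=> kn; rewrite -(gs_proj_spec kn).1 -adj_mul (gs_proj_vec kn) trmx0 map_mx0.
Qed.

Lemma gs_proj_fix k m (x : 'M[C]_(n, m)) : (k <= n)%N -> P k *m x = x -> P k.+1 *m x = x.
Proof.
move=> kn Px; have wx : (w k)^t* *m x = 0 by rewrite -Px mulmxA (gs_vec_adj_proj kn) mul0mx.
by rewrite gs_projS mulmxDl Px -scalemxAl -mulmxA wx mulmx0 scaler0 addr0.
Qed.

Lemma gs_proj_fix_le k l m (x : 'M[C]_(n, m)) : (k <= l)%N -> (l <= n)%N ->
  P k *m x = x -> P l *m x = x.
Proof.
elim: l => [|l IH]; first by rewrite leqn0 => /eqP ->.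
rewrite leq_eqVlt => /orP[/eqP ->//|kl] ln Px.
by apply: gs_proj_fix; [exact: ltnW|apply: IH => //; exact: ltnW].
Qed.

Lemma gs_proj_step (k : 'I_n) : P k.+1 *m w k = w k /\ P k.+1 *m c k = c k.
Proof.
have kn := ltnW (ltn_ord k); have n0 := gs_sqnorm_neq0 k.
have ww := gs_sqnormE L k.
have Pw : P k.+1 *m w k = w k.
  rewrite gs_projS mulmxDl (gs_proj_vec kn) add0r -scalemxAl -mulmxA ww.
  by rewrite mul_mx_scalar scalerA mulVf// scale1r.
split => //.
have PPc : P k *m (P k *m c k) = P k *m c k by rewrite mulmxA (gs_proj_spec kn).2.
have cE : c k = w k + P k *m c k by rewrite gs_vecE subrK.
by rewrite [X in _ *m X]cE mulmxDr Pw (gs_proj_fix kn PPc) -cE.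
Qed.

(** The earlier vector is fixed by the later projection, which annihilates the later vector. *)
Lemma gs_vec_orth (i k : 'I_n) : i != k -> (w i)^t* *m w k = 0.
Proof.
have H (a b : 'I_n) : (a < b)%N -> (w b)^t* *m w a = 0.
  move=> ab; have bn := ltnW (ltn_ord b).
  rewrite -(gs_proj_fix_le ab bn (gs_proj_step a).1) mulmxA.
  by rewrite (gs_vec_adj_proj bn) mul0mx.
rewrite -val_eqE neq_ltn => /orP[ik|ki]; last exact: H.
by rewrite -[w k]trmxCK -adj_mul (H _ _ ik) trmx0 map_mx0.
Qed.

Lemma gs_vec_col (i k : 'I_n) : (k < i)%N -> (w i)^t* *m c k = 0.
Proof.
move=> ki; have ni := ltnW (ltn_ord i).
rewrite -(gs_proj_fix_le ki ni (gs_proj_step k).2) (mulmxA _ (P i)).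
by rewrite (gs_vec_adj_proj ni) mul0mx.
Qed.

Lemma gs_sqrt_gt0 (k : 'I_n) : 0 < complex.Re (gs_sqnorm L k).
Proof.
have : 0 < gs_sqnorm L k by rewrite lt_def gs_sqnorm_neq0 gs_sqnorm_ge0.
by rewrite ltcE => /andP[].
Qed.

Lemma gram_schmidt_unitary : gram_schmidt L \is unitarymx.
Proof.
apply/unitarymxP; apply: mulmx1C; apply/matrixP => i j.
rewrite mxE [RHS]mxE.
rewrite (eq_bigr (fun a => gs_scale L i * gs_scale L j * ((w i a 0)^*%R * w j a 0))); last first.
  move=> a _; rewrite adjE !gram_schmidtE rmorphM /= gs_scale_conj.
  exact: mulr_perm4.
rewrite -mulr_sumr.
have -> : \sum_a (w i a 0)^*%R * w j a 0 = ((w i)^t* *m w j) 0 0.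
  by rewrite mxE; apply: eq_bigr => a _; rewrite adjE.
have [->|ij] := eqVneq i j; last by rewrite (gs_vec_orth ij) mxE mulr0.
by rewrite gs_sqnormE mxE eqxx mulr1n -expr2 gs_scale_sq// gs_sqnorm_neq0.
Qed.

(** This is the triangular factor of the QR decomposition of L: later vectors are orthogonal to
    earlier columns. *)
Lemma gram_schmidt_upper (i k : 'I_n) : (k < i)%N -> ((gram_schmidt L)^t* *m L) i k = 0.
Proof.
move=> ki; rewrite mxE.
rewrite (eq_bigr (fun a => gs_scale L i * ((w i a 0)^*%R * L a k))); last first.
  move=> a _; rewrite adjE gram_schmidtE rmorphM /= gs_scale_conj.
  exact: mulr_perm3.
rewrite -mulr_sumr.
have -> : \sum_a (w i a 0)^*%R * L a k = ((w i)^t* *m c k) 0 0.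
  by rewrite mxE; apply: eq_bigr => a _; rewrite mul_unit_col adjE.
by rewrite gs_vec_col// mxE mulr0.
Qed.

End Regular.

Section Smooth.
Context (N : nat) (F : 'rV[R]_N -> 'M[C]_n) (x : 'rV[R]_N).
Hypothesis F_smooth : mxsmooth_at F x.
Hypothesis F_unit : F x \in unitmx.

Lemma gs_vec_smooth_of k : mxsmooth_at (fun y => gs_proj (F y) k) x ->
  mxsmooth_at (fun y => gs_vec (F y) k) x.
Proof.
move=> sP; have sc : mxsmooth_at (fun y => F y *m unit_col k) x.
  by apply: mxsmooth_at_mul => //; exact: mxsmooth_at_cst.
by apply: mxsmooth_atB => //; exact: mxsmooth_at_mul.
Qed.

Lemma gs_sqnorm_smooth_of k : mxsmooth_at (fun y => gs_vec (F y) k) x ->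
  csmooth_at (fun y => gs_sqnorm (F y) k) x.
Proof.
move=> sw; apply: csmooth_at_eq (mxsmooth_at_mul (mxsmooth_at_adj sw) sw 0 0) => y.
by rewrite gs_sqnormE mxE.
Qed.

Lemma gs_proj_smooth k : (k <= n)%N -> mxsmooth_at (fun y => gs_proj (F y) k) x.
Proof.
elim: k => [_|k IH kn]; first exact: (mxsmooth_at_cst 0).
have sP := IH (ltnW kn); have sw := gs_vec_smooth_of sP.
apply: mxsmooth_atD => //; apply: mxsmooth_atZ.
  apply: csmooth_atV; first exact: (gs_sqnorm_neq0 F_unit (Ordinal kn)).
  exact: gs_sqnorm_smooth_of.
by apply: mxsmooth_at_mul => //; exact: mxsmooth_at_adj.
Qed.

Lemma gram_schmidt_smooth : mxsmooth_at (fun y => gram_schmidt (F y)) x.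
Proof.
move=> a b; have sw := gs_vec_smooth_of (gs_proj_smooth (ltnW (ltn_ord b))).
apply: csmooth_at_eq (csmooth_atM (sw a 0) _) => [y|].
  by rewrite gram_schmidtE.
apply: csmooth_at_eq (fun y => esym (gs_scaleE (F y) b)) _; apply: csmooth_atV.
  by rewrite -(rmorph0 (real_complex R)) (inj_eq (@complexI R)) gt_eqF// sqrtr_gt0 gs_sqrt_gt0.
apply: csmooth_at_real; apply: smooth_at_sqrt; first exact: gs_sqrt_gt0.
exact: (gs_sqnorm_smooth_of sw).1.
Qed.

End Smooth.
End GramSchmidt.

(** * The stabilizer of a block decomposition *)

Lemma unitary_mul_adj (R : realType) n (V : 'M[R[i]]_n) : V \is unitarymx -> V *m V^t* = 1%:M.
Proof. by move=> /unitarymxP. Qed.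

Section Blocks.
Context (R : realType) (n : nat) (lam : seq nat).
Hypothesis hlam : is_partition n lam.
Local Notation C := R[i].
Local Notation G := (unitary R n).
Local Notation H := (block_group R n lam).
Local Notation k := (size lam).
Local Notation bk := (fun i : 'I_n => reshape_index lam i).

Lemma block_index_lt (i : 'I_n) : (bk i < k)%N.
Proof. by apply: reshape_indexP; case: hlam => _ _ ->. Qed.

Definition block_ord (i : 'I_n) : 'I_k := Ordinal (block_index_lt i).

Lemma block_index_mono (a b : 'I_n) : (bk a < bk b)%N -> (a < b)%N.
Proof. by move=> /= ab; rewrite ltnNge (reshape_leq lam) negb_or -leqNgt (ltnW ab) gtn_eqF. Qed.

Lemma flatten_index_lt j c : (c < nth 0 lam j)%N -> (flatten_index lam j c < n)%N.
Proof. by move=> /flatten_indexP; case: hlam => _ _ ->. Qed.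

Lemma card_block (j : nat) : #|[pred i : 'I_n | bk i == j]| = nth 0%N lam j.
Proof.
pose f (c : 'I_(nth 0%N lam j)) : 'I_n := Ordinal (flatten_index_lt (ltn_ord c)).
have fI : injective f.
  move=> c d /(congr1 (fun i : 'I_n => reshape_offset lam i)) /=.
  by rewrite !flatten_indexKr// => /val_inj.
rewrite -[RHS]card_ord -(card_codom fI); apply: eq_card => i; rewrite !inE.
apply/eqP/codomP => [ij|[c ->]]; last by rewrite /= flatten_indexKl.
have ci : (reshape_offset lam i < nth 0%N lam j)%N.
  by rewrite -ij; apply: reshape_offsetP; case: hlam => _ _ ->.
by exists (Ordinal ci); apply: val_inj; rewrite /= -ij reshape_indexK.
Qed.

Lemma block_ord_surj (j : 'I_k) : exists i, block_ord i = j.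
Proof.
have : (0 < #|[pred i : 'I_n | bk i == j]|)%N.
  rewrite card_block lt0n; apply/eqP => j0.
  by case: hlam => _ /negP + _; apply; rewrite -j0 mem_nth.
by case/card_gt0P => i /eqP ij; exists i; exact: val_inj.
Qed.

(** Block monomial matrices, the block analogue of permutation matrices. [tau] is a bare map because
    it often arises by choice; unitarity makes it a permutation. *)
Definition block_mono (U : 'M[C]_n) (tau : 'I_k -> 'I_k) :=
  forall a b, U a b != 0 -> block_ord a = tau (block_ord b).

Lemma unitary_row_neq0 (U : 'M[C]_n) a : U \is unitarymx -> exists b, U a b != 0.
Proof.
move=> /unitarymxP/matrixP/(_ a a); rewrite mul_adj_entry mxE eqxx => U1.
apply/existsP; apply: contraT; rewrite negb_exists => /forallP U0.
move: U1; rewrite big1 => [/esym/eqP|b _]; first by rewrite oner_eq0.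
by have := U0 b; rewrite negbK => /eqP ->; rewrite normr0 expr0n.
Qed.

(** No row of a unitary matrix vanishes and no block is empty, so [tau] is surjective on a finite
    set; its right inverse is injective, hence bijective. *)
Lemma block_mono_perm (U : G) tau : block_mono (val U) tau ->
  exists s : {perm 'I_k}, tau =1 s.
Proof.
move=> mU.
have surj l : exists j, tau j == l.
  have [a <-] := block_ord_surj l; have [b Uab] := unitary_row_neq0 a (valP U).
  by exists (block_ord b); rewrite -(mU _ _ Uab).
pose r l := xchoose (surj l).
have rK : cancel r tau by move=> l; apply/eqP; exact: (xchooseP (surj l)).
have [q qK Kq] := injF_bij (can_inj rK).
have tauI : injective tau by move=> i j; rewrite -(Kq i) -(Kq j) !rK => ->.
by exists (perm tauI) => i; rewrite permE.
Qed.

Lemma block_mono_mulE (U : 'M[C]_n) (s : {perm 'I_k}) (v : 'cV[C]_n) (j : 'I_k) a :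
  block_mono U s -> block lam j v -> block_ord a != s j -> (U *m v) a 0 = 0.
Proof.
move=> mU vj aj; rewrite mxE big1// => b _.
have [Uab|] := eqVneq (U a b) 0; first by rewrite Uab mul0r.
move=> /mU ab; rewrite vj ?mulr0//; apply: contra aj => /eqP bj.
by rewrite ab (_ : block_ord b = j)//; exact: val_inj.
Qed.

Lemma block_mono_adj (U : 'M[C]_n) (s : {perm 'I_k}) :
  block_mono U s -> block_mono (U^t*) (s^-1)%g.
Proof.
move=> mU a b; rewrite adjE conjC_eq0 => /mU ->; by rewrite permK.
Qed.

Lemma block_mono_image (U : G) (s : {perm 'I_k}) (j : 'I_k) : block_mono (val U) s ->
  (fun v => val U *m v) @` block lam j = block lam (s j).
Proof.
move=> mU; apply/seteqP; split=> [_ [v vj <-] a aj|v vj].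
  by apply: (block_mono_mulE mU vj); rewrite -val_eqE.
exists ((val U)^t* *m v); last first.
  by rewrite mulmxA (unitary_mul_adj (valP U)) mul1mx.
move=> a aj; apply: (block_mono_mulE (block_mono_adj mU) vj).
by rewrite permK -val_eqE.
Qed.

Lemma block_group_fun (U : G) tau : block_mono (val U) tau -> H U.
Proof.
move=> mU; have [s ts] := block_mono_perm mU.
have {}mU : block_mono (val U) s by move=> a b /mU; rewrite ts.
apply/seteqP; split=> [_ [_ [j jk <-] <-]|_ [j jk <-]].
  by rewrite (block_mono_image (Ordinal jk) mU); exists (s (Ordinal jk)) => /=.
have jE : j = s ((s^-1)%g (Ordinal jk)) :> nat by rewrite permKV.
rewrite [in X in _ X]jE -(block_mono_image _ mU).
by exists (block lam ((s^-1)%g (Ordinal jk))) => //; exists ((s^-1)%g (Ordinal jk)) => /=.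
Qed.

(** The image of a block under a stabilizing U is some block. Applied to unit vectors, this confines
    each column of U to the rows of a single block. *)
Lemma block_groupP (U : G) : H U <-> exists s : {perm 'I_k}, block_mono (val U) s.
Proof.
split=> [HU|[s mU]]; last exact: block_group_fun mU.
have tauP (j : 'I_k) : exists l : 'I_k, (fun v => val U *m v) @` block lam j = block lam l.
  have HU' : [set (fun v => val U *m v) @` E | E in @decomposition R n lam] =
    @decomposition R n lam := HU.
  have : @decomposition R n lam ((fun v => val U *m v) @` block lam j).
    by rewrite -HU'; exists (block lam j) => //; exists (j : nat) => /=.
  by move=> [l lk <-]; exists (Ordinal lk).
pose tau j := sval (cid (tauP j)).
have mU : block_mono (val U) tau.
  move=> a b Uab; have /seteqP[+ _] := svalP (cid (tauP (block_ord b))).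
  rewrite -/(tau _) => /(_ (val U *m unit_col R n b)) H1.
  have /(_ a) : block lam (tau (block_ord b)) (val U *m unit_col R n b).
    apply: H1; exists (unit_col R n b) => // c cb; rewrite mxE.
    by move: cb; case: (eqVneq (c : nat) b) => [->|//]; rewrite /= eqxx.
  rewrite mul_unit_col => H2; apply: val_inj => /=; apply/eqP.
  by apply: contraT => /H2 U0; rewrite U0 eqxx in Uab.
by have [s ts] := block_mono_perm mU; exists s => a b /mU; rewrite ts.
Qed.

(** A finite union over the permutations of blocks of sets cut out by vanishing entries. *)
Lemma block_group_closed : closed H.
Proof.
have -> : H = \bigcup_(s in [set: {perm 'I_k}]) [set U : G | block_mono (val U) s].
  apply/seteqP; split=> [U /block_groupP[s mU]|U [s _ mU]]; first by exists s.
  by apply/block_groupP; exists s.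
apply: closed_bigcup => [|s _]; first exact: finite_finset.
have -> : [set U : G | block_mono (val U) s] =
    \bigcap_(p in [set p : 'I_n * 'I_n | block_ord p.1 != s (block_ord p.2)])
      [set U : G | val U p.1 p.2 = 0].
  apply/seteqP; split=> [U mU [a b] /= ab|U mU a b Uab].
    by apply/eqP; apply: contraT => /mU abE; rewrite abE eqxx in ab.
  by apply/eqP; apply: contraT => ab; rewrite (mU (a, b)) ?eqxx in Uab.
apply: closed_bigI => -[a b] _ /=.
(* The entry is recorded as two real coordinates, the form in which continuity on U(n) is
   available. *)
pose h (A : 'M[C]_n) : 'rV[R]_2 := \row_i (if i == 0 then complex.Re (A a b) else complex.Im (A a b)).
have -> : [set U : G | val U a b = 0] = (fun U : G => h (val U)) @^-1` [set 0].
  apply/seteqP; split=> U /=.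
    by move=> U0; apply/rowP => i; rewrite !mxE U0; case: ifP.
  move=> /rowP hU; have := hU 0; have := hU (lift 0 0); rewrite !mxE /=.
  by case: (val U a b) => x y /= -> ->.
apply: preimage_closed.
  move=> U _; apply: of_unitary_continuous; apply/smooth_at_rowP => i.
  have [sr si] := @mxsmooth_at_complexify R n (unitary_embed U) a b.
  case i0 : (i == 0).
    by apply: smooth_at_eq sr => v; rewrite /h [RHS]mxE i0.
  by apply: smooth_at_eq si => v; rewrite /h [RHS]mxE i0.
by apply: accessible_closed_set1; apply: hausdorff_accessible; exact: norm_hausdorff.
Qed.

Definition block_proj (j : 'I_k) : 'M[C]_n := \matrix_(a, b) ((a == b) && (block_ord b == j))%:R.

Lemma mul_block_proj (A : 'M[C]_n) j a b :
  (A *m block_proj j) a b = A a b * (block_ord b == j)%:R.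
Proof.
rewrite mxE (bigD1 b)//= big1 ?addr0 => [|l lb]; rewrite mxE ?eqxx//.
by rewrite (negbTE lb) mulr0.
Qed.

Lemma block_proj_mul (A : 'M[C]_n) j a b :
  (block_proj j *m A) a b = (block_ord a == j)%:R * A a b.
Proof.
rewrite mxE (bigD1 a)//= big1 ?addr0 => [|l lb]; rewrite mxE ?eqxx//.
by rewrite eq_sym (negbTE lb) mul0r.
Qed.

Lemma block_mono_projP (U : 'M[C]_n) (s : {perm 'I_k}) :
  block_mono U s <-> forall j, U *m block_proj j = block_proj (s j) *m U.
Proof.
split=> [mU j|mU a b Uab].
  apply/matrixP => a b; rewrite mul_block_proj block_proj_mul.
  have [->|/mU ->] := eqVneq (U a b) 0; first by rewrite mulr0 mul0r.
  by rewrite (inj_eq perm_inj) mulrC.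
have /matrixP/(_ a b) := mU (block_ord b).
rewrite mul_block_proj block_proj_mul eqxx mulr1.
by case: eqVneq => // _ /eqP; rewrite mul0r (negbTE Uab).
Qed.

Lemma block_proj_conj (U : G) (s : {perm 'I_k}) j : block_mono (val U) s ->
  val U *m block_proj j *m (val U)^t* = block_proj (s j).
Proof.
move=> /block_mono_projP ->; rewrite -mulmxA.
by rewrite (unitary_mul_adj (valP U)) mulmx1.
Qed.

Lemma block_diag_mono (U : 'M[C]_n) : block_diag bk U <-> block_mono U (1%g : {perm 'I_k}).
Proof.
split=> [dU a b Uab|mU a b ab].
  rewrite perm1; apply: val_inj; apply/eqP; apply: contraT => /dU U0.
  by rewrite U0 eqxx in Uab.
by apply/eqP; apply: contraT => /mU; rewrite perm1 => /(congr1 val) /= abE; rewrite abE eqxx in ab.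
Qed.

End Blocks.

(** * Coordinates on the partial flags *)

Lemma half_lt_sum (R : realFieldType) (x y : R) :
  2^-1 < x -> 2^-1 < y -> x + y <= 1 -> false.
Proof. lra. Qed.

Section FlagCharts.
Context (R : realType) (n : nat) (lam : seq nat).
Hypothesis hlam : is_partition n lam.
Local Notation C := R[i].
Local Notation G := (unitary R n).
Local Notation H := (block_group R n lam).
Local Notation k := (size lam).
Local Notation bk := (fun i : 'I_n => reshape_index lam i).
Local Notation bo := (block_ord hlam).
Local Notation E := (@block_proj R n lam hlam).

Definition off_diag := [pred p : 'I_n * 'I_n | bk p.1 != bk p.2].
Definition flag_dim : nat := #|off_diag|.

(** A sum with at most one term: it inverts [enum_val] and is 0 at pairs inside a diagonal block. *)
Definition off_entry (x : 'rV[R]_flag_dim) (p : 'I_n * 'I_n) : R :=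
  \sum_(l | enum_val l == p) x 0 l.

Lemma off_entryE x (l : 'I_flag_dim) : off_entry x (enum_val l) = x 0 l.
Proof.
by rewrite /off_entry (bigD1 l)//= big1 ?addr0// => m /andP[/eqP/enum_val_inj ->]; rewrite eqxx.
Qed.

(* An entry of L below the block diagonal is stored at its own position (real
   part) and at the transposed position (imaginary part). *)
Definition unip_of_row (x : 'rV[R]_flag_dim) : 'M[C]_n :=
  \matrix_(a, b) if (bk b < bk a)%N then off_entry x (a, b) +i* off_entry x (b, a)
                 else ((a == b)%:R : C).

Definition row_of_unip (L : 'M[C]_n) : 'rV[R]_flag_dim :=
  \row_l let p := enum_val l in
    if (bk p.2 < bk p.1)%N then complex.Re (L p.1 p.2) else complex.Im (L p.2 p.1).

Lemma unip_of_row_unip x : block_unip bk (unip_of_row x).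
Proof. by move=> a b ab; rewrite mxE ltnNge ab. Qed.

Lemma unip_of_rowK : cancel unip_of_row row_of_unip.
Proof.
move=> x; apply/rowP => l; rewrite mxE /=; set p := enum_val l.
have : bk p.1 != bk p.2 by exact: (enum_valP l).
rewrite neq_ltn => /orP[pl|pl].
  by rewrite ltnNge (ltnW pl) /= mxE pl /= -surjective_pairing off_entryE.
by rewrite pl mxE pl /= -surjective_pairing off_entryE.
Qed.

Lemma row_of_unipK L : block_unip bk L -> unip_of_row (row_of_unip L) = L.
Proof.
move=> uL; apply/matrixP => a b; rewrite mxE; case: ltnP => ab; last by rewrite uL.
have abO : (a, b) \in off_diag by rewrite !inE /= gtn_eqF.
have baO : (b, a) \in off_diag by rewrite !inE /= ltn_eqF.
rewrite -(enum_rankK_in abO abO) off_entryE mxE enum_rankK_in//= ab.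
rewrite -(enum_rankK_in baO baO) off_entryE mxE enum_rankK_in//= ltnNge (ltnW ab) /=.
by case: (L a b).
Qed.

Lemma mxsmooth_at_unip_of_row x : mxsmooth_at unip_of_row x.
Proof.
have so p : smooth_at (fun y => off_entry y p) x.
  by apply: smooth_at_sum => l _; exact: smooth_at_coord.
move=> a b; case ab : (bk b < bk a)%N; last first.
  by apply: csmooth_at_eq (csmooth_at_cst (a == b)%:R x) => y; rewrite mxE ab.
split; [apply: smooth_at_eq (so (a, b))|apply: smooth_at_eq (so (b, a))];
  by move=> y; rewrite mxE ab.
Qed.

Lemma smooth_at_row_of_unip K (f : 'rV[R]_K -> 'M[C]_n) x :
  mxsmooth_at f x -> smooth_at (fun y => row_of_unip (f y)) x.
Proof.
move=> sf; apply/smooth_at_rowP => l; set p := enum_val l.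
case pl : (bk p.2 < bk p.1)%N.
  by apply: smooth_at_eq (sf p.1 p.2).1 => y; rewrite mxE /= pl.
by apply: smooth_at_eq (sf p.2 p.1).2 => y; rewrite mxE /= pl.
Qed.

(** The squared norm of the part of row a lying in the columns of block j. Written with a
    projection, it turns right multiplication by a block monomial unitary into a relabelling of
    j. *)
Definition block_mass (V : 'M[C]_n) (a : 'I_n) (j : 'I_k) : R :=
  complex.Re ((V *m E j *m V^t*) a a).

(* Block permutations other than the identity have to be kept away: the mass condition
   makes two points of the neighbourhood in the same coset differ by a block-diagonal
   unitary. *)
Definition flag_nbhd : set G :=
  [set V | lead_regular bk (val V) /\ forall a, 2^-1 < block_mass (val V) a (bo a)].

Definition flag_coord (V : G) : 'rV[R]_flag_dim := row_of_unip (lower_factor bk (val V)).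

Definition flag_section (x : 'rV[R]_flag_dim) : G :=
  exist (fun A : 'M[C]_n => A \is unitarymx) _
    (gram_schmidt_unitary (block_unip_unit (@block_index_mono n lam) (unip_of_row_unip x))).

Lemma block_massE V a j :
  block_mass V a j = \sum_(b | bo b == j) complex.Re (`|V a b| ^+ 2).
Proof.
rewrite /block_mass mxE raddf_sum [RHS]big_mkcond; apply: eq_bigr => b _.
rewrite mul_block_proj adjE; case: eqP => _; first by rewrite mulr1 normCK.
by rewrite mulr0 mul0r.
Qed.

Lemma Re_sqr_norm_ge0 (z : C) : 0 <= complex.Re (`|z| ^+ 2).
Proof. by rewrite -(@lecR R) RRe_real ?exprn_ge0// ger0_real// exprn_ge0. Qed.

Lemma block_mass_le1 (V : G) a j l : j != l ->
  block_mass (val V) a j + block_mass (val V) a l <= 1.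
Proof.
move=> jl; rewrite !block_massE.
have /(congr1 (@complex.Re R)) : \sum_b `|val V a b| ^+ 2 = 1.
  by rewrite -mul_adj_entry (unitary_mul_adj (valP V)) mxE eqxx.
rewrite raddf_sum -[RHS]/(1 : R) => <-; rewrite [leRHS](bigID (fun b => bo b == j)) lerD2l.
rewrite [leRHS](bigID (fun b => bo b == l)).
rewrite [X in _ <= X + _](eq_bigl (fun b => bo b == l)) => [|b].
  by rewrite lerDl sumr_ge0// => b _; exact: Re_sqr_norm_ge0.
by rewrite andTb; have [->|] := eqVneq (bo b) l; rewrite ?andbF // eq_sym jl.
Qed.

Lemma block_mass_mulr (V h : G) (s : {perm 'I_k}) a j : block_mono hlam (val h) s ->
  block_mass (val V *m val h) a j = block_mass (val V) a (s j).
Proof.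
by move=> mh; rewrite /block_mass -(block_proj_conj j mh) adj_mul !mulmxA.
Qed.

(** If the permutation moved the block of c, row c of V would have more than half of its mass in
    that block, by the condition on V, and more than half in the image block, by the condition on W.
    A unit row has total mass 1. *)
Lemma flag_nbhd_diag (V W : G) : flag_nbhd V -> flag_nbhd W -> H (V^-1 * W)%g ->
  block_diag bk (val (V^-1 * W)%g).
Proof.
move=> [_ mV] [_ mW] /(block_groupP hlam)[s ms].
apply/(block_diag_mono hlam) => a b /ms ->; rewrite perm1.
have [c <-] := block_ord_surj hlam (block_ord hlam b).
apply/eqP; apply: contraT => sc.
have := block_mass_le1 V c sc.
have WE : val W = val V *m val (V^-1 * W)%g by rewrite -[in LHS](mulKVg V W).
have : 2^-1 < block_mass (val V *m val (V^-1 * W)%g) c (bo c).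
  exact: (eq_ind _ (fun X => is_true (2^-1 < block_mass X c (bo c))) (mW c) _ WE).
rewrite (block_mass_mulr _ _ _ ms) => m1 m2.
exact: (half_lt_sum m1 (mV c) m2).
Qed.

(** L is its Gram-Schmidt matrix times an upper triangular one, which is the factorization that
    defines [lower_factor]. *)
Lemma lower_factor_gs (L : 'M[C]_n) : block_unip bk L ->
  lead_regular bk (gram_schmidt L) /\ lower_factor bk (gram_schmidt L) = L.
Proof.
move=> uL; have Lu := block_unip_unit (@block_index_mono n lam) uL.
have gU := gram_schmidt_unitary Lu.
have uT : block_upper bk ((gram_schmidt L)^t* *m L).
  by move=> a b ba; exact: (gram_schmidt_upper Lu (@block_index_mono n lam _ _ ba)).
have LE : L = gram_schmidt L *m ((gram_schmidt L)^t* *m L).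
  by rewrite mulmxA (unitary_mul_adj gU) mul1mx.
have rg : lead_regular bk (gram_schmidt L).
  by move=> b; have [] := lead_factor (@block_index_mono n lam) uL uT LE (bk b).
by split => //; rewrite -(lower_factor_unique rg uL uT LE).
Qed.

Lemma flag_nbhd_mulr (V W : G) : flag_nbhd V -> block_diag bk (val (V^-1 * W)%g) ->
  flag_nbhd W /\ lower_factor bk (val W) = lower_factor bk (val V).
Proof.
move=> [rV mV] dh; have uh := valP (V^-1 * W)%g.
have WE : val W = val V *m val (V^-1 * W)%g by rewrite -[in LHS](mulKVg V W).
have [rW lW] := lower_factor_mulr uh dh rV.
split; last by rewrite WE.
split; first by rewrite WE.
move=> a; rewrite WE (block_mass_mulr _ _ _ ((block_diag_mono hlam _).1 dh)).
by rewrite perm1.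
Qed.

Lemma flag_coord_eqP (V W : G) : flag_nbhd V -> flag_nbhd W ->
  flag_coord V = flag_coord W <-> H (V^-1 * W)%g.
Proof.
move=> nV nW; split=> [VW|HVW]; last first.
  by have [_ E] := flag_nbhd_mulr nV (flag_nbhd_diag nV nW HVW); rewrite /flag_coord E.
have LVW : lower_factor bk (val V) = lower_factor bk (val W).
  exact: (etrans (esym (row_of_unipK (lower_factor_unip nV.1)))
    (etrans (congr1 unip_of_row VW) (row_of_unipK (lower_factor_unip nW.1)))).
have dh := lower_factor_eq (@block_index_mono n lam) (valP V) (valP W) nV.1 nW.1 LVW.
exact: (@block_group_fun R n lam hlam (V^-1 * W)%g _ ((block_diag_mono hlam _).1 dh)).
Qed.

(** V and the section at its coordinates share the factor L, so they differ by a block-diagonal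
    unitary. That preserves the masses, hence the second condition of [flag_nbhd]. *)
Lemma flag_section_nbhd (V : G) : flag_nbhd V -> flag_nbhd (flag_section (flag_coord V)).
Proof.
move=> nV; have uL := lower_factor_unip nV.1.
have [rg lg] := lower_factor_gs uL.
have sE : val (flag_section (flag_coord V)) = gram_schmidt (lower_factor bk (val V)).
  by rewrite /= row_of_unipK.
have rs : lead_regular bk (val (flag_section (flag_coord V))) by rewrite sE.
have ls : lower_factor bk (val V) = lower_factor bk (val (flag_section (flag_coord V))).
  exact: (etrans (esym lg) (congr1 (lower_factor bk) (esym sE))).
have dh := lower_factor_eq (@block_index_mono n lam) (valP V) (valP (flag_section (flag_coord V)))
  nV.1 rs ls.
exact: (@flag_nbhd_mulr V (flag_section (flag_coord V)) nV dh).1.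
Qed.

Lemma flag_sectionK x : flag_coord (flag_section x) = x.
Proof.
have [_ lg] := lower_factor_gs (unip_of_row_unip x).
by rewrite /flag_coord /= lg unip_of_rowK.
Qed.

Lemma flag_section_smooth x : mxsmooth_at (fun y => val (flag_section y)) x.
Proof.
apply: gram_schmidt_smooth; first exact: mxsmooth_at_unip_of_row.
exact: (block_unip_unit (@block_index_mono n lam) (unip_of_row_unip x)).
Qed.

Lemma lead_smooth K (f : 'rV[R]_K -> 'M[C]_n) j x :
  mxsmooth_at f x -> mxsmooth_at (fun y => lead bk j (f y)) x.
Proof.
move=> sf; apply: mxsmooth_atD; last exact: mxsmooth_at_cst.
apply: mxsmooth_at_mul; last exact: mxsmooth_at_cst.
by apply: mxsmooth_at_mul => //; exact: mxsmooth_at_cst.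
Qed.

Lemma lower_factor_smooth K (f : 'rV[R]_K -> 'M[C]_n) x :
  mxsmooth_at f x -> lead_regular bk (f x) ->
  mxsmooth_at (fun y => lower_factor bk (f y)) x.
Proof.
move=> sf rf a b.
have sm : mxsmooth_at
    (fun y => f y *m lead_proj R bk (bk b) *m invmx (lead bk (bk b) (f y))) x.
  apply: mxsmooth_at_mul; first by apply: mxsmooth_at_mul => //; exact: mxsmooth_at_cst.
  by apply: mxsmooth_at_inv; [exact: lead_smooth|exact: rf].
by apply: csmooth_at_eq (sm a b) => y; rewrite [RHS]mxE.
Qed.

Lemma flag_coord_smooth K (f : 'rV[R]_K -> G) x :
  mxsmooth_at (fun y => val (f y)) x -> flag_nbhd (f x) ->
  smooth_at (fun y => flag_coord (f y)) x.
Proof.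
by move=> sf [rf _]; apply: smooth_at_row_of_unip; exact: lower_factor_smooth.
Qed.

Lemma flag_coord_continuous (V : G) : flag_nbhd V -> {for V, continuous flag_coord}.
Proof.
move=> [rV _]; apply: (@of_unitary_continuous _ _ _ (fun A => row_of_unip (lower_factor bk A))).
apply: smooth_at_row_of_unip; apply: lower_factor_smooth.
  exact: mxsmooth_at_complexify.
by rewrite complexify_embed.
Qed.

Lemma flag_nbhd_open : open flag_nbhd.
Proof.
pose W := [set v : 'rV[R]_(n * n + n * n) | lead_regular bk (complexify v) /\
  forall a, 2^-1 < block_mass (complexify v) a (bo a)].
exists W; last first.
  by apply/seteqP; split=> V; rewrite /W /flag_nbhd /= complexify_embed.
rewrite -[open _]/(open W) openE => v [rv mv].
have sc := @mxsmooth_at_complexify R n v.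
have n1 : \forall u \near v, forall b, lead bk (bk b) (complexify u) \in unitmx.
  apply: (@filter_forall _ _ (fun b u => lead bk (bk b) (complexify u) \in unitmx) (nbhs v) _) => b.
  have d0 : \det (lead bk (bk b) (complexify v)) != 0.
    by rewrite -unitfE -unitmxE; exact: rv.
  have nd := csmooth_at_neq0 (csmooth_at_det (lead_smooth (bk b) sc)) d0.
  by near=> u; rewrite unitmxE unitfE; near: u.
have n2 : \forall u \near v, forall a, 2^-1 < block_mass (complexify u) a (bo a).
  apply: (@filter_forall _ _ (fun a u => 2^-1 < block_mass (complexify u) a (bo a)) (nbhs v) _) => a.
  have sm : smooth_at (fun u => block_mass (complexify u) a (bo a)) v.
    have s1 : mxsmooth_at (fun u => complexify u *m E (bo a) *m (complexify u)^t*) v.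
      apply: mxsmooth_at_mul; last exact: mxsmooth_at_adj.
      by apply: mxsmooth_at_mul => //; exact: mxsmooth_at_cst.
    exact: (s1 a a).1.
  have og : open [set t : R | 2^-1 < t] by exact: open_gt.
  exact: (smooth_at_continuous sm (open_nbhs_nbhs (conj og (mv a)))).
by apply: (filterS2 _ _ n1 n2) => u; split.
Unshelve. all: by end_near. Qed.

Lemma flag_nbhd1 : flag_nbhd 1%g.
Proof.
have v1 : val (1%g : G) = 1%:M by [].
split=> [b|a]; rewrite v1.
  rewrite (_ : lead _ _ _ = 1%:M) ?unitmx1//.
  by apply/matrixP => c d; rewrite leadE mxE if_same.
have v11 : (1%:M : 'M[C]_n) a a = 1 by rewrite mxE eqxx.
rewrite block_massE (bigD1 a) ?eqxx// v11 normr1 expr1n ltr_wpDr//; last first.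
  by rewrite -[complex.Re 1]/(1 : R) invf_lt1 ?ltr1n.
by rewrite sumr_ge0// => b _; exact: Re_sqr_norm_ge0.
Qed.

Lemma card_diag_blocks : #|predC off_diag| = (\sum_(r <- lam) r * r)%N.
Proof.
rewrite -sum1_card (eq_bigl (fun p : 'I_n * 'I_n => bk p.2 == bk p.1)); last first.
  by move=> p; rewrite !inE negbK eq_sym.
rewrite -(pair_big_dep xpredT (fun a b : 'I_n => bk b == bk a) (fun _ _ => 1%N)) /=.
rewrite (eq_bigr (fun a : 'I_n => nth 0%N lam (bo a))); last first.
  by move=> a _; rewrite sum1_card card_block.
rewrite (partition_big bo xpredT) //= (big_nth 0%N) big_mkord; apply: eq_bigr => j _.
rewrite (eq_bigr (fun=> nth 0%N lam j)) => [|a /eqP <-//].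
rewrite sum_nat_const; congr (_ * _)%N; rewrite -[RHS](card_block hlam j).
by apply: eq_card => a; rewrite !inE.
Qed.

Lemma flag_dimE : flag_dim%:Z = n%:Z ^+ 2 - \sum_(r <- lam) r%:Z ^+ 2.
Proof.
have -> : \sum_(r <- lam) r%:Z ^+ 2 = (\sum_(r <- lam) r * r)%N%:Z.
  by rewrite -[RHS]natz natr_sum; apply: eq_bigr => r _; rewrite natrM -expr2 natz.
have := cardC off_diag; rewrite card_diag_blocks -/flag_dim card_prod card_ord => E1.
by rewrite expr2 -PoszM -E1 PoszD addrK.
Qed.

End FlagCharts.

Lemma sum_count_sqr (lam : seq nat) :
  \sum_(s <- undup lam) (count_mem s lam)%:Z * s%:Z ^+ 2 = \sum_(r <- lam) r%:Z ^+ 2.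
Proof.
rewrite -[RHS]big_undup_iterop_count; apply: eq_bigr => s _.
by rewrite -natz mulr_natl.
Qed.

(** * The stabilizer as a product of wreath products *)

(** Among equal parts, the number of earlier occurrences is strictly increasing. This bounds the
    rank of a block in its size class and separates blocks of equal size. *)
Lemma count_take_mono (l : seq nat) i j : (i < j)%N -> (i < size l)%N ->
  (count_mem (nth 0%N l i) (take i l) < count_mem (nth 0%N l i) (take j l))%N.
Proof.
move=> ij il; rewrite -[take j l](cat_take_drop i.+1) count_cat.
rewrite take_takel// (take_nth 0%N)// -cats1 count_cat /= eqxx.
by rewrite addn0 addn1 addSn ltnS leq_addr.
Qed.

Section WreathProduct.
Context (R : realType) (n : nat) (lam : seq nat).
Hypothesis hlam : is_partition n lam.
Local Notation C := R[i].
Local Notation G := (unitary R n).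
Local Notation H := (block_group R n lam).
Local Notation k := (size lam).
Local Notation bo := (block_ord hlam).
Local Notation B := {s : seq_sub lam & 'I_(count_mem (val s) lam)}.
Local Notation W := (wreath_prod R lam).

Lemma count_take_lt (j : 'I_k) :
  (count_mem (nth 0%N lam j) (take j lam) < count_mem (nth 0%N lam j) lam)%N.
Proof.
by have := @count_take_mono lam j k (ltn_ord j) (ltn_ord j); rewrite take_size.
Qed.

(* Blocks are labelled by their size and their rank among the blocks of that size. *)
Definition block_label (j : 'I_k) : B :=
  @Tagged (seq_sub lam) (SeqSub (mem_nth 0%N (ltn_ord j)))
    (fun s => 'I_(count_mem (val s) lam)) (Ordinal (count_take_lt j)).

Lemma label_eq (p q : B) : val (tag p) = val (tag q) ->
  val (tagged p) = val (tagged q) -> p = q.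
Proof. by case: p q => [s t] [s' t'] /= /val_inj E; subst s'; move=> /val_inj ->. Qed.

Lemma block_label_inj : injective block_label.
Proof.
have H1 (i j : 'I_k) : (i < j)%N -> block_label i <> block_label j.
  move=> ij E; have Es := congr1 (fun p : B => val (tag p)) E.
  have Et := congr1 (fun p : B => val (tagged p)) E; move: Es Et => /= Es.
  by rewrite -Es => Et; have := count_take_mono ij (ltn_ord i); rewrite Et ltnn.
move=> i j E; apply: val_inj; case: (ltngtP i j) => // ij; first by case: (H1 _ _ ij).
by case: (H1 _ _ ij).
Qed.

Lemma nth_occurrence (l : seq nat) s t : (t < count_mem s l)%N ->
  exists2 j, (j < size l)%N & nth 0%N l j = s /\ count_mem s (take j l) = t.
Proof.
elim: l t => //= x l IH t; case: eqVneq => [xs|xs] /=.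
  case: t => [_|t]; first by exists 0%N.
  by rewrite add1n ltnS => /IH[j jl [js jt]]; exists j.+1 => //=; rewrite xs eqxx jt.
by rewrite add0n => /IH[j jl [js jt]]; exists j.+1 => //=; rewrite (negbTE xs) jt.
Qed.

Lemma block_label_surj (p : B) : exists j, block_label j == p.
Proof.
case: p => s t; have [j jk [js jt]] := nth_occurrence (ltn_ord t).
by exists (Ordinal jk); apply/eqP; apply: label_eq => //=; rewrite js.
Qed.

Definition block_of_label (p : B) : 'I_k := xchoose (block_label_surj p).

Lemma block_of_labelK : cancel block_of_label block_label.
Proof. by move=> p; apply/eqP; exact: (xchooseP (block_label_surj p)). Qed.

Lemma block_labelK : cancel block_label block_of_label.
Proof. by move=> j; apply: block_label_inj; rewrite block_of_labelK. Qed.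

Lemma nth_block_of_label p : nth 0%N lam (block_of_label p) = val (tag p).
Proof. by rewrite -[in RHS](block_of_labelK p). Qed.

(* Indexing by nat avoids casts between block sizes that are only provably equal. *)
Definition nat_entry m (U : unitary R m) (i j : nat) : C :=
  if insub i is Some i' then if insub j is Some j' then val U i' j' else 0 else 0.

Lemma nat_entryE m (U : unitary R m) (i j : 'I_m) : nat_entry U i j = val U i j.
Proof. by rewrite /nat_entry !valK. Qed.

Local Notation lab := (fun a : 'I_n => block_label (bo a)).
Local Notation off := (fun a : 'I_n => reshape_offset lam a).

Lemma offset_lt a : (off a < val (tag (lab a)))%N.
Proof. by apply: reshape_offsetP; case: hlam => _ _ ->. Qed.

Definition label_index (p : B) (o : nat) : nat := flatten_index lam (block_of_label p) o.

Lemma label_index_lt p (o : 'I_(val (tag p))) : (label_index p o < n)%N.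
Proof. by apply: (flatten_index_lt hlam); rewrite nth_block_of_label. Qed.

Lemma label_index_lab p (o : 'I_(val (tag p))) :
  lab (Ordinal (label_index_lt o)) = p /\ off (Ordinal (label_index_lt o)) = o.
Proof.
have ob : (o < nth 0%N lam (block_of_label p))%N by rewrite nth_block_of_label.
split; last by rewrite /= flatten_indexKr.
rewrite -[RHS]block_of_labelK; congr block_label; apply: val_inj.
by rewrite /= flatten_indexKl.
Qed.

Lemma label_index_off a : label_index (lab a) (off a) = a.
Proof. by rewrite /label_index block_labelK /= reshape_indexK. Qed.

Lemma sum_label (p : B) (F : 'I_n -> C) :
  \sum_(b | lab b == p) F b = \sum_(o < val (tag p)) F (Ordinal (label_index_lt o)).
Proof.
pose f (o : 'I_(val (tag p))) := Ordinal (label_index_lt o).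
have fI : injective f.
  move=> o o' E; have := congr1 (fun a : 'I_n => off a) E.
  by rewrite /f (label_index_lab o).2 (label_index_lab o').2 => /val_inj.
rewrite -(big_imset (h := f) (A := predT) F (in2W fI)); apply: eq_bigl => b.
apply/eqP/imsetP => [bp|[u _ ->]]; last exact: (label_index_lab u).1.
have ob : (off b < val (tag p))%N by rewrite -bp; exact: offset_lt.
by exists (Ordinal ob) => //; apply: val_inj; rewrite /= -{1}bp label_index_off.
Qed.

Section Matrix.
Variable x : W.

Definition wreath_perm (p : B) : B :=
  @Tagged (seq_sub lam) (tag p) (fun s => 'I_(count_mem (val s) lam)) ((x (tag p)).2 (tagged p)).

Definition wreath_block (p : B) : unitary R (val (tag p)) := (x (tag p)).1 (tagged p).

Lemma wreath_perm_inj : injective wreath_perm.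
Proof.
move=> [s t] [s' t'] E; have /val_inj Es := congr1 (fun p : B => val (tag p)) E.
rewrite /= in Es; subst s'; move: E => /eqP; rewrite /wreath_perm /= eq_Tagged /=.
by move=> /eqP/perm_inj ->.
Qed.

(** The unitary is taken at the row label, that is at the target block, in agreement with
    [wreath_mul]. *)
Definition wreath_mx : 'M[C]_n := \matrix_(a, b)
  if lab a == wreath_perm (lab b) then nat_entry (wreath_block (lab a)) (off a) (off b) else 0.

Lemma sum_nat_entry m (U V : unitary R m) (i j : 'I_m) :
  \sum_(o < m) nat_entry U i o * (nat_entry V j o)^*%R = (val U *m (val V)^t*) i j.
Proof. by rewrite mxE; apply: eq_bigr => o _; rewrite !nat_entryE adjE. Qed.

Lemma wreath_mx_label a p (u : 'I_(val (tag p))) : lab a = wreath_perm p ->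
  wreath_mx a (Ordinal (label_index_lt u)) = nat_entry (wreath_block (lab a)) (off a) u.
Proof.
by move=> ap; rewrite mxE (label_index_lab u).1 (label_index_lab u).2 ap eqxx.
Qed.

Lemma wreath_mx_eq0 a b : lab a != wreath_perm (lab b) -> wreath_mx a b = 0.
Proof. by rewrite mxE => /negbTE ->. Qed.

Definition wreath_permV (p : B) : B :=
  @Tagged (seq_sub lam) (tag p) (fun s => 'I_(count_mem (val s) lam))
    (((x (tag p)).2)^-1%g (tagged p)).

Lemma wreath_permVK p : wreath_perm (wreath_permV p) = p.
Proof. by apply: label_eq => //=; rewrite permKV. Qed.

(** Row a is supported in the columns of the one block sent to that of a. Unitarity and
    multiplicativity both reduce to this sum. *)
Lemma wreath_mx_sum a (F : 'I_n -> C) :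
  \sum_b wreath_mx a b * F b = \sum_(u < val (tag (wreath_permV (lab a))))
    nat_entry (wreath_block (lab a)) (off a) u * F (Ordinal (label_index_lt u)).
Proof.
set q := wreath_permV (lab a).
rewrite (bigID (fun b => lab b == q)) /= [X in _ + X]big1 ?addr0; last first.
  move=> b bq; rewrite wreath_mx_eq0 ?mul0r//.
  by rewrite -[lab a]wreath_permVK (inj_eq wreath_perm_inj) eq_sym.
rewrite (sum_label q (fun b => wreath_mx a b * F b)); apply: eq_bigr => u _.
by rewrite wreath_mx_label// wreath_permVK.
Qed.

Lemma wreath_mx_unitary : wreath_mx \is unitarymx.
Proof.
apply/unitarymxP; apply/matrixP => a c; rewrite mxE [RHS]mxE.
rewrite (wreath_mx_sum a (fun b => (wreath_mx^t*) b c)).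
have [ca|ca] := eqVneq (lab c) (lab a); last first.
  rewrite big1 => [|u _].
    by move: ca; case: (eqVneq a c) => [->|//]; rewrite eqxx.
  by rewrite adjE wreath_mx_eq0 ?rmorph0 ?mulr0// (label_index_lab u).1 wreath_permVK.
set U := wreath_block (lab a).
rewrite (eq_bigr (fun u : 'I_(val (tag (lab a))) =>
  nat_entry U (off a) u * (nat_entry U (off c) u)^*%R)); last first.
  move=> u _; rewrite adjE wreath_mx_label; last by rewrite wreath_permVK.
  by rewrite ca.
have ofc : (off c < val (tag (lab a)))%N by rewrite -ca; exact: offset_lt.
rewrite (sum_nat_entry U U (Ordinal (offset_lt a)) (Ordinal ofc)).
rewrite (unitary_mul_adj (valP U)) mxE -val_eqE /=; congr (_%:R); congr (nat_of_bool _).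
apply/eqP/eqP => [ac|->//]; apply: val_inj.
by apply: etrans (label_index_off c); rewrite ca -ac; exact/esym/label_index_off.
Qed.

Definition wreath_unitary : G :=
  exist (fun A : 'M[C]_n => A \is unitarymx) wreath_mx wreath_mx_unitary.

Lemma wreath_unitary_block : H wreath_unitary.
Proof.
pose tau j := block_of_label (wreath_perm (block_label j)).
apply: (@block_group_fun R n lam hlam wreath_unitary tau) => a b ab.
rewrite /tau -[LHS]block_labelK; congr block_of_label; apply/eqP.
by apply: contraT => /wreath_mx_eq0 ab0; rewrite /= ab0 eqxx in ab.
Qed.

End Matrix.

Lemma wreath_unitary_mul (x y : W) :
  wreath_unitary (wreath_prod_mul x y) = (wreath_unitary x * wreath_unitary y)%g.
Proof.
apply: val_inj; apply/matrixP => a c.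
rewrite -[val _]/(wreath_mx (wreath_prod_mul x y)) -[val _]/(wreath_mx x *m wreath_mx y).
rewrite [RHS]mxE (wreath_mx_sum x a (fun b => wreath_mx y b c)).
set q := wreath_permV x (lab a).
have qa : wreath_perm x q = lab a by exact: wreath_permVK.
have pm : wreath_perm (wreath_prod_mul x y) (lab c) = wreath_perm x (wreath_perm y (lab c)).
  by apply: label_eq => //=; rewrite permM.
rewrite mxE pm -[X in X == _]qa (inj_eq (@wreath_perm_inj x)).
have [qc|qc] := eqVneq q (wreath_perm y (lab c)); last first.
  rewrite big1// => u _; rewrite [X in _ * X]wreath_mx_eq0 ?mulr0//.
  by rewrite (label_index_lab u).1.
have ofc : (off c < val (tag (lab a)))%N.
  by have := offset_lt c; rewrite -[lab a]qa qc.
rewrite -[off a]/(val (Ordinal (offset_lt a))) -[off c]/(val (Ordinal ofc)).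
rewrite nat_entryE /= mxE; apply: eq_bigr => u _.
have Eu : wreath_mx y (Ordinal (@label_index_lt q u)) c =
    nat_entry (wreath_block y q) u (off c).
  by rewrite mxE (@label_index_lab q u).1 (@label_index_lab q u).2 -qc eqxx.
rewrite [X in _ = _ * X]Eu; congr (_ * _).
  exact/esym/(nat_entryE _ (Ordinal (offset_lt a)) u).
exact/esym/(nat_entryE (wreath_block y q) u (Ordinal ofc)).
Qed.

(** Every column has a nonzero entry, whose row label gives the image of the column label. Once the
    permutations agree, the unitaries are read from the blocks. *)
Lemma wreath_unitary_inj : injective wreath_unitary.
Proof.
move=> x y /(congr1 val) E; have {}E : wreath_mx x = wreath_mx y by exact: E.
have Ep (p : B) : wreath_perm x p = wreath_perm y p.
  have [c cp] : exists c, lab c = p.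
    have [c cE] := block_ord_surj hlam (block_of_label p).
    by exists c; rewrite cE block_of_labelK.
  have := unitary_row_neq0 c (_ : (wreath_mx x)^T \is unitarymx).
  rewrite trmx_unitary => /(_ (wreath_mx_unitary x))[a]; rewrite mxE => ac.
  have xa : lab a = wreath_perm x (lab c).
    by apply/eqP; apply: contraT => /wreath_mx_eq0 ac0; rewrite ac0 eqxx in ac.
  have ya : lab a = wreath_perm y (lab c).
    apply/eqP; apply: contraT => /(@wreath_mx_eq0 y) ac0.
    by rewrite E ac0 eqxx in ac.
  by rewrite -cp -xa -ya.
apply: functional_extensionality_dep => s.
have E2 : (x s).2 = (y s).2.
  apply/permP => t; have := Ep (@Tagged _ s (fun s => 'I_(count_mem (val s) lam)) t).
  by move/eqP; rewrite /wreath_perm /= eq_Tagged => /eqP.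
have E1 : (x s).1 = (y s).1.
  apply/funext => t; apply: val_inj; apply/matrixP => i j.
  pose p : B := @Tagged _ s (fun s => 'I_(count_mem (val s) lam)) t.
  pose q := wreath_permV x p.
  have qp : wreath_perm x q = p by exact: wreath_permVK.
  pose a := Ordinal (@label_index_lt p i); pose b := Ordinal (@label_index_lt q j).
  have ap : lab a = p by exact: (@label_index_lab p i).1.
  have ez (z : W) : wreath_perm z q = p -> wreath_mx z a b = val ((z s).1 t) i j.
    move=> zq; apply: etrans (nat_entryE ((z s).1 t) i j).
    rewrite wreath_mx_label; last by rewrite zq.
    by rewrite ap (@label_index_lab p i).2.
  by rewrite -(ez x qp) -(ez y) -?Ep// E.
by move: E1 E2; case: (x s) (y s) => [u1 v1] [u2 v2] /= -> ->.
Qed.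

Section Surjection.
Variables (U : G) (s : {perm 'I_k}).
Hypothesis mU : block_mono hlam (val U) s.

(** U conjugates the projection on block j to that on block s j, and the traces of these are the
    block sizes. *)
Lemma block_mono_size j : nth 0%N lam (s j) = nth 0%N lam j.
Proof.
have tr (l : 'I_k) : \tr (@block_proj R n lam hlam l) = (nth 0%N lam l)%:R.
  rewrite -(card_block hlam l) -sum1_card natr_sum /mxtrace [RHS]big_mkcond /=.
  by apply: eq_bigr => a _; rewrite mxE eqxx inE -val_eqE /=; case: eqP.
apply/eqP; rewrite -(eqr_nat C) -!tr -(block_proj_conj j mU) mxtrace_mulC mulmxA.
by rewrite unitary_adj_mul ?mul1mx//; exact: valP.
Qed.

Definition label_perm (p : B) : B := block_label (s (block_of_label p)).

Lemma tag_label_perm p : tag (label_perm p) = tag p.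
Proof. by apply: val_inj; rewrite /= block_mono_size nth_block_of_label. Qed.

Lemma label_perm_ex (t : seq_sub lam) (u : 'I_(count_mem (val t) lam)) :
  exists v, label_perm (@Tagged _ t (fun s => 'I_(count_mem (val s) lam)) u) =
    @Tagged _ t (fun s => 'I_(count_mem (val s) lam)) v.
Proof.
have := tag_label_perm (@Tagged _ t (fun s => 'I_(count_mem (val s) lam)) u).
by case: (label_perm _) => t' v /= tt; subst t'; exists v.
Qed.

Definition class_perm_fun (t : seq_sub lam) (u : 'I_(count_mem (val t) lam)) :=
  sval (cid (label_perm_ex u)).

Lemma class_perm_inj t : injective (@class_perm_fun t).
Proof.
move=> u v E; have Eu := svalP (cid (label_perm_ex u)).
have := svalP (cid (label_perm_ex v)); rewrite -/(class_perm_fun v) -E -Eu.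
move=> /block_label_inj/perm_inj/(can_inj block_of_labelK)/eqP.
by rewrite eq_Tagged /= => /eqP ->.
Qed.

(** The block of U in the rows of p and the columns of the preimage of p. The two sizes are equal
    only by [block_mono_size], hence indices in nat. *)
Definition class_mx (p : B) : 'M[C]_(val (tag p)) := \matrix_(i, j)
  nat_entry U (label_index p i) (flatten_index lam ((s^-1)%g (block_of_label p)) j).

(** The rows of U in block p vanish outside the columns of the preimage block, so their
    orthonormality is already that of the rows of this block. *)
Lemma class_mx_unitary p : class_mx p \is unitarymx.
Proof.
apply/unitarymxP; apply/matrixP => i j; rewrite mxE [RHS]mxE.
pose q := block_label ((s^-1)%g (block_of_label p)).
have qp : val (tag q) = val (tag p).
  by rewrite /= -block_mono_size permKV nth_block_of_label.
pose a := Ordinal (@label_index_lt p i); pose c := Ordinal (@label_index_lt p j).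
have /matrixP/(_ a c) := unitary_mul_adj (valP U); rewrite mxE [RHS]mxE.
have ap := (@label_index_lab p i).1; rewrite -/a in ap.
rewrite (bigID (fun b => lab b == q)) /= [X in _ + X]big1 ?addr0; last first.
  move=> b bq; have [->|] := eqVneq (val U a b) 0; first by rewrite mul0r.
  move=> /mU ab; move: bq; rewrite /q -ap ab block_labelK permK eqxx //.
rewrite (sum_label q (fun b => val U a b * ((val U)^t*) b c)).
move=> Ec; transitivity ((a == c)%:R : C); last first.
  suff -> : (a == c) = (i == j) by [].
  apply/eqP/eqP => [E|ij]; last by rewrite /a /c ij.
  have := congr1 (fun a : 'I_n => off a) E.
  by rewrite /a /c (@label_index_lab p i).2 (@label_index_lab p j).2 => /val_inj.
rewrite -Ec.
pose F (o : nat) := nat_entry U a (flatten_index lam ((s^-1)%g (block_of_label p)) o)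
  * (nat_entry U c (flatten_index lam ((s^-1)%g (block_of_label p)) o))^*%R.
(* Changes the bound of the sum between two equal sizes without casting ordinals; this is why the
   summand F takes a nat. *)
have castE m m' : m = m' -> \sum_(o < m) F o = \sum_(o < m') F o by move=> ->.
transitivity (\sum_(o < val (tag p)) F o).
  by apply: eq_bigr => o _; rewrite adjE !mxE.
rewrite -(castE _ _ qp); apply: eq_bigr => o _; rewrite adjE -2!nat_entryE /F.
by rewrite /label_index /= block_labelK.
Qed.

Definition class_wreath : W := fun t =>
  (fun u => exist (fun A : 'M[C]_(val t) => A \is unitarymx) _
     (class_mx_unitary (@Tagged _ t (fun s => 'I_(count_mem (val s) lam)) u)),
   perm (@class_perm_inj t)).

Lemma wreath_perm_class p : wreath_perm class_wreath p = label_perm p.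
Proof.
case: p => t u; rewrite /wreath_perm /= permE /=.
exact/esym/(svalP (cid (label_perm_ex u))).
Qed.

Lemma wreath_unitary_class : wreath_unitary class_wreath = U.
Proof.
apply: val_inj; apply/matrixP => a b; rewrite -[val _]/(wreath_mx class_wreath) mxE.
rewrite wreath_perm_class /label_perm block_labelK (inj_eq block_label_inj).
have [ab|ab] := eqVneq (bo a) (s (bo b)); last first.
  by apply/esym/eqP; apply: contraT => /mU ab'; rewrite ab' eqxx in ab.
have sab : val (tag (lab a)) = val (tag (lab b)).
  by transitivity (nth 0%N lam (s (bo b))); [rewrite -ab|exact: block_mono_size].
have ofb : (off b < val (tag (lab a)))%N by rewrite sab; exact: offset_lt.
rewrite -[off a]/(val (Ordinal (offset_lt a))) -[off b]/(val (Ordinal ofb)).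
rewrite nat_entryE [LHS]mxE -nat_entryE; congr nat_entry; first exact: label_index_off.
apply: etrans (reshape_indexK lam b); congr (flatten_index lam _ _).
by rewrite (block_labelK (bo a)) [X in (s^-1)%g X]ab permK.
Qed.

End Surjection.

Lemma block_group_wreath : block_group_is_wreath_prod R n lam.
Proof.
exists wreath_unitary; split; [exact: wreath_unitary_inj|exact: wreath_unitary_mul|].
apply/seteqP; split=> [U [x _ <-]|U /(block_groupP hlam)[s mU]]; first exact: wreath_unitary_block.
by exists (class_wreath mU) => //; exact: wreath_unitary_class.
Qed.

End WreathProduct.

(** * Orthogonal projections and measurements *)

Section InnerProduct.
Context (R : realType) (H : vectType R[i]) (dot : {dot H for Num.conj}).
Local Notation C := R[i].

Lemma dotC x y : dot x y = (dot y x)^*%R.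
Proof. by rewrite [LHS](hermC dot) expr0 mul1r. Qed.

Lemma dotDl x y z : dot (x + y) z = dot x z + dot y z.
Proof. exact: linearDl. Qed.

Lemma dotBl x y z : dot (x - y) z = dot x z - dot y z.
Proof. exact: linearBl. Qed.

Lemma dotZl a x y : dot (a *: x) y = a * dot x y.
Proof. exact: linearZl_LR. Qed.

Lemma dotZr a x y : dot x (a *: y) = a^*%R * dot x y.
Proof. exact: linearZr_LR. Qed.

Lemma dot_suml I (r : seq I) (Q : pred I) (F : I -> H) y :
  dot (\sum_(i <- r | Q i) F i) y = \sum_(i <- r | Q i) dot (F i) y.
Proof. exact: linear_sumlz. Qed.

Lemma dot_sumr I (r : seq I) (Q : pred I) (F : I -> H) x :
  dot x (\sum_(i <- r | Q i) F i) = \sum_(i <- r | Q i) dot x (F i).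
Proof. exact: linear_sumr. Qed.

Lemma dot_inj x y : (forall z, dot x z = dot y z) -> x = y.
Proof.
move=> E; by apply/eqP; rewrite -subr_eq0 -(dnorm_eq0 dot) dotBl E subrr.
Qed.

Definition orthonormal_family (I : finType) (c : I -> H) :=
  forall i j, dot (c i) (c j) = (i == j)%:R.

Lemma orthonormal_nth m (b : m.-tuple H) : orthonormal dot b ->
  orthonormal_family (tnth b).
Proof.
move=> /orthonormalP[ub ob] i j; rewrite ob ?mem_tnth//.
by rewrite (inj_eq (tuple_uniqP _ ub)).
Qed.

Section OrthonormalFamily.
Context (I : finType) (c : I -> H).
Hypothesis oc : orthonormal_family c.

Lemma orthonormal_coef (S : pred I) (F : I -> C) i :
  dot (\sum_(j | S j) F j *: c j) (c i) = if S i then F i else 0.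
Proof.
rewrite dot_suml; case: ifPn => Si.
  rewrite (bigD1 i)//= dotZl oc eqxx mulr1 big1 ?addr0// => j /andP[_ ji].
  by rewrite dotZl oc (negbTE ji) mulr0.
rewrite big1// => j Sj; rewrite dotZl oc; case: eqP => [ji|_]; last by rewrite mulr0.
by rewrite -ji Sj in Si.
Qed.

Definition family_span (S : pred I) : {vspace H} := <<[seq c i | i <- enum S]>>%VS.

Lemma family_mem (S : pred I) i : S i -> c i \in family_span S.
Proof. by move=> Si; apply/memv_span/map_f; rewrite mem_enum. Qed.

Lemma family_span_sub (S : pred I) (V : {vspace H}) :
  (forall i, S i -> c i \in V) -> (family_span S <= V)%VS.
Proof. by move=> SV; apply/span_subvP => _ /mapP[i iS ->]; apply: SV; rewrite mem_enum in iS. Qed.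

Lemma family_inj : injective c.
Proof.
move=> i j E; have := oc i j; rewrite E oc eqxx => /eqP.
by rewrite eq_sym pnatr_eq1 eqb1 => /eqP.
Qed.

Lemma dim_family_span (S : pred I) : \dim (family_span S) = #|S|.
Proof.
rewrite cardE -(size_map c); apply/eqP/(orthonormal_free (form := dot))/orthonormalP.
split=> [|_ _ /mapP[i _ ->] /mapP[j _ ->]]; first by rewrite (map_inj_uniq family_inj) enum_uniq.
by rewrite oc (inj_eq family_inj).
Qed.

End OrthonormalFamily.

Section FamilyProjection.
Context (I : finType) (c : I -> H) (S : pred I).

Definition family_sum (x : H) : H := \sum_(i | S i) dot x (c i) *: c i.

Lemma family_sum_linear : linear family_sum.
Proof.
move=> a x y; rewrite /family_sum scaler_sumr -big_split; apply: eq_bigr => i _ /=.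
by rewrite dotDl dotZl scalerDl scalerA.
Qed.

HB.instance Definition _ :=
  GRing.isLinear.Build C H H *:%R family_sum family_sum_linear.

Definition family_proj : 'End(H) := linfun family_sum.

Lemma family_projE x : family_proj x = \sum_(i | S i) dot x (c i) *: c i.
Proof. by rewrite lfunE. Qed.

End FamilyProjection.

Section FamilyExpansion.
Context (I : finType) (c : I -> H).
Hypothesis oc : orthonormal_family c.

Lemma family_proj_basis (S : pred I) i : family_proj c S (c i) = if S i then c i else 0.
Proof.
rewrite family_projE; case: ifPn => Si.
  rewrite (bigD1 i)//= oc eqxx scale1r big1 ?addr0// => j /andP[_ ji].
  by rewrite oc eq_sym (negbTE ji) scale0r.
rewrite big1// => j Sj; rewrite oc; case: eqP => [ij|_]; last by rewrite scale0r.
by rewrite ij Sj in Si.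
Qed.

Lemma family_span_expand (S : pred I) x : x \in family_span c S -> family_proj c S x = x.
Proof.
have /subvP sub : (family_span c S <= fixedSpace (family_proj c S))%VS.
  by apply: family_span_sub => i Si; apply/fixedSpaceP; rewrite family_proj_basis Si.
by move=> /sub/fixedSpaceP.
Qed.

Lemma limg_family_proj (S : pred I) : limg (family_proj c S) = family_span c S.
Proof.
apply/eqP; rewrite eqEsubv; apply/andP; split; apply/subvP => x; last first.
  by move=> /family_span_expand <-; rewrite memv_img ?memvf.
move=> /memv_imgP[y _ ->]; rewrite family_projE; apply: memv_suml => i Si.
by apply: memvZ; exact: family_mem.
Qed.

End FamilyExpansion.

(** Gram-Schmidt on a list: a vector whose residual vanishes already lies in the span and is
    dropped; otherwise its normalized residual is added. *)
Lemma orthonormal_span (X : seq H) : exists2 t, orthonormal dot t & <<t>>%VS = <<X>>%VS.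
Proof.
elim: X => [|x X [t ot ts]]; first by exists [::].
pose w := x - family_proj (tnth (in_tuple t)) xpredT x.
have oc := @orthonormal_nth _ (in_tuple t) ot.
have wt v : v \in t -> dot w v = 0.
  move=> vt; have /tnthP[i ->] : v \in in_tuple t by [].
  by rewrite dotBl family_projE (orthonormal_coef oc) subrr.
have px : family_proj (tnth (in_tuple t)) xpredT x \in <<t>>%VS.
  by rewrite family_projE; apply: memv_suml => i _; apply/memvZ/memv_span/mem_tnth.
have [w0|w0] := eqVneq w 0.
  exists t => //; rewrite span_cons ts; apply/esym/addv_idPr.
  by rewrite -memvE -ts; move/eqP: w0; rewrite subr_eq0 => /eqP ->.
have dw : 0 < dot w w by rewrite dnorm_gt0.
exists (((sqrtC (dot w w))^-1 *: w) :: t).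
  have nw : dot ((sqrtC (dot w w))^-1 *: w) ((sqrtC (dot w w))^-1 *: w) = 1.
    rewrite dnormZ normrV ?unitfE ?sqrtC_eq0 ?gt_eqF// ger0_norm ?sqrtC_ge0 ?ltW//.
    by rewrite exprVn sqrtCK mulVf ?gt_eqF.
  rewrite /orthonormal /= nw eqxx /=; move: ot => /andP[-> /= ->]; rewrite andbT.
  by rewrite /ortho_rec /= andbT; apply/allP => v vt; apply/eqP; rewrite dotZl (wt _ vt) mulr0.
rewrite !span_cons -ts; apply/eqP; rewrite eqEsubv !subv_add !addvSr !andbT -!memvE.
set r := (_)^-1; have r0 : r != 0 by rewrite invr_eq0 sqrtC_eq0 gt_eqF.
apply/andP; split; last rewrite -[x](subrK (family_proj (tnth (in_tuple t)) xpredT x)) -/w.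
  by rewrite memvZ// memv_add ?memvN// memv_line.
rewrite memv_add//; apply/vlineP; exists r^-1.
exact/esym/(scalerK r0).
Qed.

Lemma orthonormal_basis_ex (V : {vspace H}) :
  exists b : (\dim V).-tuple H, orthonormal_basis_of dot V b.
Proof.
have [t ot ts] := orthonormal_span (vbasis V).
have tV : <<t>>%VS = V by rewrite ts (span_basis (vbasisP V)).
have st : size t == \dim V by rewrite -tV eq_sym; apply: orthonormal_free ot.
by exists (Tuple st).
Qed.

Lemma adjoint_ex (A : 'End(H)) : exists B : 'End(H), forall x y, dot (A x) y = dot x (B y).
Proof.
have [b [ob bV]] := orthonormal_basis_ex {:H}.
pose e := tnth b; have oe : orthonormal_family e := orthonormal_nth ob.
have eE x : x = \sum_i dot x (e i) *: e i.
  rewrite -(family_projE e xpredT) family_span_expand//.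
  have /subvP sub : (<<b>> <= family_span e xpredT)%VS.
    by apply/span_subvP => v /tnthP[i ->]; exact: family_mem.
  by apply: sub; rewrite bV memvf.
(* The adjoint sends y to the vector with coordinates [dot y (A (e i))] in an orthonormal basis
   e. *)
pose f y := \sum_i dot y (A (e i)) *: e i.
have f_linear : linear f.
  move=> a x y; rewrite /f scaler_sumr -big_split; apply: eq_bigr => i _ /=.
  by rewrite dotDl dotZl scalerDl scalerA.
pose F := GRing.isLinear.Build _ _ _ _ f f_linear.
pose fL : {linear H -> H} := HB.pack f F.
exists (linfun fL) => x y; rewrite lfunE /= [in LHS](eE x) linear_sum dot_suml dot_sumr.
by apply: eq_bigr => i _; rewrite linearZ dotZl dotZr -dotC mulrC.
Qed.

Lemma adjointP (A : 'End(H)) x y : dot (A x) y = dot x (adjoint dot A y).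
Proof. by rewrite /adjoint; case: xgetP => [B _ ->//|no]; have [B /no] := adjoint_ex A. Qed.

Lemma dot_injr x y : (forall z, dot z x = dot z y) -> x = y.
Proof. by move=> E; apply: dot_inj => z; rewrite dotC E -dotC. Qed.

Lemma adjoint_eq (A B : 'End(H)) :
  (forall x y, dot (A x) y = dot x (B y)) -> adjoint dot A = B.
Proof. by move=> AB; apply/lfunP => y; apply: dot_injr => z; rewrite -adjointP. Qed.

Lemma projection_dot Q x y : is_projection dot Q -> dot (Q x) y = dot x (Q y).
Proof. by move=> [_ Qa]; rewrite adjointP Qa. Qed.

Lemma projection_fix Q x : is_projection dot Q -> x \in limg Q -> Q x = x.
Proof. by move=> [QQ _] /memv_imgP[y _ ->]; rewrite -[in RHS]QQ lfunE. Qed.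

(** With equal ranges, Q Q' = Q' and Q' Q = Q. Taking adjoints in one of them gives Q = Q'. *)
Lemma projection_limg_inj Q Q' : is_projection dot Q -> is_projection dot Q' ->
  limg Q = limg Q' -> Q = Q'.
Proof.
move=> pQ pQ' E; apply/lfunP => x; apply: dot_injr => z.
have QQ' y : Q (Q' y) = Q' y by rewrite projection_fix// E memv_img ?memvf.
have Q'Q y : Q' (Q y) = Q y by rewrite projection_fix// -E memv_img ?memvf.
by rewrite -Q'Q -(projection_dot _ _ pQ') -(projection_dot _ _ pQ) QQ' projection_dot.
Qed.

Lemma family_proj_dot (I : finType) (c : I -> H) S x y :
  dot (family_proj c S x) y = dot x (family_proj c S y).
Proof.
rewrite !family_projE dot_suml dot_sumr; apply: eq_bigr => i _.
by rewrite dotZl dotZr -dotC mulrC.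
Qed.

Section FamilyProjectionTheory.
Context (I : finType) (c : I -> H).
Hypothesis oc : orthonormal_family c.

Lemma family_projection S : is_projection dot (family_proj c S).
Proof.
split; last by apply: adjoint_eq => x y; exact: family_proj_dot.
apply/lfunP => x; rewrite comp_lfunE family_span_expand//.
by rewrite -(limg_family_proj oc) memv_img ?memvf.
Qed.

Lemma rank_family_proj S : rank (family_proj c S) = #|S|.
Proof. by rewrite /rank limg_family_proj// dim_family_span. Qed.

Lemma family_proj_span S Q : is_projection dot Q -> limg Q = family_span c S ->
  Q = family_proj c S.
Proof.
move=> pQ E; apply: projection_limg_inj => //; first exact: family_projection.
by rewrite limg_family_proj.
Qed.

Lemma family_proj_disjoint (S T : pred I) x : (forall i, S i -> T i -> False) ->
  family_proj c S (family_proj c T x) = 0.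
Proof.
move=> ST; rewrite (family_projE c T x) linear_sum big1// => i Ti.
by rewrite linearZ /= family_proj_basis//; case: ifP => [/ST/(_ Ti)|_]; rewrite ?scaler0.
Qed.

End FamilyProjectionTheory.

Section Frame.
Variables (P : 'End(H)) (n : nat) (b : n.-tuple H).
Hypothesis pP : is_projection dot P.
Hypothesis bP : orthonormal_basis_of dot (limg (\1%VF - P)) b.
Local Notation W := (limg (\1%VF - P)).
Local Notation G := (unitary R n).

Lemma projection_compl_mem x : (x \in W) = (P x == 0).
Proof.
have E y : (\1%VF - P) y = y - P y by rewrite add_lfunE opp_lfunE id_lfunE.
apply/idP/eqP => [/memv_imgP[y _ ->]|Px]; last by rewrite -[x]subr0 -Px -E memv_img ?memvf.
by rewrite E linearB /= -[in P (P y)]comp_lfunE pP.1 subrr.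
Qed.

Lemma projection_compl : is_projection dot (\1%VF - P).
Proof.
have E y : (\1%VF - P) y = y - P y by rewrite add_lfunE opp_lfunE id_lfunE.
split.
  apply/lfunP => x; rewrite comp_lfunE E.
  have := memv_img (\1%VF - P) (memvf x); rewrite projection_compl_mem => /eqP ->.
  by rewrite subr0.
apply: adjoint_eq => x y; rewrite !E dotBl (projection_dot _ _ pP).
exact/esym/linearBr.
Qed.

Let ob : orthonormal_family (tnth b) := orthonormal_nth bP.1.

Lemma basis_span : family_span (tnth b) xpredT = W.
Proof.
rewrite -bP.2 /family_span; congr span; rewrite -[in RHS](map_tnth_enum b).
by congr map; rewrite enumT.
Qed.

Lemma basis_expand x : x \in W -> x = \sum_i dot x (tnth b i) *: tnth b i.
Proof. by rewrite -basis_span => /(family_span_expand ob) {1}<-; rewrite family_projE. Qed.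

(** The columns of B are the coordinates of the new basis vectors. Orthonormal bases of the
    complement of P thus correspond to unitary matrices, and operators act by left
    multiplication. *)
Definition frame (B : G) (e : 'I_n) : H := \sum_a val B a e *: tnth b a.

Lemma frame_coef B e a : dot (frame B e) (tnth b a) = val B a e.
Proof. exact: (orthonormal_coef ob xpredT (fun a => val B a e)). Qed.

Lemma dot_frame B A e a : dot (frame B e) (frame A a) = val (A^-1 * B)%g a e.
Proof.
rewrite [frame A a]/frame dot_sumr -[val (A^-1 * B)%g]/((val A)^t* *m val B) mxE.
by apply: eq_bigr => i _; rewrite dotZr frame_coef adjE.
Qed.

Lemma frame_orthonormal B : orthonormal_family (frame B).
Proof. by move=> i j; rewrite dot_frame mulVg -[val _]/(1%:M : 'M[C]_n) mxE eq_sym. Qed.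

Lemma frame_compl B e : frame B e \in W.
Proof.
rewrite -basis_span; apply: memv_suml => a _; apply: memvZ; exact: family_mem.
Qed.

Lemma frame_span B : family_span (frame B) xpredT = W.
Proof.
apply/eqP; rewrite eqEdim family_span_sub => [/=|e _]; last exact: frame_compl.
by rewrite -basis_span (dim_family_span ob) (dim_family_span (@frame_orthonormal B)).
Qed.

Lemma frame_ex (c : 'I_n -> H) : orthonormal_family c -> (forall e, c e \in W) ->
  exists B, frame B =1 c.
Proof.
move=> oc cW; pose X : 'M[C]_n := \matrix_(a, e) dot (c e) (tnth b a).
have XU : X \is unitarymx.
  apply/unitarymxP; apply: mulmx1C; apply/matrixP => e e'; rewrite mxE [RHS]mxE.
  transitivity (dot (c e') (c e)); last by rewrite oc eq_sym.
  rewrite [in RHS](basis_expand (cW e')) dot_suml; apply: eq_bigr => m _.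
  by rewrite adjE !mxE dotZl mulrC -dotC.
exists (exist _ X XU) => e; rewrite [RHS](basis_expand (cW e)); apply: eq_bigr => a _.
by rewrite mxE.
Qed.

Lemma frame_mul_op U A B e : fixing_group dot P U -> restricts_to dot b U A ->
  U (frame B e) = frame (A * B)%g e.
Proof.
move=> [[UU _] UP] UA.
(* U preserves the complement of ran P: it is unitary and fixes P z, so the product of U b_i with P
   z equals that of b_i with P z, which is 0. *)
have UW i : U (tnth b i) \in W.
  rewrite projection_compl_mem; apply/eqP/dot_inj => z; rewrite (projection_dot _ _ pP).
  have PW : P z \in limg P by rewrite memv_img ?memvf.
  have biW : tnth b i \in W by rewrite -basis_span; exact: family_mem.
  rewrite -(UP _ PW) adjointP -[adjoint dot U _]comp_lfunE UU id_lfunE -(projection_dot _ _ pP).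
  by move: biW; rewrite projection_compl_mem => /eqP ->; rewrite !linear0l.
rewrite /frame linear_sum.
under eq_bigr => i _ do rewrite linearZ /= (basis_expand (UW i)) scaler_sumr.
rewrite exchange_big /=; apply: eq_bigr => a _.
under eq_bigr => i _ do rewrite scalerA.
rewrite -scaler_suml; congr (_ *: _); rewrite -[RHS]/((val A *m val B) a e) mxE.
by apply: eq_bigr => i _; rewrite mulrC UA.
Qed.

End Frame.

End InnerProduct.

Section ModelMeasurement.
Context (R : realType) (H : vectType R[i]) (dot : {dot H for Num.conj}).
Variables (P : 'End(H)) (n : nat) (b : n.-tuple H) (lam : seq nat).
Hypothesis pP : is_projection dot P.
Hypothesis P0 : P <> 0.
Hypothesis bP : orthonormal_basis_of dot (limg (\1%VF - P)) b.
Hypothesis hlam : is_partition n lam.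
Local Notation C := R[i].
Local Notation W := (limg (\1%VF - P)).
Local Notation G := (unitary R n).
Local Notation k := (size lam).
Local Notation bo := (block_ord hlam).
Local Notation fr := (frame b).
Local Notation Hg := (block_group R n lam).

Definition block_op (B : G) (j : 'I_k) : 'End(H) := family_proj dot (fr B) (fun e => bo e == j).

Let ofr B : orthonormal_family dot (fr B) := frame_orthonormal bP B.

Lemma block_op_projection B j : is_projection dot (block_op B j).
Proof. exact: family_projection. Qed.

Lemma block_op_frame B j e : block_op B j (fr B e) = if bo e == j then fr B e else 0.
Proof. exact: family_proj_basis. Qed.

Lemma card_block_ord (j : 'I_k) : #|(fun e => bo e == j)| = nth 0%N lam j.
Proof. by rewrite -(card_block hlam j); apply: eq_card => e; rewrite !unfold_in. Qed.

Lemma rank_block_op B j : rank (block_op B j) = nth 0%N lam j.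
Proof. by rewrite rank_family_proj// card_block_ord. Qed.

Lemma frame_neq0 B e : fr B e <> 0.
Proof.
by move=> E; have := ofr B e e; rewrite E linear0l eqxx => /eqP; rewrite eq_sym oner_eq0.
Qed.

Lemma block_op_inj B : injective (block_op B).
Proof.
move=> i j E; have [e ei] := block_ord_surj hlam i.
have := congr1 (fun A : 'End(H) => A (fr B e)) E; rewrite !block_op_frame ei eqxx.
by case: eqP => // _ /frame_neq0.
Qed.

Lemma compl_op B j x : P (block_op B j x) = 0.
Proof.
apply/eqP; rewrite -(projection_compl_mem pP) family_projE; apply: memv_suml => e _.
by apply: memvZ; exact: (frame_compl bP).
Qed.

Lemma op_compl B j x : block_op B j (P x) = 0.
Proof.
apply: (dot_inj (dot := dot)) => z; rewrite (projection_dot _ _ (block_op_projection B j)).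
by rewrite (projection_dot _ _ pP) compl_op linear0r linear0l.
Qed.

Lemma block_op_neq B j : block_op B j <> P.
Proof.
move=> E; have [e ej] := block_ord_surj hlam j.
have := compl_op B j (fr B e); rewrite -E !block_op_frame ej eqxx block_op_frame ej eqxx.
exact: frame_neq0.
Qed.

Definition block_ops B := [seq block_op B j | j <- enum 'I_k].

Definition block_measurement B : {fset 'End(H)} := [fset X in P :: block_ops B]%fset.

Lemma block_measurementP B X :
  reflect (X = P \/ exists j, X = block_op B j) (X \in block_measurement B).
Proof.
rewrite !inE; apply: (iffP orP) => [[/eqP|/mapP[j _ ->]]|[->|[j ->]]]; [by left| |by left|].
  by right; exists j.
by right; apply/map_f; rewrite mem_enum.
Qed.

Lemma block_ops_uniq B : uniq (block_ops B).
Proof. by rewrite (map_inj_uniq (@block_op_inj B)) enum_uniq. Qed.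

Lemma block_measurement_rem B : perm_eq (block_measurement B `\ P)%fset (block_ops B).
Proof.
apply: uniq_perm => [||X]; [exact: fset_uniq|exact: block_ops_uniq|].
rewrite !inE; have [->|//] := eqVneq X P; apply/esym/negP => /mapP[j _ E].
exact: (block_op_neq (esym E)).
Qed.

Lemma sum_block_op B : \sum_j block_op B j = \1%VF - P.
Proof.
have -> : \1%VF - P = family_proj dot (fr B) xpredT.
  by apply: family_proj_span => //; [exact: projection_compl|rewrite (frame_span bP)].
apply/lfunP => x; rewrite sum_lfunE family_projE (partition_big bo xpredT)//=.
by apply: eq_bigr => j _; rewrite family_projE.
Qed.

Lemma block_measurement_model B : measurements_with_profile dot P lam (block_measurement B).
Proof.
split; [split; [split|]|].
- move=> X /block_measurementP[->|[j ->]]; first by split.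
  split=> [|E]; first exact: block_op_projection.
  have [e ej] := block_ord_surj hlam j.
  by have := block_op_frame B j e; rewrite E ej eqxx lfunE /= => /esym/frame_neq0.
- move=> X Y /block_measurementP[->|[j ->]] /block_measurementP[->|[l ->]] XY;
    apply/lfunP => x; rewrite comp_lfunE [RHS]lfunE /=.
  + by case: XY.
  + exact: compl_op.
  + exact: op_compl.
  + apply: family_proj_disjoint => // i /eqP ij /eqP il; apply: XY.
    by rewrite -ij -il.
- rewrite (big_fsetD1 P)/=; last by apply/block_measurementP; left.
  by rewrite (perm_big _ (block_measurement_rem B)) big_map big_enum /= sum_block_op addrC subrK.
- by apply/block_measurementP; left.
(* Both lists are sorted, so it is enough that the ranks form a permutation of [lam]. *)
- case: hlam => slam _ _; rewrite /profile; apply: (sorted_eq leq_trans anti_leq) => //.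
    exact: (sort_sorted leq_total).
  rewrite perm_sort; apply: (perm_trans (perm_map _ (block_measurement_rem B))).
  rewrite -map_comp (@eq_map _ _ _ (nth 0%N lam \o val)) => [|j /=]; last exact: rank_block_op.
  by rewrite map_comp val_enum_ord map_nth_iota0// take_size.
Qed.

(** The frame vectors of A in block j expand in those of B in block s j. Equality of block sizes
    turns this inclusion of ranges into an equality. *)
Lemma block_measurement_sub B A : Hg (B^-1 * A)%g ->
  {subset block_measurement A <= block_measurement B}.
Proof.
move=> /(block_groupP hlam)[s ms] X /block_measurementP[->|[j ->]]; apply/block_measurementP; first by left.
right; exists (s j); apply: family_proj_span => //; first exact: block_op_projection.
apply/eqP; rewrite limg_family_proj// eqEdim (dim_family_span (ofr A)) (dim_family_span (ofr B)); apply/andP; split.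
  apply: family_span_sub => e /eqP ej.
  have -> : fr A e = \sum_a dot (fr A e) (fr B a) *: fr B a.
    rewrite -(family_projE dot (fr B) xpredT) family_span_expand//.
    by rewrite (frame_span bP) (frame_compl bP).
  apply: memv_suml => a _; rewrite (dot_frame bP).
  have [->|/ms ba] := eqVneq (val (B^-1 * A)%g a e) 0; first by rewrite scale0r mem0v.
  by apply/memvZ/family_mem; rewrite ba ej.
by rewrite !card_block_ord (block_mono_size ms).
Qed.

(** If the measurements agree, each block of A has the same projection as some block of B. The
    coefficients of a frame vector of A outside that block vanish, so B^-1 A is block monomial. *)
Lemma block_measurement_eqP B A :
  block_measurement A = block_measurement B <-> coset_of_unitary lam A = coset_of_unitary lam B.
Proof.
split=> [E|/esym E]; last first.
  apply/fsetP => X; apply/idP/idP; apply: block_measurement_sub; apply/coset_eqP => //.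
have ex j : exists l, block_op A j = block_op B l.
  have : block_op A j \in block_measurement B by rewrite -E; apply/block_measurementP; right; exists j.
  by move=> /block_measurementP[/block_op_neq|].
apply/esym/coset_eqP; pose tau j := sval (cid (ex j)).
apply: (@block_group_fun R n lam hlam _ tau) => a e ae.
have tE : block_op B (tau (bo e)) (fr A e) = fr A e.
  by rewrite -(svalP (cid (ex (bo e)))) block_op_frame eqxx.
apply/eqP; apply: contraT => an; move: ae; rewrite -(dot_frame bP) -tE family_projE.
rewrite (orthonormal_coef (@ofr B)).
by rewrite (negbTE an) eqxx.
Qed.

Lemma conj_block_measurement U A B : fixing_group dot P U -> restricts_to dot b U A ->
  conj_measurement dot U (block_measurement B) = block_measurement (A * B)%g.
Proof.
move=> fU UA; have [[U1 _] UP] := fU.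
have adjU x y : dot (adjoint dot U x) y = dot x (U y) by rewrite dotC -adjointP -dotC.
have cP : (U \o P \o adjoint dot U)%VF = P.
  apply/lfunP => x; rewrite !comp_lfunE UP ?memv_img ?memvf//.
  apply: (dot_inj (dot := dot)) => z; rewrite !(projection_dot _ _ pP) adjU UP//.
  by rewrite memv_img ?memvf.
have cQ j : (U \o block_op B j \o adjoint dot U)%VF = block_op (A * B)%g j.
  apply/lfunP => x; rewrite !comp_lfunE !family_projE linear_sum; apply: eq_bigr => e _.
  by rewrite linearZ /= adjU (frame_mul_op pP bP B e fU UA).
apply/fsetP => X; apply/imfsetP/idP => [[Y /= /block_measurementP[->|[j ->]] ->]|].
- by rewrite cP; apply/block_measurementP; left.
- by rewrite cQ; apply/block_measurementP; right; exists j.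
move=> /block_measurementP[->|[j ->]].
  by exists P; [apply/block_measurementP; left|].
by exists (block_op B j); [apply/block_measurementP; right; exists j|].
Qed.

(** Orthonormal bases of the ranges, concatenated in order of rank, form a basis adapted to the
    blocks; B is its matrix in b. *)
Lemma block_measurement_surj M : measurements_with_profile dot P lam M ->
  exists B, M = block_measurement B.
Proof.
move=> [[[Mproj Morth Msum] PM] Mlam].
(* Sorting the projections by rank makes their ranks equal to [lam] entry by entry. *)
pose s := sort (relpre (@rank R H) leq) (M `\ P)%fset.
have srank : [seq rank Q | Q <- s] = lam by rewrite -Mlam /profile sort_map.
have sk : size s = k by rewrite -srank size_map.
have su : uniq s by rewrite sort_uniq fset_uniq.
have sM X : (X \in s) = (X != P) && (X \in M) by rewrite mem_sort in_fsetD1.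
pose Q (j : 'I_k) := nth 0 s j.
have Qs j : Q j \in s by rewrite mem_nth// sk.
have QM j : Q j \in M by have := Qs j; rewrite sM => /andP[].
have QP j : Q j <> P by have := Qs j; rewrite sM => /andP[/eqP].
have pQ j : is_projection dot (Q j) by have [] := Mproj _ (QM j).
have rQ j : \dim (limg (Q j)) = nth 0%N lam j.
  by have := congr1 (fun l => nth 0%N l j) srank; rewrite (nth_map 0) ?sk.
pose e j := sval (cid (orthonormal_basis_ex dot (limg (Q j)))).
have eP j : orthonormal_basis_of dot (limg (Q j)) (e j).
  exact: svalP (cid (orthonormal_basis_ex dot (limg (Q j)))).
(* Index a receives the basis vector of its own block, at its offset in that block. *)
pose c (a : 'I_n) := nth 0 (e (bo a)) (reshape_offset lam a).
have offa (a : 'I_n) : (reshape_offset lam a < size (e (bo a)))%N.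
  by rewrite size_tuple rQ; apply: reshape_offsetP; case: hlam => _ _ ->.
have cQ a : c a \in limg (Q (bo a)).
  by rewrite -(eP (bo a)).2 memv_span// mem_nth.
have Qc a : Q (bo a) (c a) = c a by exact: projection_fix (pQ _) (cQ a).
have oc : orthonormal_family dot c.
  move=> a a'; have [E|E] := eqVneq (bo a) (bo a').
    have [/orthonormalP[ue oe] _] := eP (bo a).
    have cE : c a' = nth 0 (e (bo a)) (reshape_offset lam a') by rewrite [in RHS]E.
    have oa' : (reshape_offset lam a' < size (e (bo a)))%N by rewrite E; exact: offa.
    rewrite cE oe ?mem_nth ?offa// nth_uniq ?offa//.
    suff -> : (reshape_offset lam a == reshape_offset lam a') = (a == a') by [].
    apply/eqP/eqP => [oE|->//]; apply: val_inj => /=.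
    rewrite -(reshape_indexK lam a) -(reshape_indexK lam a') oE.
    by have /(congr1 val) /= -> := E.
  rewrite (negbTE (_ : a != a')); last by apply: contra E => /eqP ->.
  rewrite -Qc -(Qc a') (projection_dot _ _ (pQ _)) -[Q _ (Q _ _)]comp_lfunE.
  rewrite Morth ?lfunE ?linear0r// => /eqP; rewrite nth_uniq ?sk//.
  by rewrite (inj_eq val_inj) (negbTE E).
have cW a : c a \in W.
  rewrite (projection_compl_mem pP) -Qc -comp_lfunE Morth ?lfunE// => E.
  exact: QP (esym E).
have [B Bc] := frame_ex bP oc cW.
have BQ j : block_op B j = Q j.
  apply/esym/(family_proj_span (@ofr B)) => //; apply/esym/eqP.
  rewrite eqEdim (dim_family_span (@ofr B)) card_block_ord rQ leqnn andbT.
  by apply: family_span_sub => a /eqP <-; rewrite Bc.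
exists B; apply/fsetP => X; apply/idP/block_measurementP => [XM|[->//|[j ->]]]; last by rewrite BQ.
have [->|XP] := eqVneq X P; first by left.
have Xs : X \in s by rewrite sM XP.
have Xk : (index X s < k)%N by rewrite -sk index_mem.
by right; exists (Ordinal Xk); rewrite BQ /Q nth_index.
Qed.

End ModelMeasurement.

Section Model.
Context (R : realType) (H : vectType R[i]) (dot : {dot H for Num.conj}).
Variables (P : 'End(H)) (n : nat) (b : n.-tuple H) (lam : seq nat).
Hypothesis pP : is_projection dot P.
Hypothesis P0 : P <> 0.
Hypothesis bP : orthonormal_basis_of dot (limg (\1%VF - P)) b.
Hypothesis hlam : is_partition n lam.
Local Notation G := (unitary R n).
Local Notation Q := (block_quotient R n lam).
Local Notation pi := (@coset_of_unitary R n lam).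
Local Notation M := (measurements_with_profile dot P lam).
Local Notation bm := (block_measurement dot P b hlam).

Lemma model_frame_ex (m : M) : exists B, val m = bm B.
Proof. exact: (block_measurement_surj pP bP hlam (set_valP m)). Qed.

Definition measurement_coset (m : M) : Q := pi (sval (cid (model_frame_ex m))).

Definition coset_measurement (q : Q) : M :=
  SigSub (mem_set (block_measurement_model pP P0 bP hlam (generic_quotient.repr q))).

Definition measurement_act (A : G) (m : M) : M :=
  coset_measurement (coset_act A (measurement_coset m)).

Lemma measurement_coset_eq m B : val m = bm B -> measurement_coset m = pi B.
Proof.
move=> mB; apply/(block_measurement_eqP pP bP hlam).
by rewrite -(svalP (cid (model_frame_ex m))).
Qed.

Lemma coset_measurementE B : val (coset_measurement (pi B)) = bm B.
Proof. by apply/(block_measurement_eqP pP bP hlam); exact: reprK. Qed.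

Lemma measurement_cosetK : cancel measurement_coset coset_measurement.
Proof.
move=> m; have [B mB] := model_frame_ex m; apply: val_inj.
by rewrite (measurement_coset_eq mB) coset_measurementE.
Qed.

Lemma coset_measurementK : cancel coset_measurement measurement_coset.
Proof.
by move=> q; have [B <-] := coset_surj q; apply: measurement_coset_eq; exact: coset_measurementE.
Qed.

Lemma measurement_act_coset A m B : measurement_coset m = pi B ->
  measurement_coset (measurement_act A m) = pi (A * B)%g.
Proof. by move=> mB; rewrite coset_measurementK mB coset_actE. Qed.

Lemma measurement_act_conj U A m : fixing_group dot P U -> restricts_to dot b U A ->
  val (measurement_act A m) = conj_measurement dot U (val m).
Proof.
move=> fU UA; have [B mB] := model_frame_ex m.
rewrite /measurement_act (measurement_coset_eq mB) coset_actE coset_measurementE mB.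
by rewrite (conj_block_measurement pP bP hlam B fU UA).
Qed.

Lemma flag_homogeneous_model : homogeneous_model dot P b lam (flag_dim n lam).
Proof.
have cH := @block_group_closed R n lam hlam.
have o1 := @flag_nbhd_open R n lam hlam.
have o2 := @flag_nbhd1 R n lam hlam.
have o3 := @flag_coord_smooth R n lam hlam.
have o4 := @flag_coord_continuous R n lam hlam.
have o5 := @flag_section_smooth R n lam.
have o6 := @flag_coord_eqP R n lam hlam.
have o7 := @flag_section_nbhd R n lam hlam.
have o8 x (_ : flag_nbhd hlam (flag_section x)) := @flag_sectionK R n lam x.
exists measurement_act, measurement_coset, coset_measurement.
exists (coset_atlas (flag_nbhd hlam) (@flag_coord R n lam) (@flag_section R n lam)).
exists (@pull_atlas R n lam _ (flag_nbhd hlam) (@flag_coord R n lam) (@flag_section R n lam)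
  _ measurement_coset coset_measurement).
split.
- exact: measurement_act_conj.
- split; [exact: measurement_cosetK|exact: coset_measurementK|move=> A B m].
  exact: measurement_act_coset.
- split; first exact: (coset_smooth_manifold o1 o2 o3 o4 o5 o6 o7 o8 cH).
  exact: (coset_submersion o1 o3 o5 o6 o7 o8).
- exact: (pull_diffeo o1 o2 o3 o4 o5 o6 o7 o8 coset_measurementK cH).
- split; first exact: (pull_compact measurement_cosetK coset_measurementK).
  exact: (pull_homogeneous o1 o2 o3 o4 o5 o6 o7 o8 measurement_cosetK coset_measurementK
    measurement_act_coset cH).
Qed.

End Model.

(** * Dimensions and complementary rank profiles *)

Section Profiles.
Context (R : realType) (H : vectType R[i]) (dot : {dot H for Num.conj}).

(** The sum is direct: Q annihilates the other ranges and is the identity on its own. *)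
Lemma dim_orthogonal_limg (s : seq 'End(H)) : uniq s ->
  (forall Q, Q \in s -> is_projection dot Q) ->
  (forall Q Q', Q \in s -> Q' \in s -> Q <> Q' -> (Q \o Q')%VF = 0) ->
  \dim (\sum_(Q <- s) limg Q)%VS = (\sum_(Q <- s) rank Q)%N.
Proof.
elim: s => [|Q s IH] /=; first by rewrite !big_nil dimv0.
move=> /andP[Qs us] ps os; rewrite !big_cons dimv_disjoint_sum ?IH//.
- by move=> Q' Q's; apply: ps; rewrite inE Q's orbT.
- by move=> Q1 Q2 Q1s Q2s; apply: os; rewrite inE ?Q1s ?Q2s orbT.
apply/eqP; rewrite -subv0; apply/subvP => x; rewrite memv_cap memv0 => /andP[xQ xs].
have pQ : is_projection dot Q by apply: ps; rewrite inE eqxx.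
have /subvP/(_ x xs) : (\sum_(Q' <- s) limg Q' <= lker Q)%VS.
  rewrite big_seq; elim/big_ind: _ => [|U V UQ VQ|Q' Q's]; first exact: sub0v.
    by rewrite subv_add UQ.
  apply/subvP => _ /memv_imgP[y _ ->]; rewrite memv_ker -comp_lfunE os ?lfunE ?inE ?eqxx ?Q's ?orbT//.
  by move=> E; rewrite E Q's in Qs.
by rewrite memv_ker (projection_fix pQ xQ).
Qed.

Variable P : 'End(H).
Hypothesis pP : is_projection dot P.
Local Notation n := (\dim {: H} - rank P)%N.

Lemma dim_projection_compl : \dim (limg (\1%VF - P)) = n.
Proof.
have -> : limg (\1%VF - P) = lker P.
  by apply/vspaceP => x; rewrite (projection_compl_mem pP) memv_ker.
by rewrite -(limg_ker_dim P {:H}) capfv /rank addnK.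
Qed.

Lemma projection_compl_basis :
  exists b : n.-tuple H, orthonormal_basis_of dot (limg (\1%VF - P)) b.
Proof.
have [b ob] := orthonormal_basis_ex dot (limg (\1%VF - P)).
(* Moves the length of the tuple, which is part of its type, along the equality of dimensions. *)
by move: b ob; rewrite {1 2}dim_projection_compl => b ob; exists b.
Qed.

(** The projections sum to the identity, so their ranges span the space and the ranks add up to its
    dimension; removing the rank of P leaves n. *)
Lemma profile_partition M : measurements_at dot P M -> is_partition n (profile P M).
Proof.
move=> [[Mproj Morth Msum] PM]; split; first exact: (sort_sorted leq_total).
  rewrite /profile mem_sort; apply/mapP => -[Q]; rewrite !inE => /andP[_ QM] /esym/eqP.
  rewrite dimv_eq0 => /eqP Q0; have [_] := Mproj Q QM; apply; apply/lfunP => x.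
  by rewrite lfunE /=; apply/eqP; rewrite -memv0 -Q0 memv_img ?memvf.
rewrite sumnE (perm_big _ (permEl (perm_sort _ _))).
rewrite big_map; have sM : \dim {:H} = (\sum_(Q <- M) rank Q)%N.
  rewrite -dim_orthogonal_limg ?fset_uniq// => [|Q /Mproj[]//].
  congr (\dim _); apply/eqP; rewrite eqEsubv subvf andbT; apply/subvP => x _.
  rewrite -[x]id_lfunE -Msum sum_lfunE big_seq; apply: memv_suml => Q QM.
  have /subvP : (limg Q <= \sum_(Q' <- M) limg Q')%VS by rewrite (big_rem _ QM) addvSl.
  by apply; rewrite memv_img ?memvf.
by rewrite sM (big_fsetD1 P PM) /= addKn.
Qed.

End Profiles.

Lemma partition_size n lam : is_partition n lam ->
  (size lam <= n)%N /\ forall i, (nth 0%N lam i <= n)%N.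
Proof.
move=> [_ + <-]; elim: lam => [_|r l IH]; first by split=> // i; rewrite nth_nil.
rewrite inE negb_or => /andP[r0 /IH[sl nl]] /=; split.
  by rewrite -addn1 addnC leq_add// lt0n eq_sym.
move=> [|i] /=; first exact: leq_addr.
exact: leq_trans (nl i) (leq_addl _ _).
Qed.

(** A partition of n is encoded by its length and by n values, all bounded by n. The values past the
    length are the default 0, and [take] removes them. *)
Lemma finite_partitions n : finite_set [set lam | is_partition n lam].
Proof.
pose F (p : 'I_n.+1 * {ffun 'I_n -> 'I_n.+1}) :=
  take p.1 [seq nat_of_ord (p.2 i) | i <- enum 'I_n].
apply: (@sub_finite_set _ _ (range F)); last exact/finite_image/finite_finset.
move=> lam hlam; have [sl nl] := partition_size hlam.
exists (inord (size lam), [ffun i : 'I_n => inord (nth 0%N lam i)]) => //.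
rewrite /F /= inordK//.
rewrite (@eq_map _ _ _ (nth 0%N lam \o val)) => [|i]; last by rewrite /= ffunE inordK// ltnS.
rewrite map_comp val_enum_ord -map_take take_iota (minn_idPl sl).
by rewrite map_nth_iota0// take_size.
Qed.
Local Close Scope complex_scope.
Local Close Scope sesquilinear_scope.

Theorem proposition3p2 (R : realType) (H : vectType R[i])
    (dot : {dot H for Num.conj}) (P : 'End(H)) :
  (2 <= \dim {: H})%N -> is_projection dot P -> P <> 0 ->
  let n := (\dim {: H} - rank P)%N in
  [/\ forall lam : seq nat, is_partition n lam -> n = 0%N ->
        P = \1%VF /\
        (exists M, measurements_with_profile dot P lam = [set M]),
      forall lam : seq nat, is_partition n lam -> (1 <= n)%N ->
        [/\ closed (block_group R n lam),
            block_group_is_wreath_prod R n lam &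
            forall b : n.-tuple H,
              orthonormal_basis_of dot (limg (\1%VF - P)) b ->
              exists N : nat,
                [/\ N%:Z = n%:Z ^+ 2
                      - \sum_(s <- undup lam) (count_mem s lam)%:Z * s%:Z ^+ 2,
                    N%:Z = n%:Z ^+ 2 - \sum_(r <- lam) r%:Z ^+ 2 &
                    homogeneous_model dot P b lam N]] &
      [/\ finite_set [set lam | is_partition n lam],
          measurements_at dot P =
            \bigcup_(lam in [set lam | is_partition n lam])
              measurements_with_profile dot P lam,
          trivIset [set lam | is_partition n lam]
            (measurements_with_profile dot P) &
          forall lam : seq nat, is_partition n lam ->
            exists b : n.-tuple H,
              orthonormal_basis_of dot (limg (\1%VF - P)) b /\
              exists N : nat, homogeneous_model dot P b lam N]].

Proof.
move=> dH pP P0 n; have [b0 ob0] := projection_compl_basis pP.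
split.
- move=> lam hlam n0; split.
    apply/lfunP => x; rewrite id_lfunE; apply/eqP; rewrite eq_sym -subr_eq0.
    have -> : x - P x = (\1%VF - P) x by rewrite add_lfunE opp_lfunE id_lfunE.
    rewrite -memv0; suff <- : limg (\1%VF - P) = 0%VS by rewrite memv_img ?memvf.
    by apply/eqP; rewrite -dimv_eq0 (dim_projection_compl pP); apply/eqP.
  exists (block_measurement dot P b0 hlam 1%g); apply/seteqP; split=> [M /(block_measurement_surj pP ob0 hlam)[B ->]|_ ->].
    (* For n = 0 a unitary matrix has no entries, so there is only one, and hence only one
       measurement. *)
    rewrite (_ : B = 1%g)//; apply: val_inj; apply/matrixP => i.
    by have := ltn_ord i; rewrite [X in (_ < X)%N -> _]n0.
  exact: block_measurement_model.
- move=> lam hlam n1; split; [exact: block_group_closed|exact: block_group_wreath|].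
  move=> b bP; exists (flag_dim n lam); split; last exact: flag_homogeneous_model.
    by rewrite sum_count_sqr; exact: flag_dimE.
  exact: flag_dimE.
- split; first exact: finite_partitions.
  + apply/seteqP; split=> [M PM|M [lam _ []]//].
    by exists (profile P M) => //; exact: (profile_partition PM).
  + by move=> lam lam' _ _ [M [[_ <-] [_ <-]]].
  move=> lam hlam; exists b0; split=> //.
  by exists (flag_dim n lam); exact: flag_homogeneous_model.
Qed.
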